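(* Let $T$ be a JEP-refinement of $T_{\mathrm{E\text{-}field}}$ and $\mathfrak{F}$ a monster model for $T$. For small subsets $A,B,C$ of $\mathfrak{F}$ let $A\perp_C B$ mean that $\langle A\cup C\rangle^{\mathrm{EA}}$ and $\langle B\cup C\rangle^{\mathrm{EA}}$ are ACF-independent over $\langle C\rangle^{\mathrm{EA}}$. Then $\perp$ is $\mathrm{Aut}(\mathfrak{F})$-invariant and, for every small EA-subfield $F$ of $\mathfrak{F}$ (in particular every small existentially closed model) and all small tuples from $\mathfrak{F}$, satisfies: (i) strong finite character: if $\bar a\not\perp_F\bar b$, there is an existential formula $\phi(\bar x,\bar b,\bar m)\in\mathrm{etp}(\bar a/\bar bF)$ such that every realisation $\bar a'$ satisfies $\bar a'\not\perp_F\bar b$; (ii) $\bar a\perp_F F$; (iii) $\bar a\bar a'\perp_F\bar b\bar b'$ implies $\bar a\perp_F\bar b$; (iv) $\bar a\perp_F\bar b$ implies $\bar b\perp_F\bar a$; (v) if $\bar c_1\perp_F\bar c_2$, $\bar b_1\perp_F\bar c_1$, $\bar b_2\perp_F\bar c_2$ and $\bar b_1\equiv_F\bar b_2$, then there is $\bar b$ with $\bar b\equiv_{\bar c_1F}\bar b_1$ and $\bar b\equiv_{\bar c_2F}\bar b_2$. Consequently, $\mathcal{EC}(T)$ is $\mathrm{NSOP}_1$.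
   Context: $T_{\mathrm{E\text{-}field}}$ is the theory of exponential fields (fields of characteristic $0$ with a homomorphism $E:(F,+)\to(F^\times,\cdot)$) in the language $\{+,-,\cdot,0,1,E\}$; an EA-field is an exponential field whose underlying field is algebraically closed, and $\langle X\rangle^{\mathrm{EA}}$ is the smallest EA-subfield of $\mathfrak{F}$ containing $X$. For subfields $C\subseteq A,B$ of an algebraically closed field, $A,B$ are ACF-independent over $C$ if $\mathrm{td}(\bar a/B)=\mathrm{td}(\bar a/C)$ for all finite tuples $\bar a$ from $A$. A model $M$ of an inductive theory is existentially closed if every existential formula over $M$ true in some extension of $M$ that models the theory is true in $M$; $\mathcal{EC}(T)$ is the category of existentially closed models of $T$. A JEP-refinement of $T_{\mathrm{E\text{-}field}}$ is an inductive extension with the joint embedding property all of whose existentially closed models are existentially closed models of $T_{\mathrm{E\text{-}field}}$. An amalgamation base is a model $A\models T$ such that any two embeddings of $A$ into models of $T$ can be amalgamated over $A$. A monster model is a model $\mathfrak{F}$ of $T$ of large cardinality $\kappa$ into which every model of size $\le\kappa$ embeds and such that any two embeddings $f_1,f_2$ of an amalgamation base into $\mathfrak{F}$ satisfy $\theta\circ f_1=f_2$ for some $\theta\in\mathrm{Aut}(\mathfrak{F})$; ''small'' means of size $<\kappa$. $\mathrm{etp}(\bar a/B)$ is the set of existential formulas over $B$ true of $\bar a$, and $\bar a\equiv_B\bar b$ means equal $\mathrm{etp}$ over $B$. An existential formula $\phi(\bar x,\bar y)$ has $\mathrm{SOP}_1$ with respect to $\mathcal{EC}(T)$ if there are an amalgamation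 base $A\models T$, an existential formula $\psi(\bar y_1,\bar y_2)$ and parameters $(\bar a_\eta)_{\eta\in2^{<\omega}}$ from $A$ with: (i) for every $\sigma\in2^\omega$, $\{\phi(\bar x,\bar a_{\sigma|_n}):n<\omega\}$ is realised in some model $B\supseteq A$ of $T$; (ii) $T\vdash\neg\exists\bar x\bar y_1\bar y_2[\psi(\bar y_1,\bar y_2)\wedge\phi(\bar x,\bar y_1)\wedge\phi(\bar x,\bar y_2)]$; (iii) $A\models\psi(\bar a_{\eta^\frown1},\bar a_\nu)$ whenever $\eta^\frown0\preceq\nu$. $\mathcal{EC}(T)$ is $\mathrm{NSOP}_1$ if no existential formula has $\mathrm{SOP}_1$.
   Formalization: In the definition of monster model, homogeneity is required only for small amalgamation bases (for bases of size κ it is contradictory), and the monster model is taken to be existentially closed, without which ⟨X⟩^EA need not exist; ''large'' is read as uncountable. *)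

(* Defs.v *)
From HB Require Import structures.
From mathcomp Require Import all_boot all_algebra.
From mathcomp Require Import boolp classical_sets functions cardinality.
From mathcomp Require Import mpoly.

Set Implicit Arguments.
Unset Strict Implicit.
Unset Printing Implicit Defensive.

Import GRing.Theory.
Local Open Scope classical_set_scope.
Local Open Scope card_scope.
Local Open Scope ring_scope.

Record structure := Structure {
  carrier :> Type;
  szero : carrier;
  sone : carrier;
  sadd : carrier -> carrier -> carrier;
  sopp : carrier -> carrier;
  smul : carrier -> carrier -> carrier;
  sexp : carrier -> carrier }.

Inductive term (V : Type) : Type :=
  | Var of V
  | Zero
  | One
  | Add of term V & term V
  | Opp of term V
  | Mul of term V & term V
  | Exp of term V.

Arguments Zero {V}.
Arguments One {V}.

(* The free variables of a [formula V] are indexed by the arbitrary type [V],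
   so that parameters can be used as names for themselves. A quantifier binds
   the variable [None] of [option V]. *)
Inductive formula (V : Type) : Type :=
  | Eq of term V & term V
  | Not of formula V
  | And of formula V & formula V
  | Or of formula V & formula V
  | Ex of formula (option V)
  | All of formula (option V).

Fixpoint eval (M : structure) (V : Type) (v : V -> M) (t : term V) : M :=
  match t with
  | Var x => v x
  | Zero => szero M
  | One => sone M
  | Add s t => sadd (eval v s) (eval v t)
  | Opp s => sopp (eval v s)
  | Mul s t => smul (eval v s) (eval v t)
  | Exp s => sexp (eval v s)
  end.

Fixpoint sat (M : structure) (V : Type) (v : V -> M) (phi : formula V) : Prop :=
  match phi with
  | Eq s t => eval v s = eval v t
  | Not f => ~ sat v f
  | And f g => sat v f /\ sat v g
  | Or f g => sat v f \/ sat v g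
  | Ex f => exists x : M, sat (oapp v x) f
  | All f => forall x : M, sat (oapp v x) f
  end.

Fixpoint quantifier_free (V : Type) (phi : formula V) : bool :=
  match phi with
  | Eq _ _ => true
  | Not f => quantifier_free f
  | And f g | Or f g => quantifier_free f && quantifier_free g
  | Ex _ | All _ => false
  end.

Fixpoint existential (V : Type) (phi : formula V) : bool :=
  if phi is Ex f then existential f else quantifier_free phi.

Fixpoint forall_exists (V : Type) (phi : formula V) : bool :=
  if phi is All f then forall_exists f else existential phi.

Definition sentence := formula void.
Definition theory := set sentence.

Definition models (T : theory) (M : structure) : Prop :=
  forall s, T s -> sat (of_void M) s.

Definition extends (T0 T : theory) : Prop :=
  forall M, models T M -> models T0 M.

Definition inductive_theory (T : theory) : Prop :=
  exists2 S : theory, (forall s, S s -> forall_exists s)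
                    & forall M, models T M <-> models S M.

Definition embedding (M N : structure) (f : M -> N) : Prop :=
  [/\ injective f,
      f (szero M) = szero N /\ f (sone M) = sone N,
      forall x y, f (sadd x y) = sadd (f x) (f y),
      forall x y, f (smul x y) = smul (f x) (f y)
    & (forall x, f (sopp x) = sopp (f x))
      /\ (forall x, f (sexp x) = sexp (f x))].

Definition automorphism (M : structure) (f : M -> M) : Prop :=
  embedding f /\ bijective f.

(* Extensions are rendered by embeddings. An existential formula over [M] is
   a formula whose variables are elements of [M]. *)
Definition existentially_closed (T : theory) (M : structure) : Prop :=
  models T M /\
  forall (N : structure) (f : M -> N), models T N -> embedding f ->
  forall phi : formula M, existential phi -> sat f phi -> sat (id : M -> M) phi.

Definition joint_embedding (T : theory) : Prop :=
  forall M1 M2, models T M1 -> models T M2 ->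
  exists N : structure, models T N /\
    exists (g1 : M1 -> N) (g2 : M2 -> N), embedding g1 /\ embedding g2.

Definition JEP_refinement (T0 T : theory) : Prop :=
  [/\ inductive_theory T, extends T0 T, joint_embedding T
    & forall M, existentially_closed T M -> existentially_closed T0 M].

Definition amalgamation_base (T : theory) (A : structure) : Prop :=
  models T A /\
  forall (M1 M2 : structure) (f1 : A -> M1) (f2 : A -> M2),
    models T M1 -> models T M2 -> embedding f1 -> embedding f2 ->
  exists (N : structure) (g1 : M1 -> N) (g2 : M2 -> N),
    [/\ models T N, embedding g1, embedding g2
      & forall a, g1 (f1 a) = g2 (f2 a)].

Definition small (K U : Type) (X : set U) : Prop :=
  (X #<= [set: K]) /\ ~ ([set: K] #<= X).

(* The cardinal kappa is the cardinality of [F] itself, and "large" is read as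
   uncountable, i.e. larger than the language. The clauses on universality and
   homogeneity alone do not make [F] existentially closed, nor even
   algebraically closed. Homogeneity is over small amalgamation bases: over
   bases of size kappa it fails for the identity and a non-surjective
   self-embedding of [F]. *)
Definition monster (T : theory) (F : structure) : Prop :=
  [/\ existentially_closed T F,
      ~ countable [set: F],
      (forall M : structure, models T M -> [set: M] #<= [set: F] ->
         exists f : M -> F, embedding f)
    & forall (A : structure) (f1 f2 : A -> F),
        amalgamation_base T A -> small F [set: A] ->
        embedding f1 -> embedding f2 ->
        exists theta : F -> F,
          automorphism theta /\ forall a, theta (f1 a) = f2 a].

Definition with_params (M : structure) (I : Type) (B : set M) (a : I -> M)
    (x : I + B) : M :=
  match x with inl i => a i | inr b => val b end.

Definition etp (M : structure) (I : Type) (B : set M) (a : I -> M) :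
    set (formula (I + B)) :=
  [set phi | existential phi /\ sat (with_params a) phi].
Arguments etp {M I} B a.

Definition join_tuple (M I J : Type) (a : I -> M) (b : J -> M) (x : I + J) : M :=
  match x with inl i => a i | inr j => b j end.

(* [mkseq s n] is the restriction of the branch [s] to [n]. *)
Definition SOP1 (T : theory) (n m : nat) (phi : formula ('I_n + 'I_m)) : Prop :=
  exists (A : structure) (psi : formula ('I_m + 'I_m))
         (a : seq bool -> 'I_m -> A),
    [/\ amalgamation_base T A /\ existential psi,
        forall s : nat -> bool,
          exists (B : structure) (f : A -> B) (x : 'I_n -> B),
            [/\ models T B, embedding f
              & forall k, sat (join_tuple x (f \o a (mkseq s k))) phi],
        forall M : structure, models T M ->
          ~ exists (x : 'I_n -> M) (y1 y2 : 'I_m -> M),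
              [/\ sat (join_tuple y1 y2) psi, sat (join_tuple x y1) phi
                & sat (join_tuple x y2) phi]
      & forall eta nu, prefix (rcons eta false) nu ->
          sat (join_tuple (a (rcons eta true)) (a nu)) psi].

Definition NSOP1 (T : theory) : Prop :=
  forall (n m : nat) (phi : formula ('I_n + 'I_m)),
    existential phi -> ~ SOP1 T phi.

Local Notation x0 := (Var None).
Local Notation x1 := (Var (Some None)).
Local Notation x2 := (Var (Some (Some None))).

Inductive Efield_theory : theory :=
  | ax_addA : Efield_theory
      (All (All (All (Eq (Add x0 (Add x1 x2)) (Add (Add x0 x1) x2)))))
  | ax_addC : Efield_theory (All (All (Eq (Add x0 x1) (Add x1 x0))))
  | ax_add0 : Efield_theory (All (Eq (Add Zero x0) x0))
  | ax_addN : Efield_theory (All (Eq (Add (Opp x0) x0) Zero))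
  | ax_mulA : Efield_theory
      (All (All (All (Eq (Mul x0 (Mul x1 x2)) (Mul (Mul x0 x1) x2)))))
  | ax_mulC : Efield_theory (All (All (Eq (Mul x0 x1) (Mul x1 x0))))
  | ax_mul1 : Efield_theory (All (Eq (Mul One x0) x0))
  | ax_mulD : Efield_theory
      (All (All (All (Eq (Mul (Add x0 x1) x2) (Add (Mul x0 x2) (Mul x1 x2))))))
  | ax_inv : Efield_theory (All (Ex (Or (Eq x1 Zero) (Eq (Mul x0 x1) One))))
  (* [n = 0] is the axiom 1 <> 0 *)
  | ax_char0 (n : nat) : Efield_theory (Not (Eq (iter n (Add One) One) Zero))
  | ax_expD : Efield_theory
      (All (All (Eq (Exp (Add x0 x1)) (Mul (Exp x0) (Exp x1)))))
  | ax_exp_neq0 : Efield_theory (All (Not (Eq (Exp x0) Zero))).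

HB.mixin Record Field_isExpField F of GRing.Field F := {
  expf_char0 : [pchar F] =i pred0;
  expf : F -> F;
  expfD : forall x y, expf (x + y) = expf x * expf y;
  expf_neq0 : forall x, expf x != 0 }.

#[short(type="expFieldType")]
HB.structure Definition ExpField := {F of Field_isExpField F & GRing.Field F}.

Definition efield_structure (F : expFieldType) : structure :=
  @Structure F 0 1 +%R -%R *%R expf.

Canonical efield_structure.
Coercion efield_structure : expFieldType >-> structure.

(* By the next two lemmas, ranging over [expFieldType] instead of the models of
   [Efield_theory] loses no generality. *)
Lemma efield_structure_models (F : expFieldType) :
  models Efield_theory (efield_structure F).
Proof.
move=> s; case=> [||||||||| n ||] /=.
- by move=> x y z; rewrite addrA.
- by move=> x y; rewrite addrC.
- by move=> x; rewrite add0r.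
- by move=> x; rewrite addNr.
- by move=> x y z; rewrite mulrA.
- by move=> x y; rewrite mulrC.
- by move=> x; rewrite mul1r.
- by move=> x y z; rewrite mulrDl.
- move=> x; have [-> | x_neq0] := eqVneq x 0; first by exists 0; left.
  by exists x^-1; right; rewrite mulVf.
- suff -> : eval (of_void (efield_structure F)) (iter n (Add One) One)
          = n.+1%:R :> F.
    by move/eqP; rewrite ((pcharf0P F).1 (@expf_char0 F)).
  by elim: n => [|n IH] //; rewrite -[n.+2%:R]nat1r -IH.
- by move=> x y; rewrite expfD.
- by move=> x; apply/eqP; exact: expf_neq0.
Qed.

Lemma models_efield_structure (M : structure) : models Efield_theory M ->
  exists F : expFieldType, M = efield_structure F.
Proof.
move=> HM.
have addA := HM _ ax_addA; have addC := HM _ ax_addC.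
have add0 := HM _ ax_add0; have addN := HM _ ax_addN.
have mulA := HM _ ax_mulA; have mulC := HM _ ax_mulC.
have mul1 := HM _ ax_mul1; have mulD := HM _ ax_mulD.
have inv := HM _ ax_inv; have ch0 := fun n => HM _ (ax_char0 n).
have expD := HM _ ax_expD; have exp0 := HM _ ax_exp_neq0.
case: M HM addA addC add0 addN mulA mulC mul1 mulD inv ch0 expD exp0
  => M z o a n m e _ /=.
move=> addA addC add0 addN mulA mulC mul1 mulD inv ch0 expD exp0.
pose M1 : choiceType := HB.pack M (gen_eqMixin M) (gen_choiceMixin M).
pose M2 : zmodType := HB.pack M1 (GRing.isZmodule.Build M1
  (fun x y z => addA z y x) (fun x y => addC y x) add0 addN).
have oneq0 : o != z :> M1 by apply/eqP; exact: (ch0 0%N).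
pose M3 : comNzRingType := HB.pack M2 (GRing.Zmodule_isComNzRing.Build M2
  (fun x y z => mulA z y x) (fun x y => mulC y x) mul1
  (fun x y z => mulD z y x) oneq0).
have /choice[i iP] : forall x : M, exists y,
    (x <> z -> m y x = o) /\ (x = z -> y = z).
  move=> x; have [->|xz] := pselect (x = z); first by exists z.
  by have [y [//|yP]] := inv x; exists y.
have mulV (x : M3) : x != 0 -> (i x : M3) * x = 1 by move/eqP=> xz; apply: (iP x).1.
have inv0 : i (0 : M3) = 0 :> M3 by apply: (iP _).2.
pose M4 : fieldType := HB.pack M3 (GRing.ComNzRing_isField.Build M3 mulV inv0).
have char0 : [pchar M4] =i pred0.
  apply/pcharf0P => -[|k]; first by rewrite mulr0n !eqxx.
  apply/negbTE/eqP => k0; apply: (ch0 k).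
  rewrite -[RHS]k0.
  elim: k {k0} => [|k IH] //.
  by rewrite -[k.+2%:R]nat1r -IH.
have expD' (x y : M4) : (e : M4 -> M4) (x + y) = (e : M4 -> M4) x * (e : M4 -> M4) y by exact: expD.
have exp0' (x : M4) : (e : M4 -> M4) x != 0 by apply/eqP; exact: exp0.
pose M5 : expFieldType := HB.pack M4 (Field_isExpField.Build M4 char0 expD' exp0').
by exists M5.
Qed.

Definition EA_subfield (F : expFieldType) (K : set F) : Prop :=
  [/\ divring_closed (mem K), forall x, K x -> K (expf x)
    & forall p : {poly F}, p \is a polyOver (mem K) -> (1 < size p)%N ->
        exists2 x, K x & root p x].

Definition EA_hull (F : expFieldType) (X : set F) : set F :=
  smallest (@EA_subfield F) X.

Definition alg_indep (F : expFieldType) (B : set F) (n : nat) (a : 'I_n -> F) :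
    Prop :=
  forall p : {mpoly F[n]}, p \is a mpolyOver n (mem B) -> p.@[a] = 0 -> p = 0.

(* For a subfield [B], a maximal algebraically independent subtuple of [a] is a
   transcendence basis of B(a) over [B]. *)
Definition td (F : expFieldType) (B : set F) (n : nat) (a : 'I_n -> F) : nat :=
  \max_(J : {set 'I_n} | `[< alg_indep B (fun j : 'I_#|J| => a (enum_val j)) >])
     #|J|.

Definition ACF_indep (F : expFieldType) (A B C : set F) : Prop :=
  forall (n : nat) (a : 'I_n -> F), (forall i, A (a i)) -> td B a = td C a.

(* [EA_indep A C B] is the relation "A is independent from B over C"; the base
   is the middle argument. *)
Definition EA_indep (F : expFieldType) (A C B : set F) : Prop :=
  ACF_indep (EA_hull (A `|` C)) (EA_hull (B `|` C)) (EA_hull C).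

(* Main.v *)
(** Independence of EA-subfields over an EA-subfield [K] is linear disjointness,
    and it is witnessed by specialisations: if [A] is independent from [B] over
    [K], any finite part of [A] can be specialised into [K] while fixing [B].
    This gives symmetry. Ultraproducts of specialisations replace tensor
    products: a field extension of an algebraically closed field [H] embeds
    over [H] in an ultrapower of [H], which is linearly disjoint from the
    diagonal of any larger field.

    For the independence theorem the extensions [D1] and [D2] of [F]'s subfields
    [C1] and [C2] are placed in such an ultrapower, with the common part [B]
    inside the ultrapower of [K], so that a relation [d1 + d2 + f = 0] only
    involves [B], [C1] and [C2]. Hence the exponentials agree and extend, by [1]
    on a linear complement, to an exponential field containing [F]. Since [F] is
    existentially closed this field embeds in an ultrapower of [F], and
    Loewenheim-Skolem, universality and homogeneity bring the realisation back
    to [F].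

    Strong finite character follows from symmetry: elements of the hull of
    [b K] lie in finite existentially definable sets, and the finitely many
    conjugates that are dependent over [K] can be excluded by inequations.

    If a formula had SOP1, a tree of parameters would exist in an elementary
    extension of [F]. A pigeonhole argument selects along one branch pairs
    [c_(i,0), c_(i,1)] whose types over a countable EA-subfield [M] agree more and
    more; their limits along an ultrafilter are coheirs over [M], hence
    independent, and the amalgamation contradicts the inconsistency required
    by SOP1. *)

Require Import Defs.
From Stdlib Require List.
From HB Require Import structures.
From mathcomp Require Import all_boot all_algebra all_field.
From mathcomp Require Import boolp classical_sets functions cardinality filter.
From mathcomp Require Import mpoly ring.

Set Implicit Arguments.
Unset Strict Implicit.
Unset Printing Implicit Defensive.

Import GRing.Theory.
Local Open Scope classical_set_scope.
Local Open Scope card_scope.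
Local Open Scope ring_scope.

(** * Existential formulas and ultrapowers *)

Section Substitution.

(** An exponential on an amalgam is well defined only if every additive relation among its parts
    forces the corresponding multiplicative relation among exponentials, so the proof has to control
    sums of elements from different subfields. Linear disjointness is made for that. The amalgam
    only has to be an exponential field: no new exponential equation is solved in it, since
    existential closedness of [F] does the rest. The base [K] is algebraically closed, hence a
    finitely generated domain over [K] has a homomorphism to [K] over [K] that avoids a given
    nonzero element. The embeddings that build the amalgam are ultraproducts of such homomorphisms.
    [NSOP1] is not derived from (v) inside [F]: the limits of the tree parameters live in iterated
    ultrapowers, where no homogeneity is available, and the hull of [b] is replaced by a whole
    diagonal copy of the ground field, whose independence from coheirs is free. Hence
    [three_amalgam] is stated for any algebraically closed exponential field and serves both. *)

Fixpoint tsubst (V W : Type) (r : V -> term W) (t : term V) : term W :=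
  match t with
  | Var x => r x
  | Zero => Zero
  | One => One
  | Add s t => Add (tsubst r s) (tsubst r t)
  | Opp s => Opp (tsubst r s)
  | Mul s t => Mul (tsubst r s) (tsubst r t)
  | Exp s => Exp (tsubst r s)
  end.

Definition slift (V W : Type) (r : V -> term W) (x : option V) :
    term (option W) :=
  if x is Some y then tsubst (fun w => Var (Some w)) (r y) else Var None.

Fixpoint fsubst (V W : Type) (r : V -> term W) (f : formula V) : formula W :=
  match f with
  | Eq s t => Eq (tsubst r s) (tsubst r t)
  | Not f => Not (fsubst r f)
  | And f g => And (fsubst r f) (fsubst r g)
  | Or f g => Or (fsubst r f) (fsubst r g)
  | Ex f => Ex (fsubst (slift r) f)
  | All f => All (fsubst (slift r) f)
  end.

Lemma eval_tsubst (M : structure) V W (r : V -> term W) (w : W -> M) t :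
  eval w (tsubst r t) = eval (fun x => eval w (r x)) t.
Proof. by elim: t => //= [s -> t ->|s ->|s -> t ->|s ->]. Qed.

Lemma sat_fsubst (M : structure) V W (r : V -> term W) (w : W -> M) f :
  sat w (fsubst r f) <-> sat (fun x => eval w (r x)) f.
Proof.
have slE U V' (r' : U -> term V') (w' : V' -> M) (x : M) :
    (fun y => eval (oapp w' x) (slift r' y)) = oapp (fun y => eval w' (r' y)) x.
  by apply: funext => -[y|] //=; rewrite eval_tsubst.
elim: f W r w => [V' s t|V' f IH|V' f IHf g IHg|V' f IHf g IHg|V' f IH|V' f IH]
  W r w /=.
- by rewrite !eval_tsubst.
- by rewrite IH.
- by rewrite IHf IHg.
- by rewrite IHf IHg.
- by split=> -[x Hx]; exists x; move: Hx; rewrite IH slE.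
- by split=> Hx x; move: (Hx x); rewrite IH slE.
Qed.

Lemma qf_fsubst V W (r : V -> term W) f :
  quantifier_free (fsubst r f) = quantifier_free f.
Proof. by elim: f W r => //= [V' f IHf g IHg|V' f IHf g IHg] W r; rewrite IHf IHg. Qed.

Lemma qf_existential V (f : formula V) : quantifier_free f -> existential f.
Proof. by case: f. Qed.

Lemma existential_fsubst V W (r : V -> term W) f :
  existential f -> existential (fsubst r f).
Proof.
elim: f W r => [V' s t|V' f _|V' f _ g _|V' f _ g _|V' f IH|V' f _] W r //=.
- by rewrite qf_fsubst.
- by rewrite !qf_fsubst.
- by rewrite !qf_fsubst.
- exact: IH.
Qed.

Fixpoint tvars (V : Type) (t : term V) : seq V :=
  match t with
  | Var x => [:: x]
  | Zero | One => [::]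
  | Add s t | Mul s t => tvars s ++ tvars t
  | Opp s | Exp s => tvars s
  end.

Fixpoint fvars (V : Type) (f : formula V) : seq V :=
  match f with
  | Eq s t => tvars s ++ tvars t
  | Not f => fvars f
  | And f g | Or f g => fvars f ++ fvars g
  | Ex f | All f => pmap id (fvars f)
  end.

(** Variables are drawn from bare types without decidable equality, hence [List.In] where [\in]
    would be usual. *)
Lemma In_cat (T : Type) (x : T) s t : List.In x (s ++ t) <-> List.In x s \/ List.In x t.
Proof. exact: List.in_app_iff. Qed.

Lemma In_filter (T : Type) (p : pred T) (x : T) s :
  List.In x [seq y <- s | p y] <-> List.In x s /\ p x.
Proof.
elim: s => [|y s IH] /=; first by tauto.
case: ifP => py /=; rewrite IH.
  by split=> [[<-|[]]|[[]]]; tauto.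
by split=> [[]|[[<-|]]]; rewrite ?py //; tauto.
Qed.

Lemma In_pmap_id (T : Type) (x : T) s : List.In (Some x) s -> List.In x (pmap id s).
Proof.
elim: s => //= -[y|] s IH [] //=; first by case=> ->; left.
by move=> /IH; right.
Qed.

Lemma eq_eval (M : structure) V (v w : V -> M) t :
  (forall x, List.In x (tvars t) -> v x = w x) -> eval v t = eval w t.
Proof.
elim: t => //= [x|s IHs t IHt|s IHs|s IHs t IHt|s IHs] H.
- by apply: H; left.
- by rewrite IHs ?IHt // => x Hx; apply: H; apply/In_cat; [right|left].
- by rewrite IHs.
- by rewrite IHs ?IHt // => x Hx; apply: H; apply/In_cat; [right|left].
- by rewrite IHs.
Qed.

Lemma eq_sat (M : structure) V (v w : V -> M) f :
  (forall x, List.In x (fvars f) -> v x = w x) -> sat v f <-> sat w f.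
Proof.
elim: f v w => [V' s t|V' f IH|V' f IHf g IHg|V' f IHf g IHg|V' f IH|V' f IH] v w /= H.
- by rewrite (eq_eval (w := w)) ?(eq_eval (v := v) (w := w) (t := t)) // => x Hx;
    apply: H; apply/In_cat; [right|left].
- by rewrite (IH v w).
- by rewrite (IHf v w) ?(IHg v w) // => x Hx; apply: H; apply/In_cat; [right|left].
- by rewrite (IHf v w) ?(IHg v w) // => x Hx; apply: H; apply/In_cat; [right|left].
- have E x : sat (oapp v x) f <-> sat (oapp w x) f.
    by apply: IH => -[y|] //= Hy; apply: H; apply: In_pmap_id.
  by split=> -[x /E]; exists x.
- have E x : sat (oapp v x) f <-> sat (oapp w x) f.
    by apply: IH => -[y|] //= Hy; apply: H; apply: In_pmap_id.
  by split=> Hx x; apply/E.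
Qed.

(** [existential] formulas are prenex, so a conjunction has to be rewritten: a quantifier-free
    conjunct is pushed under the quantifiers of the other one, and in general the quantifiers of [f]
    are pulled out with [g] renamed under them. *)
Lemma existential_and V (f g : formula V) : existential f -> existential g ->
  exists2 h : formula V, existential h
    & forall (M : structure) (v : V -> M), sat v h <-> sat v f /\ sat v g.
Proof.
have liftE (M : structure) U (v : U -> M) (k : formula U) x :
    sat (oapp v x) (fsubst (fun y => Var (Some y)) k) <-> sat v k.
  by rewrite sat_fsubst.
have qf_and : forall U (k f : formula U), existential f -> quantifier_free k ->
    exists2 h : formula U, existential h
    & forall (M : structure) (v : U -> M), sat v h <-> sat v f /\ sat v k.
  move=> U k f'; elim: f' k => [V' s t|V' f' _|V' f1 _ f2 _|V' f1 _ f2 _|V' f' IH|V' f' _] k //= ef qk.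
  - by exists (And (Eq s t) k).
  - by exists (And (Not f') k) => //=; rewrite ef.
  - by exists (And (And f1 f2) k) => //=; rewrite ef.
  - by exists (And (Or f1 f2) k) => //=; rewrite ef.
  - have [|h eh hE] := IH (fsubst (fun y => Var (Some y)) k) ef; first by rewrite qf_fsubst.
    exists (Ex h) => //= M v; split=> [[x /hE[fx /liftE kx]]|[[x fx] kv]].
      by split=> //; exists x.
    by exists x; apply/hE; split=> //; apply/liftE.
elim: f g => [V' s t|V' f _|V' f1 _ f2 _|V' f1 _ f2 _|V' f IH|V' f _] g ef eg.
- have [h eh hE] := qf_and _ (Eq s t) g eg isT.
  by exists h => // M v; rewrite hE; tauto.
- have [h eh hE] := qf_and _ (Not f) g eg ef.
  by exists h => // M v; rewrite hE; tauto.
- have [h eh hE] := qf_and _ (And f1 f2) g eg ef.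
  by exists h => // M v; rewrite hE; tauto.
- have [h eh hE] := qf_and _ (Or f1 f2) g eg ef.
  by exists h => // M v; rewrite hE; tauto.
- have [h eh hE] := IH (fsubst (fun y => Var (Some y)) g) ef (existential_fsubst _ eg).
  exists (Ex h) => //= M v; split=> [[x /hE[fx /liftE kx]]|[[x fx] kv]].
    by split=> //; exists x.
  by exists x; apply/hE; split=> //; apply/liftE.
- by [].
Qed.

Lemma existential_conj V (l : seq (formula V)) :
  (forall f, List.In f l -> existential f) ->
  exists2 h : formula V, existential h
    & forall (M : structure) (v : V -> M), sat v h <-> forall f, List.In f l -> sat v f.
Proof.
elim: l => [|f l IH] H; first by exists (Eq Zero Zero).
have [|h eh hE] := IH; first by move=> g gl; apply: H; right.
have [|k ek kE] := existential_and (f := f) _ eh; first by apply: H; left.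
exists k => // M v; rewrite kE hE; split=> [[fv lv] g [<-//|]|Hv]; first exact: lv.
by split=> [|g gl]; apply: Hv; [left|right].
Qed.

Definition vsum (Z V : Type) (M : Type) (u : Z -> M) (v : V -> M) (x : Z + V) : M :=
  match x with inl z => u z | inr y => v y end.

(** The block [V] may be infinite; only the finitely many variables of it that occur in [f] are
    bound, one at a time. *)
Lemma formula_close (Z V : Type) (f : formula (Z + V)) :
  exists2 h : formula Z, existential f -> existential h
    & forall (M : structure) (u : Z -> M),
      sat u h <-> exists v : V -> M, sat (vsum u v) f.
Proof.
pose upd (M : structure) (v : V -> M) x y := fun z => if `[< z = x >] then y else v z.
have step (l : seq V) : exists2 h : formula (Z + V), existential f -> existential h
    & forall (M : structure) (u : Z -> M) (v : V -> M),
      sat (vsum u v) h <-> exists2 v' : V -> M,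
        (forall x, ~ List.In x l -> v x = v' x) & sat (vsum u v') f.
  elim: l => [|x l [h eh hE]].
    exists f => // M u v; split=> [fv|[v' vv']]; first by exists v.
    by rewrite (_ : v' = v) //; apply: funext => x; rewrite vv'.
  exists (Ex (fsubst (fun z => if z is inr y then
             if `[< y = x >] then Var None else Var (Some z) else Var (Some z)) h)).
    by move=> /eh eh1; exact: (existential_fsubst _ eh1).
  move=> M u v /=.
  have E y : sat (oapp (vsum u v) y) (fsubst (fun z => if z is inr y then
             if `[< y = x >] then Var None else Var (Some z) else Var (Some z)) h)
      <-> sat (vsum u (upd M v x y)) h.
    rewrite sat_fsubst (_ : (fun _ => _) = vsum u (upd M v x y)) //.
    by apply: funext => -[z|z] //=; rewrite /upd; case: asboolP.
  split=> [[y /E /hE[v' v'E fv']]|[v' v'E fv']].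
    exists v' => // z nz; rewrite -v'E; last by move=> zl; apply: nz; right.
    rewrite /upd; case: asboolP => // zx.
    by case: nz; left.
  exists (v' x); apply/E/hE; exists v' => // z zl; rewrite /upd.
  case: asboolP => [-> //|nzx]; apply: v'E => -[xz|//]; exact: nzx.
pose l := pmap (fun z : Z + V => if z is inr y then Some y else None) (fvars f).
have [h eh hE] := step l.
(* Every variable of [V] that matters is bound by now, so a leftover one may be replaced by any
   closed term. *)
exists (fsubst (fun z => if z is inl y then Var y else Zero) h).
  by move=> /eh; exact: existential_fsubst.
move=> M u; rewrite sat_fsubst.
rewrite (_ : (fun _ => _) = vsum u (fun _ => szero M)); last by apply: funext => -[].
rewrite hE; split=> [[v' _ fv']|[v fv]]; first by exists v'.
exists (fun x => if `[< List.In x l >] then v x else szero M).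
  by move=> x; case: asboolP.
apply/(eq_sat (w := vsum u v)) => // -[z|z] //= Hz.
case: asboolP => // -[]; rewrite /l.
elim: (fvars f) Hz => //= -[z'|z'] s IH [] //=; first by case=> ->; left.
by move=> /IH; right.
Qed.

Lemma existential_close (Z V : Type) (f : formula (Z + V)) : existential f ->
  exists2 h : formula Z, existential h
    & forall (M : structure) (u : Z -> M),
      sat u h <-> exists v : V -> M, sat (vsum u v) f.
Proof. by move=> ef; have [h eh hE] := formula_close f; exists h => //; exact: eh. Qed.

End Substitution.

Lemma embedding_eval (M N : structure) (f : M -> N) V (v : V -> M) t :
  embedding f -> eval (f \o v) t = f (eval v t).
Proof.
case=> _ [f0 f1] fD fM [fN fE].
by elim: t => //= [s -> t ->|s ->|s -> t ->|s ->]; rewrite ?fD ?fM ?fN ?fE.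
Qed.

Lemma embedding_qf (M N : structure) (f : M -> N) V (v : V -> M) phi :
  embedding f -> quantifier_free phi -> sat v phi <-> sat (f \o v) phi.
Proof.
move=> ef; have [f_inj _ _ _ _] := ef.
elim: phi v => //= [V' s t|V' phi IH|V' phi IHp psi IHq|V' phi IHp psi IHq] v.
- by rewrite !embedding_eval //; split=> [->//|/f_inj].
- by move=> /IH ->.
- by move=> /andP[/IHp -> /IHq ->].
- by move=> /andP[/IHp -> /IHq ->].
Qed.

Lemma comp_oapp (M N : Type) (f : M -> N) V (v : V -> M) x :
  f \o oapp v x = oapp (f \o v) (f x).
Proof. by apply: funext => -[]. Qed.

Lemma embedding_existential (M N : structure) (f : M -> N) V (v : V -> M) phi :
  embedding f -> existential phi -> sat v phi -> sat (f \o v) phi.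
Proof.
move=> ef.
elim: phi v => //= [V' s t|V' phi _|V' phi _ psi _|V' phi _ psi _|V' phi IH] v.
- by move=> _ H; apply/(embedding_qf (phi := Eq s t) v ef).
- by move=> q H; apply/(embedding_qf (phi := Not phi) v ef).
- by move=> q H; apply/(embedding_qf (phi := And phi psi) v ef).
- by move=> q H; apply/(embedding_qf (phi := Or phi psi) v ef).
- by move=> e [x /(IH _ e)]; rewrite comp_oapp; exists (f x).
Qed.

Definition elementary (M N : structure) (f : M -> N) : Prop :=
  forall V (v : V -> M) phi, sat v phi <-> sat (f \o v) phi.

Lemma elementary_embedding (M N : structure) (f : M -> N) :
  elementary f -> embedding f.
Proof.
move=> el.
pose v2 (x y z : M) (o : option (option unit)) :=
  match o with None => x | Some None => y | Some (Some _) => z end.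
split=> [x y fxy||x y|x y|].
- exact: (el _ (v2 x y y) (Eq (Var None) (Var (Some None)))).2 fxy.
- split.
    exact: esym ((el _ (fun _ : unit => szero M) (Eq Zero (Var tt))).1 erefl).
  exact: esym ((el _ (fun _ : unit => sone M) (Eq One (Var tt))).1 erefl).
- exact: (el _ (v2 x y (sadd x y))
    (Eq (Var (Some (Some tt))) (Add (Var None) (Var (Some None))))).1 erefl.
- exact: (el _ (v2 x y (smul x y))
    (Eq (Var (Some (Some tt))) (Mul (Var None) (Var (Some None))))).1 erefl.
- split=> x.
  + exact: (el _ (v2 x (sopp x) x) (Eq (Var (Some None)) (Opp (Var None)))).1 erefl.
  + exact: (el _ (v2 x (sexp x) x) (Eq (Var (Some None)) (Exp (Var None)))).1 erefl.
Qed.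

Lemma elementary_models (T : theory) (M N : structure) (f : M -> N) :
  elementary f -> models T M <-> models T N.
Proof.
move=> el; have E : f \o of_void M = of_void N by apply: funext => -[].
by split=> H s /H; rewrite -?E => /el //; rewrite E.
Qed.

Section Ultrapower.
Variables (I : Type) (U : set_system I).
Context {UF : UltraFilter U}.
Variable M : structure.

Definition ueq (f g : I -> M) : Prop := U [set i | f i = g i].

Lemma ueq_refl f : ueq f f.
Proof. by apply: filterS filterT => i _. Qed.

Lemma ueq_sym f g : ueq f g -> ueq g f.
Proof. by apply: filterS => i /= ->. Qed.

Lemma ueq_trans f g h : ueq f g -> ueq g h -> ueq f h.
Proof. by move=> fg gh; apply: filterS (filterI fg gh) => i /= [-> ->]. Qed.

(** Canonical representatives turn equality almost everywhere into Leibniz equality: the choice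
    depends on the predicate [ueq f] alone, and equivalent functions have equal predicates by
    extensionality. *)
Definition ucanon (f : I -> M) : I -> M :=
  projT1 (cid (ex_intro (ueq f) f (ueq_refl f))).

Lemma ucanonP f : ueq f (ucanon f).
Proof. by rewrite /ucanon; case: cid. Qed.

Lemma eq_ucanon f g : ueq f g -> ucanon f = ucanon g.
Proof.
move=> fg; have E : ueq f = ueq g.
  apply/funext => h; apply/propext; split=> H; first exact: ueq_trans (ueq_sym fg) H.
  exact: ueq_trans fg H.
have pick_ext (P Q : (I -> M) -> Prop) (p : exists x, P x) (q : exists x, Q x) :
    P = Q -> projT1 (cid p) = projT1 (cid q).
  by move=> PQ; case: _ / PQ q => q; rewrite (Prop_irrelevance p q).
exact: pick_ext.
Qed.

Definition ucarrier := {f : I -> M | ucanon f = f}.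

Lemma ucanon_idem f : ucanon (ucanon f) = ucanon f.
Proof. exact/esym/eq_ucanon/ucanonP. Qed.

Definition ucl (f : I -> M) : ucarrier := exist _ (ucanon f) (ucanon_idem f).

Lemma ucl_eq f g : ucl f = ucl g <-> ueq f g.
Proof.
split=> [[fg]|/eq_ucanon fg].
  by apply: ueq_trans (ucanonP f) _; rewrite fg; apply/ueq_sym/ucanonP.
by apply: eq_exist.
Qed.

Lemma uclK (x : ucarrier) : ucl (sval x) = x.
Proof. by case: x => f fc; apply: eq_exist. Qed.

Definition upower : structure := @Structure ucarrier
  (ucl (fun=> szero M)) (ucl (fun=> sone M))
  (fun x y => ucl (fun i => sadd (sval x i) (sval y i)))
  (fun x => ucl (fun i => sopp (sval x i)))
  (fun x y => ucl (fun i => smul (sval x i) (sval y i)))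
  (fun x => ucl (fun i => sexp (sval x i))).

Definition ucls (f : I -> M) : upower := ucl f.

Lemma sval_ucl f : ueq (sval (ucl f)) f.
Proof. exact/ueq_sym/ucanonP. Qed.

Lemma ucl_map1 (op : M -> M) f :
  ucl (fun i => op (sval (ucl f) i)) = ucl (fun i => op (f i)).
Proof. by apply/ucl_eq; apply: filterS (sval_ucl f) => i /= ->. Qed.

Lemma ucl_map2 (op : M -> M -> M) f g :
  ucl (fun i => op (sval (ucl f) i) (sval (ucl g) i)) = ucl (fun i => op (f i) (g i)).
Proof.
by apply/ucl_eq; apply: filterS (filterI (sval_ucl f) (sval_ucl g)) => i [/= -> ->].
Qed.

Lemma eval_upower V (w : V -> I -> M) t :
  eval (fun x => ucls (w x)) t = ucls (fun i => eval (w^~ i) t).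
Proof.
elim: t => //= [s -> t ->|s ->|s -> t ->|s ->].
- exact: ucl_map2.
- exact: ucl_map1.
- exact: ucl_map2.
- exact: ucl_map1.
Qed.

Lemma ultra_ex2 (P Q : set I) : U P -> U Q -> exists i, P i /\ Q i.
Proof. by move=> uP uQ; apply: (@filter_ex _ U _ (P `&` Q)); exact: filterI. Qed.

Lemma ultra_not (S : set I) : U (~` S) <-> ~ U S.
Proof.
split=> [nS uS|]; last by case: (in_ultra_setVsetC S).
by have /filter_ex[i []] : U (~` S `&` S) by exact: filterI.
Qed.

Lemma los V (w : V -> I -> M) phi :
  sat (fun x => ucls (w x)) phi <-> U [set i | sat (w^~ i) phi].
Proof.
have oappE W (v : W -> I -> M) x :
    oapp (fun y => ucls (v y)) (ucls x) = (fun y => ucls (oapp v x y)).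
  by apply: funext => -[].
have oappE2 W (v : W -> I -> M) x i :
    (oapp v x)^~ i = oapp (v^~ i) (x i) by apply: funext => -[].
elim: phi w => [V' s t|V' f IH|V' f IHf g IHg|V' f IHf g IHg|V' f IH|V' f IH] w /=.
- by rewrite !eval_upower /ucls ucl_eq.
- by rewrite IH -ultra_not.
- rewrite IHf IHg; split=> [[uf ug]|u].
    by apply: filterS (filterI uf ug).
  by split; apply: filterS u => i [].
- rewrite IHf IHg; split=> [[u|u]|u].
  + by apply: filterS u => i; left.
  + by apply: filterS u => i; right.
  + have [|/ultra_not nf] := pselect (U [set i | sat (w^~ i) f]); first by left.
    by right; apply: filterS (filterI u nf) => i [[]].
- split=> [[x]|u].
    rewrite -[x]uclK oappE IH; apply: filterS => i /=.
    by rewrite oappE2; exists (sval x i).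
  have /choice[x xP] : forall i, exists x,
      (exists y, sat (oapp (w^~ i) y) f) -> sat (oapp (w^~ i) x) f.
    move=> i; have [[y fy]|n] := pselect (exists y, sat (oapp (w^~ i) y) f).
      by exists y.
    by exists (szero M) => /n.
  exists (ucls x); rewrite oappE IH; apply: filterS u => i /= /xP.
  by rewrite oappE2.
- split=> [H|u x]; last first.
    rewrite -[x]uclK oappE IH; apply: filterS u => i /=.
    by rewrite oappE2; apply.
  apply: contrapT => /ultra_not nu.
  have /choice[x xP] : forall i, exists x,
      (exists y, ~ sat (oapp (w^~ i) y) f) -> ~ sat (oapp (w^~ i) x) f.
    move=> i; have [[y fy]|n] := pselect (exists y, ~ sat (oapp (w^~ i) y) f).
      by exists y.
    by exists (szero M) => /n.
  move: (H (ucls x)); rewrite oappE IH => u.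
  have [i [/= ni]] := ultra_ex2 nu u.
  rewrite oappE2; apply: xP.
  by move: ni; rewrite -existsNE.
Qed.

Definition udiag (a : M) : upower := ucls (fun=> a).

Lemma udiag_elementary : elementary udiag.
Proof.
move=> V v phi; rewrite (los (fun x _ => v x)); split=> [s|/filter_ex[]//].
by apply: filterS filterT => i _.
Qed.

End Ultrapower.

(** Almost every list contains any prescribed finite set of elements, so what is checked on finite
    parts holds in the ultraproduct. *)
Lemma list_ultrafilter (X : Type) : exists U : set_system (seq X),
  UltraFilter U /\ forall x, U [set l | List.In x l].
Proof.
pose G : set_system (seq X) := [set S | exists l0 : seq X,
  forall l, (forall x, List.In x l0 -> List.In x l) -> S l].
have PG : ProperFilter G.
  split; first by move=> [l0 H]; exact: (H l0).
  split=> [|P Q [l1 H1] [l2 H2]|P Q PQ [l1 H1]].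
  - by exists [::].
  - exists (l1 ++ l2) => l H; split; [apply: H1|apply: H2] => x xl; apply: H;
      by apply/In_cat; tauto.
  - by exists l1 => l /H1 /PQ.
have [U [UF GU]] := ultraFilterLemma PG.
exists U; split=> // x; apply: GU; exists [:: x] => l; apply; by left.
Qed.

(* A finite part of the diagram of [N] over the common parameters [Z] is an
   existential condition, hence solvable in [A]; the ultraproduct of such
   solutions is the embedding. *)
Lemma upower_embedding (Z : Type) (N A : structure) (fN : Z -> N) (fA : Z -> A) :
  (forall phi : formula Z, existential phi -> sat fN phi -> sat fA phi) ->
  exists (I : Type) (U : set_system I) (UF : UltraFilter U)
         (j : N -> @upower I U UF A),
    embedding j /\ forall z, j (fN z) = @udiag I U UF A (fA z).
Proof.
move=> H; have [U [UF UP]] := list_ultrafilter (formula (Z + N)).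
pose good (phi : formula (Z + N)) := quantifier_free phi /\ sat (vsum fN id) phi.
have /choice[s sP] : forall l : seq (formula (Z + N)), exists s : N -> A,
    forall phi, List.In phi l -> good phi -> sat (vsum fA s) phi.
  move=> l.
  have [|h eh hE] := @existential_conj _ [seq phi <- l | `[< good phi >]].
    move=> phi /In_filter[_ /asboolP[q _]]; exact: qf_existential.
  have [k ek kE] := existential_close eh.
  have : sat fN k.
    by apply/kE; exists id; apply/hE => phi /In_filter[_ /asboolP[_]].
  move=> /(H _ ek) /kE[s /hE Hs]; exists s => phi pl gp; apply: Hs.
  by apply/In_filter; split=> //; apply/asboolP.
exists _, U, UF, (fun x => @ucls _ U UF A (fun l => s l x)).
have step (phi : formula (Z + N)) : good phi ->
    sat (vsum (fun z => @udiag _ U UF A (fA z)) (fun x => @ucls _ U UF A (fun l => s l x))) phi.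
  move=> gp.
  rewrite (_ : vsum _ _ = fun x => @ucls _ U UF A (fun l => vsum fA (s l) x)); last first.
    by apply: funext => -[].
  apply/los; apply: filterS (UP phi) => l /= pl.
  rewrite (_ : (fun x => _) = vsum fA (s l)) //; exact: sP.
split; last first.
  move=> z; apply: (step (Eq (Var (inr (fN z))) (Var (inl z)))); by split.
split=> [x y|||x y|].
- move=> xy; apply: contrapT => nxy.
  by apply: (step (Not (Eq (Var (inr x)) (Var (inr y))))).
- split; first exact: (step (Eq (Var (inr (szero N))) Zero)).
  exact: (step (Eq (Var (inr (sone N))) One)).
- move=> x y.
  exact: (step (Eq (Var (inr (sadd x y))) (Add (Var (inr x)) (Var (inr y))))).
- exact: (step (Eq (Var (inr (smul x y))) (Mul (Var (inr x)) (Var (inr y))))).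
- split=> x; first exact: (step (Eq (Var (inr (sopp x))) (Opp (Var (inr x))))).
  exact: (step (Eq (Var (inr (sexp x))) (Exp (Var (inr x))))).
Qed.

(** * Cardinals and the Loewenheim-Skolem theorem *)

Definition injects (X Y : Type) : Prop := exists f : X -> Y, injective f.

Lemma injects_trans X Y Z : injects X Y -> injects Y Z -> injects X Z.
Proof. by move=> [f fi] [g gi]; exists (g \o f); exact: inj_comp. Qed.

Lemma card_le_injects (X Y : Type) (A : set X) (B : set Y) :
  (A #<= B) <-> injects A B.
Proof.
split=> [/card_leP/injfunPex[f _ fi]|[f fi]].
  by exists f => x y /fi; apply; rewrite inE.
by apply/card_leP/injfunPex; exists f => // x y _ _ /fi.
Qed.

Lemma setT_injects (X : Type) : injects X [set: X].
Proof. by exists (fun x => exist _ x (mem_set I)) => x y [->]. Qed.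

Lemma injects_val (X : Type) (A : set X) : injects A X.
Proof. by exists val; exact: val_inj. Qed.

Lemma card_le_injectsT (X Y : Type) : ([set: X] #<= [set: Y]) <-> injects X Y.
Proof.
rewrite card_le_injects; split=> H.
  exact: injects_trans (setT_injects X) (injects_trans H (injects_val _)).
exact: injects_trans (injects_val _) (injects_trans H (setT_injects _)).
Qed.

Lemma injects_sum X X' Y Y' : injects X X' -> injects Y Y' -> injects (X + Y) (X' + Y').
Proof.
move=> [f fi] [g gi].
exists (fun z => match z with inl x => inl (f x) | inr y => inr (g y) end).
by move=> [x|y] [x'|y'] // [] => [/fi->|/gi->].
Qed.

(* A maximal partial injection is total or onto. *)
Lemma injects_total (X Y : Type) : injects X Y \/ injects Y X.
Proof.
pose P (G : set (X * Y)) := (forall x y y', G (x, y) -> G (x, y') -> y = y') /\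
  (forall x x' y, G (x, y) -> G (x', y) -> x = x').
have [F FP tF|G [[Gf Gi] maxG]] := @Zorn_bigcup _ P.
  have two p q : (\bigcup_(Z in F) Z) p -> (\bigcup_(Z in F) Z) q ->
      exists2 Z, F Z & Z p /\ Z q.
    move=> [Z1 FZ1 Zp] [Z2 FZ2 Zq].
    by case: (tF _ _ FZ1 FZ2) => s; [exists Z2|exists Z1] => //; split=> //; apply: s.
  split=> [x y y' p q|x x' y p q].
    by have [Z /FP[H _] [a b]] := two _ _ p q; apply: H a b.
  by have [Z /FP[_ H] [a b]] := two _ _ p q; apply: H a b.
have [/choice[f fP]|/existsNP[x0 nx0]] := pselect (forall x, exists y, G (x, y)).
  left; exists f => x x' e.
  by apply: (Gi _ _ (f x)); [exact: fP|rewrite e; exact: fP].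
have [/choice[g gP]|/existsNP[y0 ny0]] := pselect (forall y, exists x, G (x, y)).
  right; exists g => y y' e.
  by apply: (Gf (g y)); [exact: gP|rewrite e; exact: gP].
exfalso; apply: (maxG (G `|` [set (x0, y0)])).
  split=> [p Gp|H]; first by left.
  by apply: nx0; exists y0; apply: H; right.
split=> [x y y' [Gy|[-> ->]] [Gy'|E]|x x' y [Gx|[-> ->]] [Gx'|E]] //.
- exact: Gf Gy Gy'.
- by case: E Gy => -> _ Gy; case: nx0; exists y.
- by case: nx0; exists y'.
- by case: E.
- exact: Gi Gx Gx'.
- by case: E Gx => _ -> Gx; case: ny0; exists x.
- by case: ny0; exists x'.
- by case: E.
Qed.

(* A maximal injection [A * A -> A], for [A] a subset of [Y] containing a copy
   of [nat], has [A] equipotent to [Y]: otherwise [A] injects into its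
   complement and the injection extends to twice [A]. *)
Lemma injects_square (Y : Type) : injects nat Y -> injects (Y * Y) Y.
Proof.
move=> [nu nui].
pose D (G : set (Y * Y * Y)) x := exists z, G (x, x, z).
pose G0 : set (Y * Y * Y) :=
  [set t | exists m n : nat, t = (nu m, nu n, nu (pickle (m, n)))].
pose P (G : set (Y * Y * Y)) :=
  [/\ G = set0 \/ G0 `<=` G,
      forall p z z', G (p, z) -> G (p, z') -> z = z',
      forall p p' z, G (p, z) -> G (p', z) -> p = p',
      forall x y z, G (x, y, z) -> [/\ D G x, D G y & D G z]
    & forall x y, D G x -> D G y -> exists z, G (x, y, z)].
have PG0 : P G0.
  have DG0 m : D G0 (nu m) by exists (nu (pickle (m, m))), m, m.
  split; first by right.
  - by move=> p z z' [m [n [-> ->]]] [m' [n' [/nui-> /nui-> ->]]].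
  - move=> p p' z [m [n [-> ->]]] [m' [n' [-> /nui]]].
    by move=> /(pcan_inj pickleK)[-> ->].
  - by move=> x y z [m [n [-> -> ->]]].
  - move=> x y [z [m [n [-> _ _]]]] [z' [m' [n' [-> _ _]]]].
    by exists (nu (pickle (m, m'))), m, m'.
have [F FP tF|G [PG maxG]] := @Zorn_bigcup _ P.
  have two p q : (\bigcup_(Z in F) Z) p -> (\bigcup_(Z in F) Z) q ->
      exists2 Z, F Z & Z p /\ Z q.
    move=> [Z1 FZ1 Zp] [Z2 FZ2 Zq].
    by case: (tF _ _ FZ1 FZ2) => s; [exists Z2|exists Z1] => //; split=> //; apply: s.
  have DS Z x : F Z -> D Z x -> D (\bigcup_(Z in F) Z) x.
    by move=> FZ [z Zz]; exists z, Z.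
  split.
  - have [[Z FZ Z0]|n] := pselect (exists2 Z, F Z & Z <> set0).
      right=> t G0t; exists Z => //; have [[//|s] _ _ _ _] := FP _ FZ; exact: s.
    left; rewrite -subset0 => t [Z FZ Zt]; case: n; exists Z => // Z0.
    by rewrite Z0 in Zt.
  - by move=> p z z' a b; have [Z /FP[_ H _ _ _] [a' b']] := two _ _ a b; apply: H a' b'.
  - by move=> p p' z a b; have [Z /FP[_ _ H _ _] [a' b']] := two _ _ a b; apply: H a' b'.
  - move=> x y z [Z FZ Zt]; have [_ _ _ H _] := FP _ FZ.
    by have [a b c] := H _ _ _ Zt; split; apply: (DS Z).
  - move=> x y [z a] [z' b]; have [Z FZ [a' b']] := two _ _ a b.
    have [_ _ _ _ H] := FP _ FZ.
    have [w Zw] : exists z, Z (x, y, z) by apply: H; [exists z|exists z'].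
    by exists w, Z.
have [G0G Gf Gi Gd Gt] := PG.
have {}G0G : G0 `<=` G.
  case: G0G => // G_0; exfalso; apply: (maxG G0) => //; rewrite G_0; split=> // s.
  by have := s (nu 0, nu 0, nu (pickle (0, 0))%N); apply; exists 0%N, 0%N.
pose A : set Y := [set x | D G x].
have Anu n : A (nu n) by exists (nu (pickle (n, n))); apply: G0G; exists n, n.
have /choice[f' f'P] : forall p : Y * Y, exists z,
    A p.1 -> A p.2 -> G (p.1, p.2, z).
  move=> [x y] /=; have [[Ax Ay]|n] := pselect (A x /\ A y).
    by have [z Gz] := Gt x y Ax Ay; exists z.
  by exists x => Ax Ay; case: n.
pose f x y := f' (x, y).
have fP x y : A x -> A y -> G (x, y, f x y) by move=> Ax Ay; apply: (f'P (x, y)).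
have fA x y : A x -> A y -> A (f x y).
  by move=> Ax Ay; have [] := Gd _ _ _ (fP _ _ Ax Ay).
have fi x y x' y' : f x y = f x' y' -> A x -> A y -> A x' -> A y' -> x = x' /\ y = y'.
  move=> e Ax Ay Ax' Ay'; have := fP _ _ Ax Ay; rewrite e => H.
  by case: (Gi _ _ _ H (fP _ _ Ax' Ay')).
have [[j ji]|[j ji]] := injects_total A (~` A : set Y); last first.
  (* When the complement injects into [A], all of [Y] injects into [A] through [f], the second
     arguments [nu 0] and [nu 1] telling the two halves apart; then [f] codes pairs of such
     images. *)
  have [g [gA gi]] : exists g : Y -> Y, (forall x, A (g x)) /\ injective g.
    have /choice[g gP] : forall x, exists y,
        (exists Ax : A x, y = f x (nu 0%N)) \/
        (exists Ax : x \in (~` A : set Y), y = f (val (j (exist _ x Ax))) (nu 1%N)).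
      move=> x; have [Ax|nAx] := pselect (A x).
        by exists (f x (nu 0%N)); left; exists Ax.
      by exists (f (val (j (exist _ x (mem_set nAx)))) (nu 1%N)); right; exists (mem_set nAx).
    have jA t : A (val (j t)) by apply: set_mem; apply: valP.
    exists g; split=> [x|x x'].
      by case: (gP x) => -[Ax ->]; apply: fA.
    case: (gP x) (gP x') => -[Ax ->] [] [Ax' ->] /fi.
    - by case=> //.
    - by case=> // _ /nui.
    - by case=> // _ /nui.
    - by case=> // /val_inj/ji[].
  exists (fun p => f (g p.1) (g p.2)) => -[x y] [x' y'] /= /fi[] //.
  by move=> /gi -> /gi ->.
pose k (x : Y) : Y := if pselect (A x) is left Ax then val (j (exist _ x (mem_set Ax))) else x.
have kA x : A x -> ~ A (k x).
  rewrite /k; case: pselect => // Ax _.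
  by have /set_mem := valP (j (exist _ x (mem_set Ax))).
have ki x y : k x = k y -> A x -> A y -> x = y.
  rewrite /k; case: pselect => // Ax; case: pselect => // Ay.
  by move=> /val_inj/ji[].
pose e (b : bool) x := if b then k x else x.
have ei b c x y : A x -> A y -> e b x = e c y -> b = c /\ x = y.
  case: b; case: c => //= Ax Ay.
  - by move=> /ki->.
  - by move=> E; case: (kA _ Ax); rewrite E.
  - by move=> E; case: (kA _ Ay); rewrite -E.
(* The new domain is [A] with its copy under [k]. The pairs outside [A * A], those with [b || c],
   get values in the copy, and [cd b c] records in which halves the two arguments lie. *)
pose cd (b c : bool) := nu (b + c.*2)%N.
have cdi b c b' c' : cd b c = cd b' c' -> b = b' /\ c = c'.
  by move=> /nui; case: b; case: c; case: b'; case: c'.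
pose h b c x y := k (f (f x y) (cd b c)).
pose G1 : set (Y * Y * Y) := [set t | exists b c x y,
  [/\ b || c, A x, A y & t = (e b x, e c y, h b c x y)]].
pose G' := G `|` G1.
have GA x y z : G (x, y, z) -> [/\ A x, A y & A z] by exact: Gd.
have hA b c x y : A x -> A y -> ~ A (h b c x y).
  by move=> Ax Ay; exact: (kA _ (fA _ _ (fA _ _ Ax Ay) (Anu _))).
have G1n x y z b c x' y' : G (x, y, z) -> b || c -> A x' -> A y' ->
    (x, y) <> (e b x', e c y').
  move=> /GA[Ax Ay _] bc Ax' Ay' [ex ey]; case: b bc ex => //= [_ ex|].
    by apply: (kA _ Ax'); rewrite -ex.
  by case: c ey => //= ey _ _; apply: (kA _ Ay'); rewrite -ey.
have DG' b x : A x -> D G' (e b x).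
  move=> Ax; case: b; last by have [z Gz] := Ax; exists z; left.
  by exists (h true true x x); right; exists true, true, x, x.
have DG'P x : D G' x -> exists b, exists2 y, A y & x = e b y.
  move=> [z [Gz|[b [c [x' [y' [_ Ax' _ [-> _ _]]]]]]]].
    by exists false, x => //; exists z.
  by exists b, x'.
exfalso; apply: (maxG G').
  split=> [t|s]; first by left.
  have : G' (k (nu 0%N), k (nu 0%N), h true true (nu 0%N) (nu 0%N)).
    by right; exists true, true, (nu 0%N), (nu 0%N).
  by move=> /s/GA[_ _]; exact: hA.
split.
- by right=> t /G0G; left.
- move=> [x y] z z' [Gz|[b [c [x1 [y1 [bc Ax1 Ay1 [-> -> ->]]]]]]].
    case=> [/(Gf _ _ _ Gz)//|[b [c [x1 [y1 [bc Ax1 Ay1 [ex ey ez]]]]]]].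
    by case: (G1n _ _ _ _ _ _ _ Gz bc Ax1 Ay1); rewrite ex ey.
  case=> [Gz|[b' [c' [x2 [y2 [bc' Ax2 Ay2 [ex ey ->]]]]]]].
    by case: (G1n _ _ _ _ _ _ _ Gz bc Ax1 Ay1).
  by have [-> ->] := ei _ _ _ _ Ax1 Ax2 ex; have [-> ->] := ei _ _ _ _ Ay1 Ay2 ey.
- move=> p p' z [Gz|[b [c [x1 [y1 [bc Ax1 Ay1 [-> ->]]]]]]].
    case=> [/(Gi _ _ _ Gz)//|[b [c [x1 [y1 [bc Ax1 Ay1 [_ ez]]]]]]].
    by case: p Gz => x y /GA[_ _]; rewrite ez => H; case: (hA b c x1 y1).
  case=> [|[b' [c' [x2 [y2 [bc' Ax2 Ay2 [-> ez]]]]]]].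
    by case: p' => x y /GA[_ _] H; case: (hA b c x1 y1).
  have Af1 := fA _ _ Ax1 Ay1; have Af2 := fA _ _ Ax2 Ay2.
  have kf := ki _ _ ez (fA _ _ Af1 (Anu _)) (fA _ _ Af2 (Anu _)).
  have [/fi e1 /cdi[-> ->]] := fi _ _ _ _ kf Af1 (Anu _) Af2 (Anu _).
  by have [-> ->] := e1 Ax1 Ay1 Ax2 Ay2.
- move=> x y z [/Gd[]|[b [c [x1 [y1 [bc Ax1 Ay1 [-> -> ->]]]]]]].
    by move=> [a Ga] [a' Ga'] [a'' Ga'']; split; [exists a|exists a'|exists a'']; left.
  split; [exact: DG'|exact: DG'|].
  exact: (DG' true _ (fA _ _ (fA _ _ Ax1 Ay1) (Anu _))).
- move=> x y /DG'P[b [x1 Ax1 ->]] /DG'P[c [y1 Ay1 ->]].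
  case bc : (b || c); last first.
    by case: b c bc => -[] //= _; exists (f x1 y1); left; exact: fP.
  by exists (h b c x1 y1); right; exists b, c, x1, y1.
Qed.

Lemma injects_double (Y : Type) : injects nat Y -> injects (Y + Y) Y.
Proof.
move=> Hn; have [g gi] := injects_square Hn; have [nu nui] := Hn.
exists (fun z => match z with inl x => g (x, nu 0%N) | inr y => g (y, nu 1%N) end).
by move=> [x|x] [y|y] /gi [] // -> // /nui.
Qed.

Lemma injects_seq (Y : Type) : injects nat Y -> injects (seq Y) Y.
Proof.
move=> Hn; have [g gi] := injects_square Hn; have [nu nui] := Hn.
pose c (s : seq Y) := foldr (fun x y => g (x, y)) (nu 0%N) s.
exists (fun s => g (nu (size s), c s)) => s t /gi[/nui].
elim: s t => [|x s IH] [|y t] //= [st] /gi[-> e].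
by rewrite (IH t).
Qed.

(** Identify [X] with its square. Either some row goes entirely into [A], or every row has a point
    sent to [B], and one such point per row embeds [X] in [B]. This makes a union of two small sets
    small. *)
Lemma injects_not_sum (X A B : Type) : injects nat X -> injects X (A + B) ->
  injects X A \/ injects X B.
Proof.
move=> /injects_square [g gi] [f fi].
have [[x xP]|n] := pselect (exists x, forall y, exists a, f (g (x, y)) = inl a).
  left; have [h hP] := choice xP; exists h => y y' e.
  by have := hP y; rewrite e -hP => /fi/gi[].
right; have /choice[h hP] : forall x, exists b, exists y, f (g (x, y)) = inr b.
  move=> x; apply: contrapT => nx; apply: n; exists x => y.
  case E: (f (g (x, y))) => [a|b]; first by exists a.
  by case: nx; exists b, y.
exists h => x x' e; have [y yP] := hP x; have [y' y'P] := hP x'.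
by move: yP; rewrite e -y'P => /fi/gi[].
Qed.

(** * Coding formulas by natural numbers, and the downward Loewenheim-Skolem theorem *)

Fixpoint term_code (V : Type) (c : V -> nat) (t : term V) : GenTree.tree nat :=
  match t with
  | Var x => GenTree.Node 0 [:: GenTree.Leaf (c x)]
  | Zero => GenTree.Node 1 [::]
  | One => GenTree.Node 2 [::]
  | Add s t => GenTree.Node 3 [:: term_code c s; term_code c t]
  | Opp s => GenTree.Node 4 [:: term_code c s]
  | Mul s t => GenTree.Node 5 [:: term_code c s; term_code c t]
  | Exp s => GenTree.Node 6 [:: term_code c s]
  end.

Definition ocode (V : Type) (c : V -> nat) (x : option V) : nat :=
  if x is Some y then (c y).+1 else 0%N.

Fixpoint formula_code (V : Type) (c : V -> nat) (f : formula V) : GenTree.tree nat :=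
  match f with
  | Eq s t => GenTree.Node 0 [:: term_code c s; term_code c t]
  | Not f => GenTree.Node 1 [:: formula_code c f]
  | And f g => GenTree.Node 2 [:: formula_code c f; formula_code c g]
  | Or f g => GenTree.Node 3 [:: formula_code c f; formula_code c g]
  | Ex f => GenTree.Node 4 [:: formula_code (ocode c) f]
  | All f => GenTree.Node 5 [:: formula_code (ocode c) f]
  end.

Lemma term_code_inj V (c : V -> nat) : injective c -> injective (term_code c).
Proof.
move=> ci; elim=> [x|||s IHs t IHt|s IHs|s IHs t IHt|s IHs] [y|||s' t'|s'|s' t'|s'] //=.
- by case=> /ci->.
- by case=> /IHs-> /IHt->.
- by case=> /IHs->.
- by case=> /IHs-> /IHt->.
- by case=> /IHs->.
Qed.

Lemma ocode_inj V (c : V -> nat) : injective c -> injective (ocode c).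
Proof. by move=> ci [x|] [y|] //= [/ci->]. Qed.

Lemma formula_code_inj V (c : V -> nat) : injective c -> injective (formula_code c).
Proof.
move=> ci f; elim: f c ci => [V' s t|V' f IH|V' f IHf g IHg|V' f IHf g IHg|V' f IH|V' f IH]
  c ci; case=> [s' t'|f'|f' g'|f' g'|f'|f'] //=.
- by case=> /(term_code_inj ci)-> /(term_code_inj ci)->.
- by case=> /IH->.
- by case=> /IHf-> // /IHg->.
- by case=> /IHf-> // /IHg->.
- by case=> /IH-> //; exact: ocode_inj.
- by case=> /IH-> //; exact: ocode_inj.
Qed.

Lemma formula_injects_nat V : injects V nat -> injects (formula V) nat.
Proof.
move=> [c ci]; exists (fun f => pickle (formula_code c f)) => f g.
by move=> /(pcan_inj pickleK)/(formula_code_inj ci).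
Qed.

(* Downward Loewenheim-Skolem: close under Skolem functions, whose iterated
   applications are coded by finite trees with leaves in the generators. *)
Lemma lowenheim_skolem (N : structure) (Z Y : Type) (g : Z -> N) :
  injects nat Y -> injects Z Y ->
  exists (A : structure) (e : A -> N),
    [/\ elementary e, forall z, exists a, e a = g z & injects A Y].
Proof.
move=> nY ZY.
have [c ci] : injects (formula (option nat)) nat.
  by apply: formula_injects_nat; exists pickle; exact: pcan_inj pickleK.
pose d := szero N.
(* [w'] is a Skolem function for the formula whose code is the first component; the sequence lists
   the parameters, with [d] as the default beyond its end. *)
have /choice[w' w'P] : forall p : nat * seq N, exists x, forall phi,
    c phi = p.1 -> (exists y, sat (oapp (nth d p.2) y) phi) -> sat (oapp (nth d p.2) x) phi.
  move=> [n s] /=.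
  have [[phi [cphi [y sy]]]|nphi] := pselect (exists phi, c phi = n /\
      exists y, sat (oapp (nth d s) y) phi).
    by exists y => phi'; rewrite -cphi => /ci->.
  by exists d => phi cphi sphi; case: nphi; exists phi.
pose ev := fix ev (t : GenTree.tree Z) : N := match t with
  | GenTree.Leaf z => g z
  | GenTree.Node n ts => w' (n, map ev ts) end.
pose S : set N := range ev.
have wit (phi : formula (option nat)) (s : seq N) :
    (forall k, (k < size s)%N -> S (nth d s k)) ->
    (exists y, sat (oapp (nth d s) y) phi) -> exists2 y, S y & sat (oapp (nth d s) y) phi.
  move=> Ss ys; have [ts tsE] : exists ts, s = map ev ts.
    elim: s {ys} Ss => [|x s IH] H; first by exists [::].
    have [t _ tx] := H 0%N isT.
    have [k ks|ts ->] := IH; first exact: (H k.+1).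
    by exists (t :: ts); rewrite /= tx.
  exists (w' (c phi, s)); last exact: (w'P (c phi, s)).
  by exists (GenTree.Node (c phi) ts); rewrite //= tsE.
pose x_ k : term (option nat) := Var (Some k).
(* Closure under the operations comes from the Skolem function of the formula [x = t]. *)
have closed0 (t : term nat) (s : seq N) : (forall k, (k < size s)%N -> S (nth d s k)) ->
    S (eval (nth d s) t).
  move=> Ss.
  have [|y Sy] := wit (Eq (Var None) (tsubst x_ t)) s Ss.
    by exists (eval (nth d s) t); rewrite /= eval_tsubst.
  by rewrite /= eval_tsubst /= => <-.
pose A0 := {x : N | S x}.
have S0 : S (szero N) by exact: (closed0 Zero [::]).
have S1 : S (sone N) by exact: (closed0 One [::]).
have SD (x y : A0) : S (sadd (sval x) (sval y)).
  apply: (closed0 (Add (Var 0%N) (Var 1%N)) [:: sval x; sval y]).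
  by case=> [|[|]] //= _; apply: svalP.
have SM (x y : A0) : S (smul (sval x) (sval y)).
  apply: (closed0 (Mul (Var 0%N) (Var 1%N)) [:: sval x; sval y]).
  by case=> [|[|]] //= _; apply: svalP.
have SN (x : A0) : S (sopp (sval x)).
  by apply: (closed0 (Opp (Var 0%N)) [:: sval x]); case=> [|] //= _; apply: svalP.
have SE (x : A0) : S (sexp (sval x)).
  by apply: (closed0 (Exp (Var 0%N)) [:: sval x]); case=> [|] //= _; apply: svalP.
pose A : structure := @Structure A0 (exist _ _ S0) (exist _ _ S1)
  (fun x y => exist _ _ (SD x y)) (fun x => exist _ _ (SN x))
  (fun x y => exist _ _ (SM x y)) (fun x => exist _ _ (SE x)).
pose e (x : A) : N := sval x.
have ee : embedding e.
  by split=> // x y; case: x y => x Sx [y Sy] /= xy; apply: eq_exist.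
(* The Tarski-Vaught criterion. Skolem functions exist only for formulas with variables in [nat], so
   each parameter is renamed to its position in the list of free variables. *)
have TV V (v : V -> A) (phi : formula (option V)) :
    (exists y, sat (oapp (e \o v) y) phi) -> exists y : A, sat (oapp (e \o v) (e y)) phi.
  move=> [y sy].
  pose l := pmap id (fvars phi).
  have /choice[r rP] : forall x : V, exists k, List.In x l ->
      (k < size l)%N /\ nth d (map (e \o v) l) k = e (v x).
    move=> x; have [xl|nx] := pselect (List.In x l); last by exists 0%N.
    suff [k kP] : exists k, (k < size l)%N /\ nth d (map (e \o v) l) k = e (v x) by exists k.
    elim: (l) xl => //= z l' IH [->|/IH[k kP]]; first by exists 0%N.
    by exists k.+1.
  pose rho (o : option V) : term (option nat) := if o is Some x then Var (Some (r x)) else Var None.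
  have E z : sat (oapp (nth d (map (e \o v) l)) z) (fsubst rho phi) <->
             sat (oapp (e \o v) z) phi.
    rewrite sat_fsubst; apply: eq_sat => -[x|] //= xl.
    by have [_ ->] := rP x (In_pmap_id xl).
  have [||z [t _ tz] /E sz] := wit (fsubst rho phi) (map (e \o v) l).
  - move=> k; rewrite size_map => kl.
    have -> : nth d (map (e \o v) l) k = e (nth (exist _ _ S0 : A) (map v l) k).
      by rewrite map_comp (nth_map (exist _ _ S0 : A)) // size_map.
    exact: svalP.
  - by exists y; apply/E.
  - have Sz : S z by exists t.
    by exists (exist _ z Sz).
exists A, e; split.
- move=> V v phi.
  elim: phi v => [V' s t|V' f IH|V' f IHf h IHh|V' f IHf h IHh|V' f IH|V' f IH] v /=.
  + exact: (embedding_qf (phi := Eq s t) v ee isT).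
  + by rewrite IH.
  + by rewrite IHf IHh.
  + by rewrite IHf IHh.
  + split=> [[x]|/TV[y]].
      by rewrite IH comp_oapp; exists (e x).
    by exists y; rewrite IH comp_oapp.
  + split=> [H x|H x]; last by rewrite IH comp_oapp.
    apply: contrapT => nx.
    have [|y /= ny] := TV _ v (Not f); first by exists x.
    by apply: ny; rewrite -comp_oapp -IH.
- move=> z; have Sz : S (g z) by exists (GenTree.Leaf z).
  by exists (exist _ _ Sz).
- have At : injects A (GenTree.tree Z).
    have /choice[f fP] : forall x : A, exists t, ev t = e x by move=> [x Sx]; have [t _ tx] := Sx; exists t.
    exists f => x y fxy; have [ei _ _ _ _] := ee; apply: ei.
    by rewrite -fP fxy fP.
  apply: injects_trans At _.
  apply: (@injects_trans _ (seq (nat + Z))).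
    by exists (@GenTree.encode Z); exact: pcan_inj (@GenTree.codeK Z).
  apply: (@injects_trans _ (seq Y)); last exact: injects_seq.
  have [f fi] : injects (nat + Z) Y.
    exact: injects_trans (injects_sum nY ZY) (injects_double nY).
  by exists (map f); exact: inj_map.
Qed.

(** * Specialisation of finitely generated rings *)

Section SubringSets.
Variable P : fieldType.
Implicit Types (R S K C : set P) (p q : {poly P}).

Definition subring_set R : Prop :=
  [/\ R 1, forall x y, R x -> R y -> R (x - y)
    & forall x y, R x -> R y -> R (x * y)].

Definition subfield_set K : Prop :=
  subring_set K /\ forall x, K x -> K x^-1.

Definition pover R p : Prop := forall i, R p`_i.

Definition closed_subfield K : Prop :=
  subfield_set K /\
  forall p, pover K p -> (1 < size p)%N -> exists2 x, K x & root p x.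

Section Closure.
Variable R : set P.
Hypothesis sR : subring_set R.

Lemma subring1 : R 1. Proof. by case: sR. Qed.
Lemma subringB x y : R x -> R y -> R (x - y). Proof. by case: sR => _ + _; apply. Qed.
Lemma subringM x y : R x -> R y -> R (x * y). Proof. by case: sR => _ _; apply. Qed.
Lemma subring0 : R 0. Proof. by rewrite -(subrr 1); apply: subringB; exact: subring1. Qed.
Lemma subringN x : R x -> R (- x).
Proof. by move=> Rx; rewrite -sub0r; apply: subringB => //; exact: subring0. Qed.
Lemma subringD x y : R x -> R y -> R (x + y).
Proof. by move=> Rx Ry; rewrite -[y]opprK; apply: subringB => //; exact: subringN. Qed.
Lemma subringX x n : R x -> R (x ^+ n).
Proof. by move=> Rx; elim: n => [|n IH]; rewrite ?exprS; [exact: subring1|exact: subringM]. Qed.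
Lemma subring_nat n : R n%:R.
Proof. by elim: n => [|n IH]; [exact: subring0|rewrite -addn1 natrD; apply: subringD => //; exact: subring1]. Qed.
Lemma subring_sum (I : Type) (r : seq I) (F : I -> P) :
  (forall i, R (F i)) -> R (\sum_(i <- r) F i).
Proof. by move=> H; apply: big_ind => //; [exact: subring0|exact: subringD]. Qed.

Lemma pover0 : pover R 0. Proof. by move=> i; rewrite coef0; exact: subring0. Qed.
Lemma poverC c : R c -> pover R c%:P.
Proof. by move=> Rc i; rewrite coefC; case: ifP => // _; exact: subring0. Qed.
Lemma poverX : pover R 'X.
Proof. by move=> i; rewrite coefX; case: eqP => _; [exact: subring1|exact: subring0]. Qed.
Lemma poverB p q : pover R p -> pover R q -> pover R (p - q).
Proof. by move=> Rp Rq i; rewrite coefB; exact: subringB. Qed.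
Lemma poverD p q : pover R p -> pover R q -> pover R (p + q).
Proof. by move=> Rp Rq i; rewrite coefD; exact: subringD. Qed.
Lemma poverM p q : pover R p -> pover R q -> pover R (p * q).
Proof. by move=> Rp Rq i; rewrite coefM; apply: subring_sum => j; exact: subringM. Qed.
Lemma poverXn n : pover R 'X^n.
Proof. by elim: n => [|n IH]; rewrite ?exprS; [apply: poverC; exact: subring1|apply: poverM => //; exact: poverX]. Qed.
Lemma poverZ c p : R c -> pover R p -> pover R (c *: p).
Proof. by move=> Rc Rp i; rewrite coefZ; exact: subringM. Qed.

Lemma pover_horner p x : pover R p -> R x -> R p.[x].
Proof.
by move=> Rp Rx; rewrite horner_coef; apply: subring_sum => i; apply: subringM => //; exact: subringX.
Qed.

(** Division that stays over the ring [R], where leading coefficients need not be invertible; the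
    price is a power of [lead_coef d]. *)
Lemma pseudo_division (d : {poly P}) p : d != 0 -> pover R d -> pover R p ->
  exists k q r, [/\ pover R q, pover R r, lead_coef d ^+ k *: p = q * d + r
    & (size r < size d)%N].
Proof.
move=> d0 Rd; have [n] := ubnP (size p); elim: n p => // n IH p pn Rp.
have [lt|ge] := ltnP (size p) (size d).
  by exists 0%N, 0, p; rewrite expr0 scale1r mul0r add0r; split=> //; exact: pover0.
have Rl : R (lead_coef d) by exact: Rd.
have Rlp : R (lead_coef p) by exact: Rp.
pose t := lead_coef p *: ('X^(size p - size d) : {poly P}).
have Rt : pover R t by apply: poverZ => //; exact: poverXn.
pose p' := lead_coef d *: p - t * d.
have Rp' : pover R p' by apply: poverB; [exact: poverZ|exact: poverM].
have p0 : p != 0.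
  by rewrite -size_poly_gt0 (leq_trans _ ge) // size_poly_gt0.
have sp' : (size p' < size p)%N.
  have le : (size p' <= size p)%N.
    rewrite (leq_trans (size_polyD _ _)) // size_polyN geq_max size_scale_leq /=.
    rewrite (leq_trans (size_polyMleq _ _)) // /t size_scale ?lead_coef_eq0 //.
    by rewrite size_polyXn addSn /= subnK.
  rewrite ltn_neqAle le andbT; apply/eqP => e.
  have : lead_coef p' = 0.
    rewrite lead_coefE e /p' coefB coefZ -lead_coefE /t -scalerAl coefZ.
    rewrite coefXnM ltnNge.
    have -> : (size p - size d <= (size p).-1)%N.
      by rewrite -subn1 leq_sub2l // size_poly_gt0.
    rewrite /= (_ : ((size p).-1 - (size p - size d))%N = (size d).-1); last first.
      have : (0 < size d)%N by rewrite size_poly_gt0.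
      by move: ge; case: (size d) => // a; case: (size p) => // b; rewrite ltnS subSS => ab _ /=; rewrite subKn.
    by rewrite -lead_coefE mulrC subrr.
  move/eqP; rewrite lead_coef_eq0 => /eqP p'0.
  by move: e; rewrite p'0 size_poly0 => /esym/eqP; rewrite size_poly_eq0 (negPf p0).
have [|k [q [r [Rq Rr E sr]]]] := IH p' _ Rp'; first exact: leq_trans sp' pn.
exists k.+1, (lead_coef d ^+ k *: t + q), r; split=> //.
  by apply: poverD => //; apply: poverZ => //; exact: subringX.
rewrite exprSr -scalerA (_ : lead_coef d *: p = p' + t * d); last by rewrite subrK.
by rewrite scalerDr E mulrDl scalerAl addrC addrA.
Qed.

End Closure.

Lemma pover_sub R S p : R `<=` S -> pover R p -> pover S p.
Proof. by move=> RS Rp i; apply: RS. Qed.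

(* Dividing by [X - z] stays over [K]: the coefficients of the quotient are
   obtained from the top by [q_i = p_(i+1) + z q_(i+1)]. *)
Lemma closed_subfield_root K p x : closed_subfield K -> pover K p -> p != 0 ->
  root p x -> K x.
Proof.
move=> [[sK _] aK]; have [n] := ubnP (size p); elim: n p => // n IH p pn Kp p0 px.
have [z Kz pz] : exists2 x, K x & root p x.
  apply: aK => //; rewrite ltnNge; apply/negP => /size1_polyC E.
  by move: px p0; rewrite E rootE hornerC polyC_eq0 => ->.
have /factor_theorem[q E] := pz.
have [xz|nxz] := eqVneq x z; first by rewrite xz.
have q0 : q != 0 by apply: contraNneq p0 => q0; rewrite E q0 mul0r.
apply: (IH q) => //.
- by rewrite (leq_trans _ (_ : size p <= n)%N) // E size_Mmonic ?monicXsubC // size_XsubC addn2.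
- move=> i; have [m] := ubnP (size q - i); elim: m i => // m IHm i im.
  have [ge|lt] := leqP (size q) i; first by rewrite nth_default //; exact: subring0.
  have -> : q`_i = p`_i.+1 + z * q`_i.+1.
    by rewrite E mulrBr coefB coefMX coefMC /= mulrC subrK.
  apply: subringD => //; apply: subringM => //; apply: IHm.
  by rewrite subnSK // -ltnS.
- by move: px; rewrite E rootM root_XsubC (negPf nxz) orbF.
Qed.

(* [adj1 R x] is the ring [R[x]] and [adj R s] the ring generated by [R] and [s]. *)
Definition adj1 R x : set P := [set y | exists2 p, pover R p & y = p.[x]].

Fixpoint adj R (s : seq P) : set P := if s is x :: s' then adj1 (adj R s') x else R.

Lemma adj1_subring R x : subring_set R -> subring_set (adj1 R x).
Proof.
move=> sR; split.
- by exists 1; rewrite ?hornerC //; apply: poverC => //; exact: subring1.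
- by move=> _ _ [p Rp ->] [q Rq ->]; exists (p - q); rewrite ?hornerE //; exact: poverB.
- by move=> _ _ [p Rp ->] [q Rq ->]; exists (p * q); rewrite ?hornerE //; exact: poverM.
Qed.

Lemma sub_adj1 R x : subring_set R -> R `<=` adj1 R x.
Proof. by move=> sR y Ry; exists y%:P; rewrite ?hornerC //; exact: poverC. Qed.

Lemma mem_adj1 R x : subring_set R -> adj1 R x x.
Proof. by move=> sR; exists 'X; rewrite ?hornerX //; exact: poverX. Qed.

Lemma adj_subring R s : subring_set R -> subring_set (adj R s).
Proof. by move=> sR; elim: s => //= x s; exact: adj1_subring. Qed.

Lemma sub_adj R s : subring_set R -> R `<=` adj R s.
Proof.
move=> sR; elim: s => //= x s IH y Ry; apply: sub_adj1; last exact: IH.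
exact: adj_subring.
Qed.

Lemma mem_adj R s x : subring_set R -> x \in s -> adj R s x.
Proof.
move=> sR; elim: s => //= y s IH; rewrite inE => /predU1P[->|/IH H].
  by apply: mem_adj1; exact: adj_subring.
by apply: sub_adj1 => //; exact: adj_subring.
Qed.

Lemma adj1_min R S x : subring_set S -> R `<=` S -> S x -> adj1 R x `<=` S.
Proof. by move=> sS RS Sx y [p Rp ->]; apply: pover_horner => //; exact: pover_sub Rp. Qed.

Lemma adj_min R S s : subring_set S -> R `<=` S -> (forall x, x \in s -> S x) ->
  adj R s `<=` S.
Proof.
move=> sS RS; elim: s => //= x s IH H; apply: adj1_min => //.
  by apply: IH => y ys; apply: H; rewrite inE ys orbT.
by apply: H; rewrite mem_head.
Qed.

Lemma adj_mono R S s : R `<=` S -> adj R s `<=` adj S s.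
Proof.
move=> RS; elim: s => //= x s IH y [p Rp ->]; exists p => //; exact: pover_sub Rp.
Qed.

Definition transc R x : Prop := forall p, pover R p -> p.[x] = 0 -> p = 0.
Definition algebraic R x : Prop := exists p, [/\ pover R p, p != 0 & p.[x] = 0].

Lemma transcValg R x : transc R x \/ algebraic R x.
Proof.
have [?|na] := pselect (algebraic R x); first by right.
by left=> p Rp px; apply: contrapT => /eqP p0; apply: na; exists p.
Qed.

Lemma exists_minpoly R x : algebraic R x -> exists m,
  [/\ pover R m, m != 0, m.[x] = 0
    & forall p, pover R p -> p.[x] = 0 -> (size p < size m)%N -> p = 0].
Proof.
move=> ax.
have ex : exists n, `[< exists p, [/\ pover R p, p != 0, p.[x] = 0 & size p = n] >].
  by have [p [a b c]] := ax; exists (size p); apply/asboolP; exists p.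
have [n /asboolP[m [Rm m0 mx <-]] nmin] := ex_minnP ex.
exists m; split=> // p Rp px lt; apply: contrapT => /eqP p0.
suff : (size m <= size p)%N by rewrite leqNgt lt.
by apply: nmin; apply/asboolP; exists p.
Qed.

(* The least degree element of the ideal generated by [g], by Euclid. *)
Lemma algebraic_divides R x g : subring_set R -> algebraic R x -> adj1 R x g ->
  g != 0 -> exists r w, [/\ R r, r != 0, adj1 R x w & g * w = r].
Proof.
move=> sR /exists_minpoly[m [Rm m0 mx mmin]] [q Rq gE] g0.
have sA := adj1_subring x sR.
pose T (e : {poly P}) := [/\ pover R e, (size e < size m)%N, e != 0
  & exists2 w, adj1 R x w & e.[x] = g * w].
have ex : exists n, `[< exists e, T e /\ size e = n >].
  have [k [d [e [Rd Re E se]]]] := pseudo_division sR m0 Rm Rq.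
  have ex : e.[x] = g * lead_coef m ^+ k.
    by have := congr1 (horner^~ x) E; rewrite /= !hornerE mx mulr0 add0r -gE mulrC => <-.
  exists (size e); apply/asboolP; exists e; split=> //; split=> //.
    apply/eqP => e0; move: ex; rewrite e0 horner0 => /esym/eqP.
    by rewrite mulf_eq0 (negPf g0) expf_eq0 lead_coef_eq0 (negPf m0) andbF.
  by exists (lead_coef m ^+ k) => //; apply: sub_adj1 => //; apply: subringX => //; exact: Rm.
have [n /asboolP[e [[Re se e0 [w Aw ew]] en]] nmin] := ex_minnP ex.
have [le1|gt1] := leqP (size e) 1.
  have eC := size1_polyC le1.
  exists e`_0, w; split=> //.
    by move: e0; rewrite eC polyC_eq0 coefC eqxx.
  by rewrite -ew eC hornerC coefC eqxx.
exfalso.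
(* Divide [m] by [e]. A zero remainder would make [x] a root of [e] or of the quotient, both of
   smaller degree than [m]; a nonzero remainder contradicts the minimality of [e]. *)
have [k [d [r [Rd Rr E sr]]]] := pseudo_division sR e0 Re Rm.
have Ex : 0 = d.[x] * e.[x] + r.[x].
  by have := congr1 (horner^~ x) E; rewrite /= !hornerE mx mulr0.
have [r0|r0] := eqVneq r 0.
  have ex0 : e.[x] != 0.
    by apply: contraNneq e0 => /(mmin _ Re) /(_ se) ->.
  have dx : d.[x] = 0.
    by move/esym/eqP: Ex; rewrite r0 horner0 addr0 mulf_eq0 (negPf ex0) orbF => /eqP.
  have d0 : d != 0.
    apply: contraNneq m0 => d0; move: E; rewrite d0 r0 mul0r addr0 => /eqP.
    by rewrite scaler_eq0 expf_eq0 lead_coef_eq0 (negPf e0) andbF.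
  have sd : (size d < size m)%N.
    have : size (lead_coef e ^+ k *: m) = (size d + size e).-1.
      by rewrite E r0 addr0 size_mul.
    rewrite size_scale ?expf_eq0 ?lead_coef_eq0 ?(negPf e0) ?andbF // => ->.
    by move: gt1; case: (size e) => [|[|c]] // _; rewrite !addnS /= ltnS leq_addr.
  by move: d0; rewrite (mmin d) ?eqxx.
have : (size e <= size r)%N; last by rewrite leqNgt sr.
rewrite en; apply: nmin; apply/asboolP; exists r; split=> //; split=> //.
  exact: ltn_trans sr se.
exists (- d.[x] * w).
  by apply: subringM => //; apply: subringN => //; exists d.
by apply/eqP; rewrite mulNr mulrN -addr_eq0 addrC mulrCA -ew -Ex.
Qed.

End SubringSets.

Section HomOn.
Variables P Q : fieldType.
Implicit Types (R : set P) (h : P -> Q).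

Definition hom_on R h : Prop :=
  [/\ h 1 = 1, forall x y, R x -> R y -> h (x - y) = h x - h y
    & forall x y, R x -> R y -> h (x * y) = h x * h y].

Section Theory.
Variables (R : set P) (h : P -> Q).
Hypotheses (sR : subring_set R) (hh : hom_on R h).

Lemma hom_on1 : h 1 = 1. Proof. by case: hh. Qed.
Lemma hom_onB x y : R x -> R y -> h (x - y) = h x - h y. Proof. by case: hh => _ + _; apply. Qed.
Lemma hom_onM x y : R x -> R y -> h (x * y) = h x * h y. Proof. by case: hh => _ _; apply. Qed.
Lemma hom_on0 : h 0 = 0.
Proof. by rewrite -(subrr 1) hom_onB ?subrr //; exact: subring1. Qed.
Lemma hom_onN x : R x -> h (- x) = - h x.
Proof. by move=> Rx; rewrite -sub0r hom_onB ?hom_on0 ?sub0r //; exact: subring0. Qed.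
Lemma hom_onD x y : R x -> R y -> h (x + y) = h x + h y.
Proof.
by move=> Rx Ry; rewrite -{1}[y]opprK hom_onB ?hom_onN ?opprK //; exact: subringN.
Qed.
Lemma hom_onX x n : R x -> h (x ^+ n) = h x ^+ n.
Proof.
move=> Rx; elim: n => [|n IH]; first exact: hom_on1.
by rewrite !exprS hom_onM ?IH //; exact: subringX.
Qed.
Lemma hom_on_sum (I : Type) (r : seq I) (F : I -> P) :
  (forall i, R (F i)) -> h (\sum_(i <- r) F i) = \sum_(i <- r) h (F i).
Proof.
move=> H; elim: r => [|i r IH]; first by rewrite !big_nil hom_on0.
by rewrite !big_cons hom_onD ?IH //; exact: subring_sum.
Qed.

Lemma coef_map_hom (p : {poly P}) i : (map_poly h p)`_i = h p`_i.
Proof. by rewrite coef_map_id0 //; exact: hom_on0. Qed.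

Lemma map_hom0 : map_poly h 0 = 0.
Proof. by apply/polyP => i; rewrite coef_map_hom !coef0 hom_on0. Qed.

Lemma map_homC c : map_poly h c%:P = (h c)%:P.
Proof. by apply/polyP => i; rewrite coef_map_hom !coefC; case: ifP; rewrite ?hom_on0. Qed.

Lemma map_homB p q : pover R p -> pover R q ->
  map_poly h (p - q) = map_poly h p - map_poly h q.
Proof. by move=> Rp Rq; apply/polyP => i; rewrite coefB !coef_map_hom coefB hom_onB. Qed.

Lemma map_homM p q : pover R p -> pover R q ->
  map_poly h (p * q) = map_poly h p * map_poly h q.
Proof.
move=> Rp Rq; apply/polyP => i; rewrite coefM coef_map_hom coefM hom_on_sum.
  by apply: eq_bigr => j _; rewrite !coef_map_hom hom_onM.
by move=> j; exact: subringM.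
Qed.

Lemma map_homZ c p : R c -> pover R p -> map_poly h (c *: p) = h c *: map_poly h p.
Proof. by move=> Rc Rp; apply/polyP => i; rewrite coefZ !coef_map_hom coefZ hom_onM. Qed.

Lemma hom_on_horner p x : pover R p -> R x -> h p.[x] = (map_poly h p).[h x].
Proof.
move=> Rp Rx; rewrite horner_coef hom_on_sum; last first.
  by move=> i; apply: subringM => //; exact: subringX.
rewrite /map_poly horner_poly; apply: eq_bigr => i _.
by rewrite hom_onM ?hom_onX //; exact: subringX.
Qed.

Lemma map_hom_neq0 p : pover R p -> h (lead_coef p) != 0 -> map_poly h p != 0.
Proof.
by move=> Rp; apply: contraNneq => p0; rewrite lead_coefE -coef_map_hom p0 coef0.
Qed.

Lemma map_hom_over (C : set Q) p :
  (forall x, R x -> C (h x)) -> pover R p -> pover C (map_poly h p).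
Proof. by move=> RC Rp i; rewrite coef_map_hom; exact: RC. Qed.

Lemma hom_on_extend x y :
  (forall p, pover R p -> p.[x] = 0 -> (map_poly h p).[y] = 0) ->
  exists2 h', hom_on (adj1 R x) h'
    & forall p, pover R p -> h' p.[x] = (map_poly h p).[y].
Proof.
move=> H.
have /choice[h' h'P] : forall z, exists w, forall p, pover R p -> z = p.[x] ->
    w = (map_poly h p).[y].
  move=> z; have [[p Rp zE]|n] := pselect (adj1 R x z); last first.
    by exists 0 => p Rp zE; case: n; exists p.
  exists (map_poly h p).[y] => q Rq; rewrite zE => pq.
  apply/eqP; rewrite -subr_eq0 -hornerN -hornerD -map_homB //; apply/eqP.
  by apply: H; [exact: poverB|rewrite hornerD hornerN pq subrr].
have {}h'P p : pover R p -> h' p.[x] = (map_poly h p).[y] by move=> Rp; exact: h'P.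
exists h' => //; split.
- rewrite -(hornerC 1 x) h'P ?map_homC ?hom_on1 ?hornerC //.
  by apply: poverC => //; exact: subring1.
- move=> _ _ [p Rp ->] [q Rq ->].
  rewrite -hornerN -hornerD (h'P (p - q)); last exact: poverB.
  by rewrite map_homB // hornerD hornerN !h'P.
- move=> _ _ [p Rp ->] [q Rq ->].
  rewrite -hornerM (h'P (p * q)); last exact: poverM.
  by rewrite map_homM // hornerM !h'P.
Qed.

End Theory.

Lemma hom_on_sub R S h : R `<=` S -> hom_on S h -> hom_on R h.
Proof. by move=> RS [a b c]; split=> // x y /RS ? /RS ?; [exact: b|exact: c]. Qed.

Lemma hom_on_inj K h x y : subfield_set K -> hom_on K h -> K x -> K y ->
  h x = h y -> x = y.
Proof.
move=> [sK iK] hh Kx Ky e; apply/eqP; rewrite -subr_eq0; apply/negP => /negP n.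
have Kxy : K (x - y) by exact: subringB.
have : h ((x - y) * (x - y)^-1) = 0.
  by rewrite (hom_onM hh) ?(hom_onB hh) // ?e ?subrr ?mul0r //; exact: iK.
by rewrite mulfV // (hom_on1 hh) => /eqP; rewrite oner_eq0.
Qed.

Lemma hom_onV K h x : subfield_set K -> hom_on K h -> K x -> h x^-1 = (h x)^-1.
Proof.
move=> sfK hh Kx; have [sK iK] := sfK.
have [->|x0] := eqVneq x 0; first by rewrite invr0 (hom_on0 sK hh) invr0.
have hx0 : h x != 0.
  apply: contraNneq x0 => hx; apply/eqP; apply: (hom_on_inj sfK hh) => //.
    exact: subring0.
  by rewrite hx (hom_on0 sK hh).
by apply: (mulfI hx0); rewrite -(hom_onM hh) ?mulfV ?(hom_on1 hh) //; exact: iK.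
Qed.

Lemma subfield_image K h : subfield_set K -> hom_on K h -> subfield_set (h @` K).
Proof.
move=> sfK hh; have [sK iK] := sfK; split; first split.
- by exists 1; [exact: subring1|exact: (hom_on1 hh)].
- by move=> _ _ [x Kx <-] [y Ky <-]; exists (x - y); [exact: subringB|rewrite (hom_onB hh)].
- by move=> _ _ [x Kx <-] [y Ky <-]; exists (x * y); [exact: subringM|rewrite (hom_onM hh)].
- by move=> _ [x Kx <-]; exists x^-1; [exact: iK|rewrite (hom_onV sfK)].
Qed.

Lemma pover_image R h (p : {poly Q}) : subring_set R -> hom_on R h -> pover (h @` R) p ->
  exists q, [/\ pover R q, map_poly h q = p & size q = size p].
Proof.
move=> sR hh Rp.
have /choice[c cP] : forall i, exists c, R c /\ h c = p`_i.
  by move=> i; have [c] := Rp i; exists c.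
exists (\poly_(i < size p) c i); split.
- by move=> i; rewrite coef_poly; case: ifP => _; [case: (cP i)|exact: subring0].
- apply/polyP => i; rewrite (coef_map_hom sR hh) coef_poly.
  case: ltnP => [_|le]; first by case: (cP i).
  by rewrite (hom_on0 sR hh) nth_default.
- have [->|p0] := eqVneq p 0; first by rewrite size_poly0 /= poly_def big_ord0 size_poly0.
  rewrite size_poly_eq //; apply: contra_neq p0 => c0; apply/eqP.
  by rewrite -lead_coef_eq0 lead_coefE -(cP _).2 c0 (hom_on0 sR hh).
Qed.

Lemma nonroot_exists (K : set Q) (q : {poly Q}) : [pchar Q] =i pred0 ->
  subring_set K -> q != 0 -> exists2 y, K y & q.[y] != 0.
Proof.
move=> ch sK q0; apply: contrapT => n.
have H y : K y -> q.[y] = 0.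
  by move=> Ky; apply: contrapT => /eqP qy; apply: n; exists y.
(* In characteristic zero the natural numbers already supply more points of [K] than [q] has
   roots. *)
pose s : seq Q := [seq i%:R | i <- iota 0 (size q)].
have us : uniq s.
  rewrite map_inj_uniq ?iota_uniq // => i j /eqP; rewrite -subr_eq0.
  wlog ij : i j / (i <= j)%N.
    move=> W; have [/W//|/ltnW/W H'] := leqP i j; rewrite -oppr_eq0 opprB => /H'.
    by move=> ->.
  rewrite -oppr_eq0 opprB -natrB // ((pcharf0P Q).1 ch) subn_eq0 => ji.
  by apply/eqP; rewrite eqn_leq ij.
have /(max_poly_roots q0) : all (root q) s.
  by apply/allP => _ /mapP[i _ ->]; rewrite rootE H //; exact: subring_nat.
by move=> /(_ us); rewrite size_map size_iota ltnn.
Qed.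

(* A ring homomorphism into an algebraically closed field extends to [R[x]] off
   the zero set of one element. The companion subring [RK] is sent into [K];
   when [x] is transcendental over [R] its image can be chosen in [K], when it
   is algebraic over [RK] its image is forced into [K]. *)
Lemma specialize1 (R RK : set P) (C K : set Q) x g :
  [pchar Q] =i pred0 -> subring_set R -> subring_set RK -> RK `<=` R ->
  closed_subfield C -> closed_subfield K -> K `<=` C ->
  transc R x \/ algebraic RK x -> adj1 R x g -> g != 0 ->
  exists r, [/\ R r, r != 0 & forall h, hom_on R h ->
    (forall y, R y -> C (h y)) -> (forall y, RK y -> K (h y)) -> h r != 0 ->
    exists h', [/\ hom_on (adj1 R x) h', forall y, R y -> h' y = h y,
      forall y, adj1 R x y -> C (h' y), forall y, adj1 RK x y -> K (h' y)
      & h' g != 0]].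
Proof.
move=> ch sR sRK RKR cC cK KC dich Ag g0.
have [[sC _] aC] := cC; have [[sK _] aK] := cK.
have finish h y : hom_on R h -> (forall y, R y -> C (h y)) ->
    (forall y, RK y -> K (h y)) -> K y ->
    (forall p, pover R p -> p.[x] = 0 -> (map_poly h p).[y] = 0) ->
    (forall h', hom_on (adj1 R x) h' ->
       (forall p, pover R p -> h' p.[x] = (map_poly h p).[y]) -> h' g != 0) ->
    exists h', [/\ hom_on (adj1 R x) h', forall y, R y -> h' y = h y,
      forall y, adj1 R x y -> C (h' y), forall y, adj1 RK x y -> K (h' y)
      & h' g != 0].
  move=> hh hC hK Ky rel hg.
  have [h' hh' h'E] := hom_on_extend sR hh rel.
  exists h'; split=> //; last exact: hg.
  - by move=> z Rz; rewrite -[z in LHS](hornerC z x) h'E ?(map_homC sR hh) ?hornerC //; exact: poverC.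
  - move=> _ [p Rp ->]; rewrite h'E //; apply: pover_horner => //; last exact: KC.
    exact: (map_hom_over sR hh).
  - move=> _ [p Rp ->]; rewrite h'E; last exact: pover_sub Rp.
    apply: pover_horner => //.
    by apply: (map_hom_over sRK (hom_on_sub RKR hh)).
have [tr|nt] := pselect (transc R x).
  have [q Rq gE] := Ag.
  have q0 : q != 0 by apply: contraNneq g0 => q0; rewrite gE q0 horner0.
  exists (lead_coef q); split; [exact: Rq|by rewrite lead_coef_eq0|].
  move=> h hh hC hK hr; have mq := map_hom_neq0 sR hh Rq hr.
  have [y Ky qy] := nonroot_exists ch sK mq.
  apply: (finish h y) => //.
    by move=> p Rp /(tr _ Rp)->; rewrite (map_hom0 sR hh) horner0.
  by move=> h' hh' h'E; rewrite gE h'E.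
have {dich}[pK [RpK pK0 pKx]] : algebraic RK x by case: dich.
have alg : algebraic R x by exists pK; split=> //; exact: pover_sub RpK.
have [m [Rm m0 mx mmin]] := exists_minpoly alg.
have [r0 [w [Rr0 r00 Aw gw]]] := algebraic_divides sR alg Ag g0.
(* The first factor keeps the degree of [m], so that its image has a root and pseudo-division by [m]
   can be cancelled; the second keeps the image of [pK] nonzero, which forces the root into [K]; the
   third is a multiple of [g], so that the image of [g] cannot vanish. *)
exists (lead_coef m * lead_coef pK * r0).
have Rlm : R (lead_coef m) by exact: Rm.
have RlK : R (lead_coef pK) by apply: RKR; exact: RpK.
split.
- by do 2?apply: subringM => //.
- by rewrite !mulf_neq0 ?lead_coef_eq0.
move=> h hh hC hK; rewrite !(hom_onM hh) //; last exact: subringM.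
rewrite !mulf_eq0 !negb_or => /andP[/andP[hm hpK] hr0].
have [y Cy my] : exists2 y, C y & root (map_poly h m) y.
  apply: aC; first exact: (map_hom_over sR hh).
  have le1 : (1 < size m)%N.
    rewrite ltnNge; apply/negP => /size1_polyC mC.
    by move: mx m0; rewrite mC hornerC polyC_eq0 => ->; rewrite eqxx.
  rewrite ltnNge; apply/negP => /leq_sizeP/(_ (size m).-1).
  rewrite -subn1 leq_subRL ?addn1 ?(ltnW le1) // => /(_ le1).
  by rewrite subn1 (coef_map_hom sR hh) -lead_coefE => /eqP; rewrite (negPf hm).
have rel p : pover R p -> p.[x] = 0 -> (map_poly h p).[y] = 0.
  move=> Rp px; have [k [q [r [Rq Rr E sr]]]] := pseudo_division sR m0 Rm Rp.
  have r_0 : r = 0.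
    apply: mmin => //; have := congr1 (horner^~ x) E.
    by rewrite /= !hornerE mx px !mulr0 add0r => <-.
  have Rlk : R (lead_coef m ^+ k) by exact: subringX.
  have := congr1 (fun p => (map_poly h p).[y]) E.
  rewrite /= r_0 addr0 (map_homZ sR hh) // (map_homM sR hh) // !hornerE.
  rewrite (rootP my) mulr0 (hom_onX sR hh) // => /eqP.
  by rewrite mulf_eq0 expf_eq0 (negPf hm) andbF => /eqP.
have Ky : K y.
  apply: (closed_subfield_root cK (p := map_poly h pK)).
  - exact: (map_hom_over sRK (hom_on_sub RKR hh)).
  - exact: (map_hom_neq0 sRK (hom_on_sub RKR hh)).
  - by apply/rootP; apply: rel => //; exact: pover_sub RpK.
apply: (finish h y) => //.
move=> h' hh' h'E; apply: contraNneq hr0 => hg.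
have <- : h' r0 = h r0.
  by rewrite -[r0 in LHS](hornerC r0 x) h'E ?(map_homC sR hh) ?hornerC //; exact: poverC.
by rewrite -gw (hom_onM hh') // hg mul0r.
Qed.

(** Generators are adjoined from the end of [s]. The condition is automatic for [RK = R]; for a
    larger [R] it is what independence provides, namely a transcendence basis over [RK] that stays
    one over [R], followed by algebraic elements. *)
Fixpoint dichotomy (R RK : set P) (s : seq P) : Prop :=
  if s is x :: s' then
    (transc (adj R s') x \/ algebraic (adj RK s') x) /\ dichotomy R RK s'
  else True.

Lemma dichotomy_refl R s : dichotomy R R s.
Proof. by elim: s => //= x s IH; split=> //; exact: transcValg. Qed.

(** The condition that [g] does not vanish is pulled back through the generators one by one until it
    concerns a single element of [R]; the homomorphism is then extended in the opposite
    direction. *)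
Lemma specialize (R RK : set P) (C K : set Q) s g :
  [pchar Q] =i pred0 -> subring_set R -> subring_set RK -> RK `<=` R ->
  closed_subfield C -> closed_subfield K -> K `<=` C ->
  dichotomy R RK s -> adj R s g -> g != 0 ->
  exists r, [/\ R r, r != 0 & forall h, hom_on R h ->
    (forall y, R y -> C (h y)) -> (forall y, RK y -> K (h y)) -> h r != 0 ->
    exists h', [/\ hom_on (adj R s) h', forall y, R y -> h' y = h y,
      forall y, adj R s y -> C (h' y), forall y, adj RK s y -> K (h' y)
      & h' g != 0]].
Proof.
move=> ch sR sRK RKR cC cK KC; elim: s g => [|x s IH] g /=.
  by move=> _ Rg g0; exists g; split=> // h hh hC hK hg; exists h.
move=> [dx ds] Ag g0.
have [r [Rr r0 H]] := specialize1 ch (adj_subring s sR) (adj_subring s sRK)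
  (adj_mono (s := s) RKR) cC cK KC dx Ag g0.
have [r' [Rr' r'0 H']] := IH r ds Rr r0.
exists r'; split=> // h hh hC hK hr'.
have [h1 [hh1 h1E h1C h1K h1r]] := H' h hh hC hK hr'.
have [h2 [hh2 h2E h2C h2K h2g]] := H h1 hh1 h1C h1K h1r.
exists h2; split=> // y Ry; rewrite h2E ?h1E //; exact: sub_adj.
Qed.

End HomOn.

(** * Algebraic closure and linear disjointness *)

Section SubfieldType.
Variables (P : fieldType) (K : set P).

Definition subf_pred (sK : subfield_set K) : {pred P} := mem K.

Variable sK : subfield_set K.

Fact subf_divring : divring_closed (subf_pred sK).
Proof.
have [rK iK] := sK.
split=> [|x y /set_mem Kx /set_mem Ky|x y /set_mem Kx /set_mem Ky]; apply: mem_set.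
- exact: subring1.
- exact: subringB.
- by apply: subringM => //; exact: iK.
Qed.

HB.instance Definition _ := GRing.isDivringClosed.Build P (subf_pred sK) subf_divring.
(** Turns a set into a field type, which gives access to the closure of [algebraicOver] under the
    field operations. *)
Definition subf := {x : P | x \in subf_pred sK}.
HB.instance Definition _ := SubChoice.on subf.
HB.instance Definition _ := [SubChoice_isSubIntegralDomain of subf by <:].
HB.instance Definition _ := [SubIntegralDomain_isSubField of subf by <:].

Lemma algebraic_subf x : algebraic K x <-> algebraicOver (val : subf -> P) x.
Proof.
have [rK iK] := sK.
split=> [[p [Kp p0 px]]|[p p0 px]].
  pose c i : subf := exist _ p`_i (mem_set (Kp i)).
  pose q : {poly subf} := \poly_(i < size p) c i.
  have qE : map_poly val q = p.
    apply/polyP => i; rewrite coef_map /= coef_poly.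
    by case: ltnP => // le; rewrite nth_default.
  exists q; first by apply: contraNneq p0 => q0; rewrite -qE q0 rmorph0.
  by rewrite qE; apply/rootP.
exists (map_poly val p); split.
- by move=> i; rewrite coef_map /=; apply: set_mem; exact: (valP (p`_i)).
- by rewrite map_poly_eq0.
- exact/rootP.
Qed.

End SubfieldType.

Section Algebraic.
Variable P : fieldType.
Implicit Types (R K : set P).

Definition frac R : set P := [set z | exists x y, [/\ R x, R y, y != 0 & z = x / y]].

Lemma frac_subfield R : subring_set R -> subfield_set (frac R).
Proof.
move=> sR; split; first split.
- by exists 1, 1; rewrite divr1 oner_eq0; split=> //; exact: subring1.
- move=> _ _ [x [y [Rx Ry y0 ->]]] [x' [y' [Rx' Ry' y'0 ->]]].
  exists (x * y' - x' * y), (y * y'); split.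
  + by apply: subringB => //; exact: subringM.
  + exact: subringM.
  + exact: mulf_neq0.
  + by rewrite -mulNr addf_div // mulNr.
- move=> _ _ [x [y [Rx Ry y0 ->]]] [x' [y' [Rx' Ry' y'0 ->]]].
  exists (x * x'), (y * y'); split; [exact: subringM|exact: subringM|exact: mulf_neq0|].
  by rewrite mulf_div.
- move=> _ [x [y [Rx Ry y0 ->]]]; rewrite invf_div.
  have [->|x0] := eqVneq x 0; last by exists y, x.
  rewrite invr0 mulr0; exists 0, 1; rewrite mul0r oner_eq0; split=> //.
    exact: subring0.
  exact: subring1.
Qed.

Lemma sub_frac R : subring_set R -> R `<=` frac R.
Proof.
by move=> sR x Rx; exists x, 1; rewrite divr1 oner_eq0; split=> //; exact: subring1.
Qed.

Lemma algebraic_frac R x : subring_set R -> algebraic (frac R) x -> algebraic R x.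
Proof.
move=> sR [p [Rp p0 px]].
have [d [Rd d0 H]] : exists d, [/\ R d, d != 0
    & forall i, (i < size p)%N -> R (d * p`_i)].
  elim: (size p) => [|n [d [Rd d0 H]]].
    by exists 1; rewrite oner_eq0; split=> //; exact: subring1.
  have [a [b [Ra Rb b0 pE]]] := Rp n.
  exists (d * b); split; [exact: subringM|exact: mulf_neq0|].
  move=> i; rewrite ltnS leq_eqVlt => /predU1P[->|/H Hi].
    by rewrite pE -mulrA [b * _]mulrC divfK //; exact: subringM.
  by rewrite mulrAC; exact: subringM.
exists (d *: p); split.
- move=> i; rewrite coefZ; have [/H//|le] := ltnP i (size p).
  by rewrite nth_default // mulr0; exact: subring0.
- by rewrite scaler_eq0 negb_or d0.
- by rewrite hornerZ px mulr0.
Qed.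

Lemma algebraic_mono R S x : R `<=` S -> algebraic R x -> algebraic S x.
Proof. by move=> RS [p [Rp p0 px]]; exists p; split=> //; exact: pover_sub Rp. Qed.

Lemma algebraic_mem R x : subring_set R -> R x -> algebraic R x.
Proof.
move=> sR Rx; exists ('X - x%:P); split.
- by apply: poverB => //; [exact: poverX|exact: poverC].
- by rewrite polyXsubC_eq0.
- by rewrite hornerXsubC subrr.
Qed.

Lemma algebraic_closed R : subring_set R ->
  (forall p : {poly P}, (1 < size p)%N -> exists x, root p x) ->
  closed_subfield [set x | algebraic R x].
Proof.
move=> sR aP; have sF := frac_subfield sR.
have E x : algebraic R x <-> algebraicOver (val : subf sF -> P) x.
  rewrite -algebraic_subf; split; last exact: algebraic_frac.
  exact/algebraic_mono/sub_frac.
split; first split; first split.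
- by rewrite /=; apply: algebraic_mem => //; exact: subring1.
- by move=> x y /E ax /E ay; apply/E; exact: algebraic_sub.
- by move=> x y /E ax /E ay; apply/E; exact: algebraic_mul.
- by move=> x /E ax; apply/E; exact: algebraic_inv.
move=> p Rp p1; have [x px] := aP _ p1; exists x => //=; apply/E/integral_algebraic.
have p0 : lead_coef p != 0.
  by rewrite lead_coef_eq0 -size_poly_gt0 ltnW.
(* Over a field, algebraic means integral, and a root of a monic polynomial with integral
   coefficients is integral. *)
apply: (@integral_root_monic _ _ _ x ((lead_coef p)^-1 *: p)).
- by rewrite monicE lead_coefZ mulVf.
- by rewrite rootE hornerZ (rootP px) mulr0.
- apply/integral_poly => i; rewrite coefZ; apply/integral_algebraic/algebraic_mul.
    by apply/algebraic_inv/E; exact: Rp.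
  by apply/E; exact: Rp.
Qed.

End Algebraic.

Section Linear.
Variable P : fieldType.
Implicit Types (K C B R : set P) (e : seq P) (c : nat -> P).

(** Coefficients are indexed by all of [nat], so that they need not be resized with [e]; only those
    below [size e] count. *)
Definition lc c e : P := \sum_(l < size e) c l * e`_l.

Definition linindep K e : Prop :=
  forall c, (forall l, K (c l)) -> lc c e = 0 -> forall l, (l < size e)%N -> c l = 0.

Definition span K e : set P :=
  [set z | exists2 c, (forall l, K (c l)) & z = lc c e].

Lemma lc_cons c x e : lc c (x :: e) = c 0%N * x + lc (fun l => c l.+1) e.
Proof. by rewrite /lc big_ord_recl. Qed.

Lemma lcB c d e : lc (fun l => c l - d l) e = lc c e - lc d e.
Proof. by rewrite /lc -sumrB; apply: eq_bigr => i _; rewrite mulrBl. Qed.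

Lemma lcD c d e : lc (fun l => c l + d l) e = lc c e + lc d e.
Proof. by rewrite /lc -big_split; apply: eq_bigr => i _; rewrite mulrDl. Qed.

Lemma lcZ a c e : lc (fun l => c l * a) e = lc c e * a.
Proof. by rewrite /lc mulr_suml; apply: eq_bigr => i _; rewrite mulrAC. Qed.

Lemma lc0 e : lc (fun=> 0) e = 0.
Proof. by rewrite /lc big1 // => i _; rewrite mul0r. Qed.

Lemma exists_basis K (g : seq P) : subfield_set K -> exists e,
  [/\ forall x, x \in e -> x \in g, linindep K e & forall x, x \in g -> span K e x].
Proof.
move=> [sK iK]; elim: g => [|x g [e [eg ie ge]]]; first by exists [::].
have [xe|nxe] := pselect (span K e x).
  exists e; split=> // y; first by move=> /eg yg; rewrite inE yg orbT.
  by rewrite inE => /predU1P[->|/ge].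
exists (x :: e); split=> [y|c Kc|y]; rewrite ?inE.
- by move=> /predU1P[->|/eg->]; rewrite ?eqxx ?orbT.
- rewrite lc_cons => E.
  have c0 : c 0%N = 0.
    apply: contrapT => /eqP c0; apply: nxe; exists (fun l => c l.+1 * (- (c 0%N)^-1)).
      by move=> l; apply: subringM => //; apply: subringN => //; exact: iK.
    apply: (mulfI c0); rewrite lcZ mulrN mulrN mulrCA mulfV // mulr1.
    by apply/eqP; rewrite -addr_eq0; apply/eqP.
  move: E; rewrite c0 mul0r add0r => /ie H [|l] //= le; apply: H => //.
- move=> /predU1P[->|/ge[c Kc ->]].
    exists (fun l => (l == 0)%:R); first by move=> l; exact: subring_nat.
    by rewrite lc_cons mul1r /= lc0 addr0.
  exists (fun l => if l is l'.+1 then c l' else 0).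
    by case=> [|l] //; exact: subring0.
  by rewrite lc_cons mul0r add0r.
Qed.

Definition lin_disjoint C B K : Prop :=
  forall e, (forall x, x \in e -> C x) -> linindep K e -> linindep B e.

(** Expand the coefficients [c] in a [K]-basis [f] of their span. Regrouping turns a relation among
    [e] over [C] into one among [f] over [B]; its coefficients vanish, and they are [K]-combinations
    of [e]. *)
Lemma lin_disjoint_sym C B K : subfield_set K -> subring_set B -> K `<=` B ->
  lin_disjoint C B K -> lin_disjoint B C K.
Proof.
move=> sfK sB KB ld e eB ie c Cc E l le; have [sK _] := sfK.
have [f [fc if_ cf]] := exists_basis (map c (iota 0 (size e))) sfK.
have /choice[d dP] : forall i, exists d, (i < size e)%N ->
    (forall j, K (d j)) /\ c i = lc d f.
  move=> i; have [ie'|] := ltnP i (size e); last by exists c.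
  have [|d Kd cd] := cf (c i); last by exists d.
  by apply/mapP; exists i => //; rewrite mem_iota.
pose b j := \sum_(i < size e) d i j * e`_i.
have Bb j : B (b j).
  apply: subring_sum => // i; apply: subringM => //.
    by apply: KB; have [] := dP i (ltn_ord i).
  by apply: eB; exact: mem_nth.
have bE : lc b f = 0.
  rewrite -E /lc /b.
  transitivity (\sum_(i < size e) \sum_(j < size f) d i j * e`_i * f`_j).
    by rewrite exchange_big /=; apply: eq_bigr => j _; rewrite mulr_suml.
  apply: eq_bigr => i _; have [_ ->] := dP i (ltn_ord i).
  by rewrite /lc mulr_suml; apply: eq_bigr => j _; rewrite mulrAC.
have fC x : x \in f -> C x by move=> /fc/mapP[i _ ->].
have [_ ->] := dP l le.
rewrite /lc big1 // => j _.
have bj : b j = 0 by apply: (ld f fC if_ b Bb bE).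
suff -> : d l j = 0 by rewrite mul0r.
have := ie (fun i => if (i < size e)%N then d i j else 0).
move=> /(_ _ _ l le); rewrite le; apply.
  move=> i; case: ifP => [lt|_]; last exact: subring0.
  by have [] := dP i lt.
by rewrite -bj /lc /b; apply: eq_bigr => i _; rewrite ltn_ord.
Qed.

(** The image in [P] of the tensor product of [C] and [R] over a common subfield. Linear
    disjointness makes the map from the tensor product injective. *)
Definition comp C R : set P := [set z | exists2 l : seq (P * P),
  (forall p, p \in l -> C p.1 /\ R p.2) & z = \sum_(p <- l) p.1 * p.2].

Lemma sub_compl C R : R 1 -> C `<=` comp C R.
Proof.
move=> R1 x Cx; exists [:: (x, 1)]; last by rewrite big_seq1 mulr1.
by move=> p; rewrite inE => /eqP->.
Qed.

Lemma sub_compr C R : C 1 -> R `<=` comp C R.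
Proof.
move=> C1 x Rx; exists [:: (1, x)]; last by rewrite big_seq1 mul1r.
by move=> p; rewrite inE => /eqP->.
Qed.

Lemma comp_subring C R : subring_set C -> subring_set R -> subring_set (comp C R).
Proof.
move=> sC sR; split; first by apply: sub_compl; exact: subring1.
- move=> _ _ [l lP ->] [k kP ->]; exists (l ++ [seq (- p.1, p.2) | p <- k]).
    move=> p; rewrite mem_cat => /orP[/lP//|/mapP[q /kP[Cq Rq] ->]]; split=> //.
    exact: subringN.
  rewrite big_cat big_map; congr (_ + _); rewrite -sumrN.
  by apply: eq_bigr => p _; rewrite mulNr.
- move=> _ _ [l lP ->] [k kP ->].
  exists [seq (p.1 * q.1, p.2 * q.2) | p <- l, q <- k].
    move=> _ /allpairsP[[p q] /= [/lP[? ?] /kP[? ?] ->]]; split; exact: subringM.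
  rewrite big_allpairs_dep mulr_suml; apply: eq_bigr => p _.
  by rewrite mulr_sumr; apply: eq_bigr => q _; rewrite mulrACA.
Qed.

(** The same coordinates serve for the element and for its image under the identity tensored with
    [s], so the two can be compared. *)
Lemma comp_coordinates K R (s : P -> P) e (l : seq (P * P)) :
  subring_set R -> K `<=` R -> hom_on R s -> (forall x, K x -> s x = x) ->
  (forall p, p \in l -> span K e p.1 /\ R p.2) ->
  exists2 b, (forall j, R (b j))
    & \sum_(p <- l) p.1 * p.2 = lc b e /\
      \sum_(p <- l) p.1 * s p.2 = lc (fun j => s (b j)) e.
Proof.
move=> sR KR hs sK; elim: l => [|p l IH] lP.
  exists (fun=> 0); first by move=> _; exact: subring0.
  by rewrite !big_nil (hom_on0 sR hs) lc0.
have [q ql|b Rb [E1 E2]] := IH; first by apply: lP; rewrite inE ql orbT.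
have [[c Kc pE] Rp] := lP p (mem_head _ _).
have Rcp j : R (c j * p.2) by apply: subringM => //; exact: KR.
exists (fun j => c j * p.2 + b j); first by move=> j; exact: subringD.
rewrite !big_cons E1 E2 pE lcD lcZ; split=> //.
rewrite -lcZ -lcD /lc; apply: eq_bigr => j _; congr (_ * _).
by rewrite (hom_onD sR hs) // (hom_onM hs) ?(sK _ (Kc j)) //; exact: KR.
Qed.

(** The extension is the identity of [C] tensored with [s], well defined by linear disjointness. As
    [r] one takes a nonzero coordinate of [g] in a [K]-independent family of [C]: the coordinates of
    the image of [g] are the values of [s], so it vanishes only if all of them do. *)
Lemma comp_extend C B K R g : subfield_set K -> subring_set C -> subring_set R ->
  K `<=` C -> K `<=` R -> R `<=` B -> lin_disjoint C B K ->
  comp C R g -> g != 0 ->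
  exists r, [/\ R r, r != 0 & forall s, hom_on R s -> (forall x, R x -> K (s x)) ->
    (forall x, K x -> s x = x) -> s r != 0 ->
    exists h, [/\ hom_on (comp C R) h, forall x, R x -> h x = s x,
      forall x, C x -> h x = x, forall x, comp C R x -> C (h x) & h g != 0]].
Proof.
move=> sfK sC sR KC KR RB ld [lg lgP gE] g0; have [sK _] := sfK.
have basis (l : seq (P * P)) : (forall p, p \in l -> C p.1 /\ R p.2) ->
    exists e, [/\ forall x, x \in e -> C x, linindep K e
      & forall p, p \in l -> span K e p.1 /\ R p.2].
  move=> lP; have [e [ea ie ae]] := exists_basis (map fst l) sfK.
  exists e; split=> //; first by move=> x /ea/mapP[p /lP[? _] ->].
  by move=> p pl; split; [apply: ae; exact: map_f|case: (lP _ pl)].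
have [e [eC ie ge]] := basis lg lgP.
have hom_id : hom_on R (fun x : P => x) by [].
have [b Rb [gb _]] := comp_coordinates sR KR hom_id (fun _ _ => erefl) ge.
have [l le bl] : exists2 l, (l < size e)%N & b l != 0.
  apply: contrapT => n; case/eqP: g0; rewrite gE gb /lc big1 // => i _.
  suff -> : b i = 0 by rewrite mul0r.
  by apply: contrapT => /eqP bi; apply: n; exists i.
exists (b l); split=> // s hs sR' sK' sbl.
pose val2 (l : seq (P * P)) := \sum_(p <- l) p.1 * s p.2.
have wd l1 l2 : (forall p, p \in l1 -> C p.1 /\ R p.2) ->
    (forall p, p \in l2 -> C p.1 /\ R p.2) ->
    \sum_(p <- l1) p.1 * p.2 = \sum_(p <- l2) p.1 * p.2 -> val2 l1 = val2 l2.
  move=> l1P l2P; have [|f [fC if_ lf]] := basis (l1 ++ l2).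
    by move=> p; rewrite mem_cat => /orP[/l1P|/l2P].
  have [p pl|b1 Rb1 [E1 F1]] := comp_coordinates (e := f) (l := l1) sR KR hs sK'.
    by apply: lf; rewrite mem_cat pl.
  have [p pl|b2 Rb2 [E2 F2]] := comp_coordinates (e := f) (l := l2) sR KR hs sK'.
    by apply: lf; rewrite mem_cat pl orbT.
  rewrite E1 E2 /val2 F1 F2 => /eqP; rewrite -subr_eq0 -lcB => /eqP /(ld f fC if_) H.
  rewrite /lc; apply: eq_bigr => j _; congr (s _ * _); apply/eqP; rewrite -subr_eq0.
  by apply/eqP/H => // i; apply: RB; exact: subringB.
have /choice[h hP] : forall z, exists w, forall l,
    (forall p, p \in l -> C p.1 /\ R p.2) -> z = \sum_(p <- l) p.1 * p.2 -> w = val2 l.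
  move=> z; have [[l1 l1P zE]|n] := pselect (comp C R z); last first.
    by exists 0 => l1 l1P zE; case: n; exists l1.
  by exists (val2 l1) => l2 l2P zE2; apply: wd => //; rewrite -zE -zE2.
exists h; split.
- have h1 : h 1 = 1.
    rewrite (hP 1 [:: (1, 1)]); last by rewrite big_seq1 mulr1.
      by rewrite /val2 big_seq1 (hom_on1 hs) mulr1.
    by move=> p; rewrite inE => /eqP->; split; exact: subring1.
  split=> // [_ _ [l1 l1P ->] [l2 l2P ->]|_ _ [l1 l1P ->] [l2 l2P ->]].
  + rewrite (hP _ l1 l1P erefl) (hP _ l2 l2P erefl).
    rewrite (hP _ (l1 ++ [seq (- p.1, p.2) | p <- l2])).
    * rewrite /val2 big_cat big_map /= -sumrN; congr (_ + _).
      by apply: eq_bigr => p _; rewrite mulNr.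
    * move=> p; rewrite mem_cat => /orP[/l1P//|/mapP[q /l2P[Cq Rq] ->]]; split=> //.
      exact: subringN.
    * rewrite big_cat big_map /= -sumrN; congr (_ + _).
      by apply: eq_bigr => p _; rewrite mulNr.
  + rewrite (hP _ l1 l1P erefl) (hP _ l2 l2P erefl).
    rewrite (hP _ [seq (p.1 * q.1, p.2 * q.2) | p <- l1, q <- l2]).
    * rewrite /val2 big_allpairs_dep mulr_suml; apply: eq_big_seq => p /l1P[_ Rp].
      rewrite mulr_sumr; apply: eq_big_seq => q /l2P[_ Rq] /=.
      by rewrite (hom_onM hs) // mulrACA.
    * move=> _ /allpairsP[[p q] /= [/l1P[? ?] /l2P[? ?] ->]]; split; exact: subringM.
    * rewrite big_allpairs_dep mulr_suml; apply: eq_bigr => p _.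
      by rewrite mulr_sumr; apply: eq_bigr => q _; rewrite mulrACA.
- move=> x Rx; rewrite (hP x [:: (1, x)]) ?big_seq1 ?mul1r //.
    by rewrite /val2 big_seq1 mul1r.
  by move=> p; rewrite inE => /eqP->; split=> //; exact: subring1.
- move=> x Cx; rewrite (hP x [:: (x, 1)]) ?big_seq1 ?mulr1 //.
    by rewrite /val2 big_seq1 (hom_on1 hs) mulr1.
  by move=> p; rewrite inE => /eqP->; split=> //; exact: subring1.
- move=> _ [l1 l1P ->]; rewrite (hP _ l1) // /val2.
  elim: l1 l1P => [|p l1 IH] l1P; first by rewrite big_nil; exact: subring0.
  rewrite big_cons; have [Cp Rp] := l1P p (mem_head _ _); apply: subringD => //.
    by apply: subringM => //; apply: KC; exact: sR'.
  by apply: IH => q ql; apply: l1P; rewrite inE ql orbT.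
- have [b' Rb' [gb' sb']] := comp_coordinates sR KR hs sK' ge.
  have bb' : forall j, (j < size e)%N -> b j = b' j.
    move=> j je; apply/eqP; rewrite -subr_eq0; apply/eqP.
    apply: (ld e eC ie (fun j => b j - b' j)) => //.
      by move=> i; apply: RB; exact: subringB.
    by rewrite lcB -gb -gb' subrr.
  rewrite (hP g lg lgP gE) /val2 sb'; apply: contraNneq sbl => /ie H.
  by rewrite (bb' l le); apply/eqP; apply: (H _ l le) => j; exact: sR'.
Qed.

End Linear.

(** * Algebraic independence *)

Section Mpoly.
Variable P : fieldType.

Lemma mpoly_morph_eq n (S : comNzRingType) (f g : {rmorphism {mpoly P[n]} -> S}) :
  (forall c, f c%:MP = g c%:MP) -> (forall i, f 'X_i = g 'X_i) -> f =1 g.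
Proof.
move=> fgC fgX p; rewrite [p]mpolyE !rmorph_sum; apply: eq_bigr => m _.
rewrite -mul_mpolyC !rmorphM fgC; congr (_ * _).
rewrite mpolyXE_id !rmorph_prod; apply: eq_bigr => i _.
by rewrite !rmorphXn fgX.
Qed.

(* The image of a variable under the isomorphism of [P[X_0,...,X_n]] with
   [P[X_0,...,X_(n-1)][X]]. *)
Definition muni_var n (i : 'I_n.+1) : {poly {mpoly P[n]}} :=
  if unlift ord_max i is Some j then ('X_j)%:P else 'X.

Local Notation muni := (mmap (polyC \o @mpolyC _ P) (@muni_var _)).

Lemma muni_widen n (p : {mpoly P[n]}) : muni (mwiden p) = p%:P.
Proof.
pose f : {rmorphism {mpoly P[n]} -> {poly {mpoly P[n]}}} := muni \o @mwiden n P.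
pose g : {rmorphism {mpoly P[n]} -> {poly {mpoly P[n]}}} := polyC.
apply: (@mpoly_morph_eq _ _ f g) => [c|i] /=; first by rewrite mwidenC mmapC.
rewrite mwidenX mnmwiden1 mmapX mmap1U /muni_var.
have -> : widen_ord (leqnSn n) i = lift ord_max i.
  by apply: val_inj; rewrite /= /bump leqNgt ltn_ord.
by rewrite liftK.
Qed.

Lemma muni_last n : muni ('X_(@ord_max n)) = 'X.
Proof. by rewrite mmapX mmap1U /muni_var unlift_none. Qed.

Lemma widen_lift n (i : 'I_n) : widen_ord (leqnSn n) i = lift ord_max i.
Proof. by apply: val_inj; rewrite /= /bump leqNgt ltn_ord. Qed.

Lemma muniK n (p : {mpoly P[n.+1]}) :
  (map_poly (@mwiden n P) (muni p)).['X_ord_max] = p.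
Proof.
pose f : {rmorphism {mpoly P[n.+1]} -> {mpoly P[n.+1]}} :=
  horner_eval 'X_ord_max \o map_poly (@mwiden n P) \o muni.
pose g : {rmorphism {mpoly P[n.+1]} -> {mpoly P[n.+1]}} := idfun.
apply: (@mpoly_morph_eq _ _ f g) => [c|i] /=.
  by rewrite mmapC /= map_polyC /horner_eval hornerC /= mwidenC.
rewrite mmapX mmap1U /muni_var /horner_eval; case: unliftP => [j|] -> /=.
  by rewrite map_polyC hornerC /= mwidenX mnmwiden1 widen_lift.
by rewrite map_polyX hornerX.
Qed.

Lemma muni_eval n (a : 'I_n.+1 -> P) (p : {mpoly P[n.+1]}) :
  (map_poly (meval (a \o lift ord_max)) (muni p)).[a ord_max] = p.@[a].
Proof.
pose f : {rmorphism {mpoly P[n.+1]} -> P} :=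
  horner_eval (a ord_max) \o map_poly (meval (a \o lift ord_max)) \o muni.
pose g : {rmorphism {mpoly P[n.+1]} -> P} := meval a.
apply: (@mpoly_morph_eq _ _ f g) => [c|i] /=.
  by rewrite mmapC /= map_polyC /horner_eval hornerC /= !mevalC.
rewrite mmapX mmap1U /muni_var /horner_eval mevalXU; case: unliftP => [j|] -> /=.
  by rewrite map_polyC hornerC /= mevalXU.
by rewrite map_polyX hornerX.
Qed.

Lemma mwiden_eval n (a : 'I_n.+1 -> P) (p : {mpoly P[n]}) :
  (mwiden p).@[a] = p.@[a \o lift ord_max].
Proof. by rewrite -muni_eval muni_widen map_polyC hornerC. Qed.

Definition mover (K : set P) n (p : {mpoly P[n]}) : Prop := forall m, K p@_m.

Variable K : set P.
Hypothesis sK : subfield_set K.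
Let S := subf_pred sK.

Lemma mover_pred n (p : {mpoly P[n]}) : mover K p <-> p \is a mpolyOver n S.
Proof.
split=> [H|/mpolyOverP H m]; last by apply: set_mem; exact: H.
by apply/mpolyOverP => m; apply: mem_set; exact: H.
Qed.

Lemma moverP n (p : {mpoly P[n]}) : mover K p <-> p \is a mpolyOver n (mem K).
Proof. exact: mover_pred. Qed.

Lemma mover_widen n (p : {mpoly P[n]}) : mover K p -> mover K (mwiden p).
Proof.
move=> Kp; apply/mover_pred; rewrite /mwiden /mmap; apply: rpred_sum => m _.
apply: rpredM; first by rewrite mpolyOverC; apply: mem_set; exact: Kp.
by rewrite /mmap1; apply: rpred_prod => j _; apply: rpredX; exact: mpolyOverX.
Qed.

Lemma mover_sum n (I : Type) (r : seq I) (F : I -> {mpoly P[n]}) :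
  (forall i, mover K (F i)) -> mover K (\sum_(i <- r) F i).
Proof. by move=> H; apply/mover_pred; apply: rpred_sum => i _; apply/mover_pred. Qed.

Lemma moverM n (p q : {mpoly P[n]}) : mover K p -> mover K q -> mover K (p * q).
Proof. by move=> /mover_pred Hp /mover_pred Hq; apply/mover_pred; exact: rpredM. Qed.

Lemma moverB n (p q : {mpoly P[n]}) : mover K p -> mover K q -> mover K (p - q).
Proof. by move=> /mover_pred Hp /mover_pred Hq; apply/mover_pred; exact: rpredB. Qed.

Lemma moverX n (p : {mpoly P[n]}) i : mover K p -> mover K (p ^+ i).
Proof. by move=> /mover_pred Hp; apply/mover_pred; exact: rpredX. Qed.

Lemma mover_var n i : mover K ('X_i : {mpoly P[n]}).
Proof. by apply/mover_pred; exact: mpolyOverX. Qed.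

Lemma moverC n c : K c -> mover K (c%:MP : {mpoly P[n]}).
Proof. by move=> Kc; apply/mover_pred; rewrite mpolyOverC; apply: mem_set. Qed.

Lemma mover_muni n (p : {mpoly P[n.+1]}) i : mover K p -> mover K (muni p)`_i.
Proof.
move=> Kp; have [rK _] := sK.
pose Q (f : {poly {mpoly P[n]}}) := forall i, mover K f`_i.
have K1 : mover K (1 : {mpoly P[n]}) by rewrite -mpolyC1; apply: moverC; exact: subring1.
have K0 : mover K (0 : {mpoly P[n]}) by rewrite -mpolyC0; apply: moverC; exact: subring0.
have QC (q : {mpoly P[n]}) : mover K q -> Q q%:P by move=> Kq k; rewrite coefC; case: ifP.
have QM f g : Q f -> Q g -> Q (f * g).
  by move=> Qf Qg k; rewrite coefM; apply: mover_sum => j; exact: moverM.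
have QX f k : Q f -> Q (f ^+ k).
  move=> Qf; elim: k => [|k IH]; first by rewrite expr0; exact: QC.
  by rewrite exprS; exact: QM.
rewrite /mmap coef_sum; apply: mover_sum => m.
suff : Q ((polyC \o @mpolyC n P) p@_m * mmap1 (@muni_var n) m) by apply.
apply: (QM); first by apply: (QC); apply: moverC; exact: Kp.
rewrite /mmap1; apply: (big_ind Q); [exact: (QC)|exact: (QM)|move=> j _].
apply: (QX); rewrite /muni_var; case: unliftP => [k|] _.
  by apply: (QC); exact: mover_var.
by move=> k; rewrite coefX; case: eqP.
Qed.

(* The values of [a] from the last one to the first, in accordance with [muni],
   which singles out the last variable. *)
Fixpoint lst n : ('I_n -> P) -> seq P :=
  if n is n'.+1 then fun a => a ord_max :: lst (a \o lift ord_max) else fun=> [::].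

Lemma lst_surj (s : seq P) : exists n (a : 'I_n -> P), lst a = s.
Proof.
elim: s => [|x s [n [a <-]]]; first by exists 0%N, (fun _ => 0).
exists n.+1, (fun i => if unlift ord_max i is Some j then a j else x).
rewrite /= unlift_none; congr (x :: lst _); apply: funext => i /=.
by rewrite liftK.
Qed.

Lemma mem_lst n (a : 'I_n -> P) x : reflect (exists i, x = a i) (x \in lst a).
Proof.
elim: n a x => [|n IH] a x /=; first by apply: (iffP idP) => // -[[]].
rewrite inE; apply: (iffP predU1P) => [[->|/IH[i ->]]|[i ->]].
- by exists ord_max.
- by exists (lift ord_max i).
- case: (unliftP ord_max i) => [j|] ->; [right|by left].
  by apply/IH; exists j.
Qed.

Definition alg_free n (a : 'I_n -> P) : Prop :=
  forall p : {mpoly P[n]}, mover K p -> p.@[a] = 0 -> p = 0.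

Fixpoint aind (s : seq P) : Prop :=
  if s is x :: s' then aind s' /\ transc (adj K s') x else True.

Lemma meval_adj n (a : 'I_n -> P) (p : {mpoly P[n]}) : mover K p -> adj K (lst a) p.@[a].
Proof.
move=> Kp; have [rK _] := sK; have rA := adj_subring (lst a) rK.
rewrite mevalE; apply: subring_sum => // m; apply: subringM => //.
  by apply: sub_adj => //; exact: Kp.
apply: (big_ind (adj K (lst a))); [exact: subring1|exact: subringM|move=> i _].
by apply: subringX => //; apply: mem_adj => //; apply/mem_lst; exists i.
Qed.

Lemma adj_meval n (a : 'I_n -> P) z : adj K (lst a) z -> exists2 p, mover K p & z = p.@[a].
Proof.
have [rK _] := sK.
apply: (@adj_min P K [set z | exists2 p, mover K p & z = p.@[a]]) => [|c Kc|x /mem_lst[i ->]].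
- split.
  + by exists 1; rewrite ?meval1 // -mpolyC1; apply: moverC; exact: subring1.
  + by move=> _ _ [p Kp ->] [q Kq ->]; exists (p - q); rewrite ?mevalB //; exact: moverB.
  + by move=> _ _ [p Kp ->] [q Kq ->]; exists (p * q); rewrite ?mevalM //; exact: moverM.
- by exists c%:MP; rewrite ?mevalC //; exact: moverC.
- by exists 'X_i; rewrite ?mevalXU //; exact: mover_var.
Qed.

(** Splits independence of a tuple into one-variable transcendence statements over successive rings,
    the form required by [dichotomy]. Singling out the last variable through [muni] gives the
    induction. *)
Lemma alg_free_aind n (a : 'I_n -> P) : alg_free a <-> aind (lst a).
Proof.
have [rK _] := sK.
elim: n a => [|n IH] a /=.
  split=> // _ p Kp pa.
  pose f : {rmorphism {mpoly P[0]} -> {mpoly P[0]}} := idfun.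
  pose g : {rmorphism {mpoly P[0]} -> {mpoly P[0]}} := @mpolyC 0 P \o meval a.
  rewrite -[p]/(f p) (@mpoly_morph_eq _ _ f g) => [|c|[]//] /=; last by rewrite mevalC.
  by rewrite pa mpolyC0.
split=> [fa|[/IH fa tr] p Kp pa].
  split.
    apply/IH => p Kp pa.
    have /fa : mover K (mwiden p) by exact: mover_widen.
    rewrite mwiden_eval pa => /(_ erefl) /(congr1 muni).
    by rewrite muni_widen rmorph0 => /eqP; rewrite polyC_eq0 => /eqP.
  move=> q Kq qa.
  have /choice[f fP] : forall i, exists p : {mpoly P[n]}, mover K p /\ q`_i = p.@[a \o lift ord_max].
    by move=> i; have [p Kp pE] := adj_meval (Kq i); exists p.
  pose p : {mpoly P[n.+1]} := \sum_(i < size q) mwiden (f i) * 'X_ord_max ^+ i.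
  have Kp : mover K p.
    apply: mover_sum => i; apply: moverM.
      by apply: mover_widen; case: (fP i).
    by apply: moverX; exact: mover_var.
  have p0 : p = 0.
    apply: fa => //; rewrite -qa horner_coef rmorph_sum; apply: eq_bigr => i _.
    rewrite rmorphM rmorphXn /= mwiden_eval mevalXU.
    by case: (fP i) => _ ->.
  have : \poly_(i < size q) f i = 0.
    rewrite poly_def -[RHS](rmorph0 muni) -p0 rmorph_sum; apply: eq_bigr => i _.
    by rewrite rmorphM rmorphXn /= muni_widen muni_last mul_polyC.
  move=> /polyP H; apply/polyP => i; rewrite coef0.
  have [lt|le] := ltnP i (size q); last by rewrite nth_default.
  by case: (fP i) => _ ->; have := H i; rewrite coef_poly lt coef0 => ->; rewrite meval0.
have q0 : map_poly (meval (a \o lift ord_max)) (muni p) = 0.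
  apply: tr; last by rewrite muni_eval.
  by move=> i; rewrite coef_map; apply: meval_adj; exact: mover_muni.
have m0 : muni p = 0.
  apply/polyP => i; rewrite coef0; apply: fa; first exact: mover_muni.
  by rewrite -[LHS]coef_map q0 coef0.
by rewrite -[p]muniK m0 rmorph0 horner0.
Qed.

End Mpoly.

(** * EA-hulls, and independence as linear disjointness *)

Definition alg_closed (P : fieldType) : Prop :=
  forall p : {poly P}, (1 < size p)%N -> exists x, root p x.

Section EAsub.
Variable F : expFieldType.
Implicit Types (K A B C X : set F).

Lemma EA_subfieldP K : EA_subfield K <->
  closed_subfield K /\ forall x, K x -> K (expf x).
Proof.
have polyE p : K 0 -> pover K p <-> p \is a polyOver (mem K).
  move=> K0; split=> H; first by apply/(all_nthP 0) => i _; apply: mem_set; exact: H.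
  move=> i; have [lt|le] := ltnP i (size p); last by rewrite nth_default.
  by apply: set_mem; move/(all_nthP 0)/(_ _ lt): H.
split=> [[[K1 KB KV] Ke Kc]|[[[sK iK] Kc] Ke]].
  have mK x : K x -> x \in mem K by move=> Kx; exact: mem_set.
  have Km x : x \in mem K -> K x by exact: set_mem.
  have rK : subfield_set K.
    have KI x : K x -> K x^-1.
      by move=> Kx; rewrite -div1r; apply: Km; apply: KV; rewrite //; exact: mK.
    split; last exact: KI.
    split; first exact: Km.
      by move=> x y Kx Ky; apply: Km; apply: KB; exact: mK.
    move=> x y Kx Ky; rewrite -[y]invrK; apply: Km; apply: KV; apply: mK => //.
    exact: KI.
  split=> //; split=> // p Kp p1; apply: Kc => //; apply/polyE => //.
  by case: rK => + _; exact: subring0.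
split=> //.
- exact: (subf_divring (conj sK iK)).
- by move=> p /polyE Kp p1; apply: Kc => //; apply: Kp; exact: subring0.
Qed.

Hypothesis aF : alg_closed F.

Lemma EA_setT : EA_subfield [set: F].
Proof.
apply/EA_subfieldP; split=> //; split=> // p _ p1.
by have [x px] := aF p1; exists x.
Qed.

Lemma EA_hull_EA X : EA_subfield (EA_hull X).
Proof.
have H M x : EA_subfield M -> X `<=` M -> EA_hull X x -> M x.
  by move=> EM XM; apply.
apply/EA_subfieldP; split; last first.
  move=> x hx M [EM XM]; have /EA_subfieldP[_ Me] := EM.
  by apply: Me; exact: H hx.
split; first split; first split.
- by move=> M [/EA_subfieldP[[[sM _] _] _] _]; exact: subring1.
- move=> x y hx hy M [EM XM]; have /EA_subfieldP[[[sM _] _] _] := EM.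
  by apply: subringB => //; [exact: H hx|exact: H hy].
- move=> x y hx hy M [EM XM]; have /EA_subfieldP[[[sM _] _] _] := EM.
  by apply: subringM => //; [exact: H hx|exact: H hy].
- move=> x hx M [EM XM]; have /EA_subfieldP[[[_ iM] _] _] := EM.
  by apply: iM; exact: H hx.
(* Any root will do, since an algebraically closed [M] contains all roots of a nonzero polynomial
   over it. *)
- move=> p hp p1; have [x px] := aF p1; exists x => // M [EM XM].
  have /EA_subfieldP[cM _] := EM.
  apply: (closed_subfield_root cM (p := p)) => //.
    by move=> i; apply: H (hp i).
  by rewrite -size_poly_gt0 ltnW.
Qed.

Lemma sub_EA_hull X : X `<=` EA_hull X.
Proof. by move=> x Xx M [_]; apply. Qed.

Lemma EA_hull_min X K : EA_subfield K -> X `<=` K -> EA_hull X `<=` K.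
Proof. by move=> EK XK x; apply. Qed.

Lemma EA_hull_mono X Y : X `<=` Y -> EA_hull X `<=` EA_hull Y.
Proof. by move=> XY x hx M [EM YM]; apply: hx; split=> // y /XY; exact: YM. Qed.

Lemma EA_hull_id K : EA_subfield K -> EA_hull K = K.
Proof. by move=> EK; apply/seteqP; split; [exact: EA_hull_min|exact: sub_EA_hull]. Qed.

Lemma EA_hull_closed X : closed_subfield (EA_hull X).
Proof. by have /EA_subfieldP[] := EA_hull_EA X. Qed.

Lemma alg_indepE B n (a : 'I_n -> F) : subfield_set B ->
  alg_indep B a <-> alg_free B a.
Proof. by move=> sB; split=> H p /(moverP sB); exact: H. Qed.

Lemma alg_indep_mono B C n (a : 'I_n -> F) : C `<=` B -> alg_indep B a -> alg_indep C a.
Proof.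
move=> CB H p Cp; apply: H; move: p Cp; apply: mpolyOverS => x /set_mem Cx.
by apply: mem_set; exact: CB.
Qed.

Lemma alg_indep_cast B n m (e : n = m) (a : 'I_n -> F) (b : 'I_m -> F) :
  (forall i, b (cast_ord e i) = a i) -> alg_indep B a <-> alg_indep B b.
Proof.
case: _ / e b => b H; suff -> : a = b by [].
by apply: funext => i; rewrite -H cast_ord_id.
Qed.

Lemma alg_indep_setT B n (a : 'I_n -> F) :
  alg_indep B (fun j : 'I_#|[set: 'I_n]%SET| => a (enum_val j)) <-> alg_indep B a.
Proof.
have e : #|[set: 'I_n]%SET| = n by rewrite cardsT card_ord.
apply: (@alg_indep_cast _ _ _ e) => i; congr (a _); apply: val_inj => /=.
rewrite /enum_val (_ : enum [set: 'I_n]%SET = enum 'I_n); last first.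
  by apply: eq_enum => j; rewrite !inE.
by rewrite -(nth_map _ 0%N) ?val_enum_ord ?nth_iota ?size_enum_ord // -[X in (_ < X)%N]e ltn_ord.
Qed.

(** The degree over [C] of an independent tuple is its length, and over [B] this value can only be
    attained by the full index set. *)
Lemma ACF_indepP A B C : subfield_set B -> C `<=` B -> ACF_indep A B C <->
  forall n (a : 'I_n -> F), (forall i, A (a i)) -> alg_indep C a -> alg_indep B a.
Proof.
move=> sB CB; split=> H n a Aa; last first.
  apply: eq_bigl => J; apply/asboolP/asboolP; first exact: alg_indep_mono.
  by apply: H => i; exact: Aa.
move=> Ca; have := H n a Aa; rewrite /td => tdE.
have : (n <= \max_(J : {set 'I_n} |
    `[< alg_indep B (fun j : 'I_#|J| => a (enum_val j)) >]) #|J|)%N.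
  rewrite tdE; have {1}-> : n = #|[set: 'I_n]%SET| by rewrite cardsT card_ord.
  by apply: leq_bigmax_cond; apply/asboolP/alg_indep_setT.
have [J /asboolP BJ -> nJ] : {J : {set 'I_n} |
    `[< alg_indep B (fun j : 'I_#|J| => a (enum_val j)) >]
    & \max_(J : {set 'I_n} | `[< alg_indep B (fun j : 'I_#|J| => a (enum_val j)) >]) #|J|
      = #|J|}.
  apply: eq_bigmax_cond; apply/card_gt0P; exists (finset.set0 : {set (ordinal n)}); apply/asboolP.
  apply/(alg_indepE _ sB)/(alg_free_aind sB).
  by move: (fun _ => _); rewrite cards0.
suff JT : J = [set: 'I_n]%SET by apply/alg_indep_setT; rewrite -JT.
by apply/eqP; rewrite eqEcard finset.subsetT cardsT card_ord.
Qed.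

(* Specialising [A] into [K] while fixing [B] turns a relation with
   coefficients in [A] into one with coefficients in [K]. *)
Lemma ACF_indep_lin_disjoint A B K : closed_subfield A -> closed_subfield B ->
  closed_subfield K -> K `<=` A -> K `<=` B -> ACF_indep A B K -> lin_disjoint B A K.
Proof.
move=> cA cB cK KA KB ind e eB ie c Ac E l le.
have [sfA _] := cA; have [sfB _] := cB; have [sfK _] := cK.
have [sA _] := sfA; have [sB _] := sfB; have [sK _] := sfK.
apply: contrapT => /eqP cl.
have basis (s : seq F) : (forall x, x \in s -> A x) -> exists t,
    [/\ forall x, x \in t -> A x, aind K t & forall x, x \in s -> algebraic (adj K t) x].
  elim: s => [|x s IH] As; first by exists [::].
  have [y ys|t [At it ts]] := IH; first by apply: As; rewrite inE ys orbT.
  have [tr|al] := transcValg (adj K t) x.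
    exists (x :: t); split=> [y|//|y]; rewrite inE => /predU1P[->|].
    - by apply: As; rewrite mem_head.
    - exact: At.
    - apply: algebraic_mem; first exact: (adj_subring (x :: t)).
      by apply: mem_adj => //; rewrite mem_head.
    - move=> /ts; apply: algebraic_mono; apply: sub_adj1; exact: adj_subring.
  by exists t; split=> // y; rewrite inE => /predU1P[->//|/ts].
pose s := map c (iota 0 (size e)).
have [t [At it st]] : exists t,
    [/\ forall x, x \in t -> A x, aind K t & forall x, x \in s -> algebraic (adj K t) x].
  by apply: basis => x /mapP[i _ ->].
have Bt : aind B t.
  have [n [a aE]] := lst_surj t; rewrite -aE; apply/(alg_free_aind sfB)/(alg_indepE _ sfB).
  move: ind => /(ACF_indepP _ sfB KB); apply.
    by move=> i; apply: At; rewrite -aE; apply/mem_lst; exists i.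
  by apply/(alg_indepE _ sfK)/(alg_free_aind sfK); rewrite aE.
(* The basis [t] stays transcendental over [B] by independence, and the coefficients in [s] are
   algebraic already over [K] and [t], so they can be sent into [K]. *)
have dich : dichotomy B K (s ++ t).
  elim: s st => [|x s' IH] st /=.
    by elim: t Bt {At it st} => //= x t IH [Bt tr]; split; [left|exact: IH].
  split; last by apply: IH => y ys; apply: st; rewrite inE ys orbT.
  right; have := st x (mem_head _ _); apply: algebraic_mono.
  apply: adj_min => //; first exact: adj_subring.
    exact: sub_adj.
  by move=> y yt; apply: mem_adj => //; rewrite mem_cat yt orbT.
have smem j : (j < size e)%N -> c j \in s ++ t.
  by move=> je; rewrite mem_cat; apply/orP; left; apply/mapP; exists j; rewrite ?mem_iota.
have Acl : adj B (s ++ t) (c l) by apply: mem_adj => //; exact: smem.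
have [r [Br r0 H]] := specialize (@expf_char0 F) sB sK KB cB cK KB dich Acl cl.
have hid : hom_on B (id : F -> F) by [].
have [h [hh hB hC hK hcl]] := H id hid (fun _ By => By) (fun _ Ky => Ky) r0.
have K' j : (j < size e)%N -> K (h (c j)).
  by move=> je; apply: hK; apply: mem_adj => //; exact: smem.
have := ie (fun j => if (j < size e)%N then h (c j) else 0).
move=> /(_ _ _ l le); rewrite le => H'; case/eqP: hcl; apply: H'.
  by move=> j; case: ifP => [/K'//|_]; exact: subring0.
have sR := adj_subring (s ++ t) sB.
transitivity (h (lc c e)); last by rewrite E (hom_on0 sR hh).
rewrite /lc (hom_on_sum sR hh); last first.
  move=> j; apply: subringM => //; first by apply: mem_adj => //; exact: smem.
  by apply: sub_adj => //; apply: eB; exact: mem_nth.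
apply: eq_bigr => j _; rewrite ltn_ord (hom_onM hh).
- by rewrite (hB e`_j) //; apply: eB; exact: mem_nth.
- by apply: mem_adj => //; exact: smem.
- by apply: sub_adj => //; apply: eB; exact: mem_nth.
Qed.

(** Algebraic independence of a tuple is linear independence of its monomials, and these lie in
    [B]. *)
Lemma lin_disjoint_ACF_indep A B K : subfield_set A -> subfield_set B -> subfield_set K ->
  K `<=` A -> lin_disjoint B A K -> ACF_indep B A K.
Proof.
move=> sfA sfB sfK KA ld; apply/ACF_indepP => // n a Ba /(alg_indepE _ sfK) fa.
have [sB _] := sfB; have [sK _] := sfK.
apply/(alg_indepE _ sfA) => p Ap pa.
pose mon (m : 'X_{1..n}) : F := \prod_(i < n) a i ^+ m i.
pose e := map mon (msupp p).
have se : size e = size (msupp p) by rewrite size_map.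
have eB x : x \in e -> B x.
  move=> /mapP[m _ ->]; apply: (big_ind B); [exact: subring1|exact: subringM|move=> i _].
  exact: subringX.
have ie : linindep K e.
  move=> c Kc E l le; rewrite se in le.
  pose q : {mpoly F[n]} := \sum_(j < size e) c j *: 'X_[nth 0%MM (msupp p) j].
  have q0 : q = 0.
    apply: fa.
      apply: (mover_sum sfK) => j; rewrite -mul_mpolyC; apply: (moverM sfK).
        exact: (moverC sfK).
      by apply/(mover_pred sfK); exact: mpolyOverX.
    rewrite -E /lc /q rmorph_sum; apply: eq_bigr => j _ /=.
    rewrite mevalZ mevalX (nth_map 0%MM) //; by rewrite -se.
  have := congr1 (mcoeff (nth 0%MM (msupp p) l)) q0.
  rewrite /q raddf_sum /= mcoeff0 -[in size e]/e.
  have le' : (l < size e)%N by rewrite se.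
  rewrite (bigD1 (Ordinal le')) //= mcoeffZ mcoeffX eqxx mulr1 big1 ?addr0 // => j jl.
  rewrite mcoeffZ mcoeffX nth_uniq ?msupp_uniq //; last by rewrite -se.
  by rewrite (negPf (_ : val j != l)) ?mulr0.
have := ld e eB ie (fun j => p@_(nth 0%MM (msupp p) j)).
move=> /(_ _ _) H; apply/mpolyP => m; rewrite mcoeff0.
have [mp|] := boolP (m \in msupp p); last by move/memN_msupp_eq0.
rewrite -[m](nth_index 0%MM mp); apply: H; last by rewrite se index_mem.
  by move=> j; exact: Ap.
rewrite -pa mevalE /lc se (big_nth 0%MM) big_mkord; apply: eq_bigr => j _.
by rewrite (nth_map 0%MM).
Qed.

Lemma ACF_indep_sym A B K : closed_subfield A -> closed_subfield B ->
  closed_subfield K -> K `<=` A -> K `<=` B -> ACF_indep A B K -> ACF_indep B A K.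
Proof.
move=> cA cB cK KA KB ind; have [sA _] := cA; have [sB _] := cB; have [sK _] := cK.
by apply: lin_disjoint_ACF_indep => //; exact: ACF_indep_lin_disjoint.
Qed.

End EAsub.

(** * Ultrapowers of exponential fields and gluing of exponentials *)

(** An interface to ultrapowers through the class map [cl]: the concrete one is only provably equal
    to the structure of an [expFieldType], and computing with its carrier would need transport along
    that equality. *)
Record is_upower (I : Type) (U : set_system I) (P Q : expFieldType)
    (cl : (I -> P) -> Q) : Prop := IsUpower {
  cl_eq : forall f g, cl f = cl g <-> U [set i | f i = g i];
  cl_surj : forall y, exists f, y = cl f;
  clD : forall f g, cl (fun i => f i + g i) = cl f + cl g;
  clN : forall f, cl (fun i => - f i) = - cl f;
  clM : forall f g, cl (fun i => f i * g i) = cl f * cl g;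
  cl1 : cl (fun=> 1) = 1;
  clE : forall f, cl (fun i => expf (f i)) = expf (cl f);
  cl_los : forall V (w : V -> I -> P) phi,
    sat (fun x => cl (w x)) phi <-> U [set i | sat (w^~ i) phi] }.

Lemma expfield_upower (P : expFieldType) (I : Type) (U : set_system I) :
  UltraFilter U -> exists (Q : expFieldType) (cl : (I -> P) -> Q), is_upower U cl.
Proof.
move=> UF.
pose S := @upower I U UF P.
pose c : (I -> P) -> S := @ucls I U UF P.
have cD f g : c (fun i => sadd (f i) (g i)) = sadd (c f) (c g).
  by rewrite /c /= /ucls ucl_map2.
have cM f g : c (fun i => smul (f i) (g i)) = smul (c f) (c g).
  by rewrite /c /= /ucls ucl_map2.
have cN f : c (fun i => sopp (f i)) = sopp (c f) by rewrite /c /= /ucls ucl_map1.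
have cE f : c (fun i => sexp (f i)) = sexp (c f) by rewrite /c /= /ucls ucl_map1.
have c1 : c (fun=> sone P) = sone S by [].
have ceq f g : c f = c g <-> U [set i | f i = g i] by exact: ucl_eq.
have csurj y : exists f, y = c f by exists (sval y); rewrite /c /ucls uclK.
have clos V (w : V -> I -> P) phi : sat (fun x => c (w x)) phi <-> U [set i | sat (w^~ i) phi].
  exact: los.
have [Q E] : exists Q : expFieldType, S = efield_structure Q.
  apply: models_efield_structure.
  by rewrite -(elementary_models _ (@udiag_elementary I U UF P)); exact: efield_structure_models.
(* Once its body is forgotten, [S] can be replaced by the exponential field that it equals. *)
clearbody c S; subst S; exists Q, c; by split.
Qed.

Section UpowerTheory.
Variables (I : Type) (U : set_system I) (P Q : expFieldType) (cl : (I -> P) -> Q).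
Context {UF : UltraFilter U}.
Hypothesis cP : is_upower U cl.

Definition cdiag (x : P) : Q := cl (fun=> x).

Lemma clB f g : cl (fun i => f i - g i) = cl f - cl g.
Proof. by rewrite (clD cP f (fun i => - g i)) (clN cP). Qed.

Lemma cl0 : cl (fun=> 0) = 0.
Proof.
by rewrite -(subrr (cl (fun=> 0))) -clB; congr cl; apply: funext => i; rewrite subrr.
Qed.

Lemma clX f n : cl (fun i => f i ^+ n) = cl f ^+ n.
Proof.
elim: n => [|n IH]; first exact: (cl1 cP).
by rewrite exprS -IH -(clM cP); congr cl; apply: funext => i; rewrite exprS.
Qed.

Lemma cl_sum (J : Type) (r : seq J) (f : J -> I -> P) :
  cl (fun i => \sum_(j <- r) f j i) = \sum_(j <- r) cl (f j).
Proof.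
elim: r => [|j r IH].
  by rewrite big_nil -cl0; congr cl; apply: funext => i; rewrite big_nil.
rewrite big_cons -IH -(clD cP); congr cl; apply: funext => i; by rewrite big_cons.
Qed.

Lemma cl_ae f g : U [set i | f i = g i] -> cl f = cl g.
Proof. by move=> H; apply/(cl_eq cP). Qed.

Lemma cdiag_elementary : elementary (cdiag : P -> Q).
Proof.
move=> V v phi; rewrite (cl_los cP (fun x _ => v x)); split=> [s|/filter_ex[]//].
by apply: filterS filterT => i _.
Qed.

Lemma cdiag_embedding : embedding (cdiag : P -> Q).
Proof. exact: elementary_embedding cdiag_elementary. Qed.

Lemma cdiag_hom : hom_on [set: P] cdiag.
Proof.
split=> [|x y _ _|x y _ _]; first exact: (cl1 cP).
  exact: clB.
exact: (clM cP).
Qed.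

(* The internal subset of the ultrapower [Q] defined by [K], i.e. the ultrapower of [K]. *)
Definition iset (K : set P) : set Q := [set y | exists2 f, y = cl f & forall i, K (f i)].

Lemma iset_ae K f : K 0 -> U [set i | K (f i)] -> iset K (cl f).
Proof.
move=> K0 H; exists (fun i => if pselect (K (f i)) then f i else 0).
  by apply: cl_ae; apply: filterS H => i /= Ki; case: pselect.
by move=> i; case: pselect.
Qed.

Lemma iset_diag K x : K x -> iset K (cdiag x).
Proof. by move=> Kx; exists (fun=> x). Qed.

Lemma iset_aeP K f : iset K (cl f) -> U [set i | K (f i)].
Proof. by move=> [g /(cl_eq cP) H Kg]; apply: filterS H => i /= ->. Qed.

Lemma iset_closed K : closed_subfield K -> closed_subfield (iset K).
Proof.
move=> [[sK iK] aK]; have sI : subring_set (iset K).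
  split.
  - by exists (fun=> 1); [rewrite (cl1 cP)|move=> _; exact: subring1].
  - move=> _ _ [f -> Kf] [g -> Kg]; exists (fun i => f i - g i); first by rewrite clB.
    by move=> i; exact: subringB.
  - move=> _ _ [f -> Kf] [g -> Kg]; exists (fun i => f i * g i); first by rewrite (clM cP).
    by move=> i; exact: subringM.
split; first split=> //.
  move=> _ [f -> Kf]; exists (fun i => (f i)^-1); last by move=> i; exact: iK.
  have [f0|f0] := eqVneq (cl f) 0.
    rewrite f0 invr0 -cl0; apply: cl_ae; move: f0; rewrite -cl0 => /(cl_eq cP).
    by apply: filterS => i /= ->; rewrite invr0.
  apply: (mulfI f0); rewrite mulfV // -(clM cP) -(cl1 cP); apply: cl_ae.
  have /(ultra_not (U := U)) : ~ U [set i | f i = 0].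
    by move=> H; case/eqP: f0; rewrite -cl0; apply: cl_ae.
  by apply: filterS => i /= /eqP fi; rewrite mulfV.
move=> p Ip p1.
have /choice[f fP] : forall j, exists f, p`_j = cl f /\ forall i, K (f i).
  by move=> j; have [f] := Ip j; exists f.
set n := size p in p1.
(* A root is chosen in each coordinate where the leading coefficient survives, that is in almost
   every one, and [0] elsewhere. *)
have /choice[r rP] : forall i, exists r, K r /\
    (f n.-1 i <> 0 -> \sum_(j < n) f j i * r ^+ j = 0).
  move=> i; have [fi|fi] := eqVneq (f n.-1 i) 0; first by exists 0; split=> //; exact: subring0.
  have [||r Kr rr] := aK (\poly_(j < n) f j i).
  - move=> j; rewrite coef_poly; case: ifP => _; last exact: subring0.
    by case: (fP j).
  - by rewrite size_poly_eq.
  - by exists r; split=> // _; move/rootP: rr; rewrite horner_poly.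
exists (cl r); first by exists r => // i; case: (rP i).
apply/rootP; rewrite horner_coef -/n.
transitivity (cl (fun i => \sum_(j < n) f j i * r i ^+ j)).
  rewrite cl_sum; apply: eq_bigr => j _.
  by rewrite (clM cP (f j)) clX; case: (fP j) => <-.
rewrite -cl0; apply: cl_ae.
have /(ultra_not (U := U)) : ~ U [set i | f n.-1 i = 0].
  move=> H; have : p`_n.-1 = 0 by case: (fP n.-1) => -> _; rewrite -cl0; apply: cl_ae.
  by apply/eqP; rewrite -lead_coefE lead_coef_eq0 -size_poly_gt0 ltnW.
by apply: filterS => i /= fi; case: (rP i) => _; apply.
Qed.

Lemma iset_EA K : EA_subfield K -> EA_subfield (iset K).
Proof.
move=> /EA_subfieldP[cK eK]; apply/EA_subfieldP; split; first exact: iset_closed.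
move=> _ [f -> Kf]; exists (fun i => expf (f i)); first by rewrite (clE cP).
by move=> i; exact: eK.
Qed.

(* Coheirs are linearly disjoint from the diagonal. *)
Lemma iset_linindep K e : subring_set K -> linindep K e -> linindep (iset K) (map cdiag e).
Proof.
move=> sK ie c Kc E l; rewrite size_map => le.
have /choice[f fP] : forall j, exists f, c j = cl f /\ forall i, K (f i).
  by move=> j; have [f] := Kc j; exists f.
have {}E : cl (fun i => lc (fun j => f j i) e) = cl (fun=> 0).
  rewrite cl0 -E /lc cl_sum size_map; apply: eq_bigr => j _.
  by rewrite (clM cP (f j)) (nth_map 0) //; case: (fP j) => ->.
case: (fP l) => -> _; rewrite -cl0; apply: cl_ae.
move/(cl_eq cP): E; apply: filterS => i /= /ie; apply=> // j.
by case: (fP j).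
Qed.

End UpowerTheory.

Lemma In_mem (T : eqType) (x : T) s : List.In x s <-> x \in s.
Proof.
elim: s => //= y s IH; rewrite inE; split=> [[->|/IH->]|/predU1P[->|/IH]].
- by rewrite eqxx.
- by rewrite orbT.
- by left.
- by right.
Qed.

Lemma mem_ultrafilter (X : eqType) : exists U : set_system (seq X),
  UltraFilter U /\ forall x : X, U [set l : seq X | x \in l].
Proof.
have [U [UF UP]] := list_ultrafilter X; exists U; split=> // x.
by apply: filterS (UP x) => l /= /In_mem.
Qed.

Lemma setT_subfield (P : fieldType) : subfield_set [set: P].
Proof. by []. Qed.

(** As [H] is algebraically closed, each [H[l]] with [l] finite specialises to [H] over [H];
    composing with [u] and passing to the ultraproduct embeds [P]. The last clause is the crucial
    one: it confines relations between the two fields to [H]. Only ring homomorphisms are built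
    here; exponentials come with [exp_glue]. *)
Lemma field_amalgam (P W0 : expFieldType) (H : set P) (u : P -> W0) :
  closed_subfield H -> hom_on H u ->
  exists (W1 : expFieldType) (w : W0 -> W1) (q : P -> W1),
    [/\ hom_on [set: W0] w, hom_on [set: P] q, forall x, H x -> q x = w (u x)
      & forall x y, q x = w y -> H x].
Proof.
move=> cH hu; have [[sH _] _] := cH.
have [U [UF UP]] := mem_ultrafilter P.
have [W1 [cl cP]] := expfield_upower W0 UF.
have /choice[h hP] : forall l : seq P, exists h : P -> P,
    [/\ hom_on (adj H l) h, forall x, H x -> h x = x & forall x, adj H l x -> H (h x)].
  move=> l; have A1 : adj H l 1 by apply: subring1; exact: adj_subring.
  have [r [Hr r0 E]] := specialize (@expf_char0 P) sH sH (fun _ => id) cH cH (fun _ => id)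
    (dichotomy_refl H l) A1 (oner_neq0 P).
  have hid : hom_on H (id : P -> P) by [].
  have [h [hh hE hC _ _]] := E id hid (fun _ x => x) (fun _ x => x) r0.
  by exists h.
pose q x := cl (fun l => u (h l x)).
have memA l x : x \in l -> adj H l x by exact: mem_adj.
have hq : hom_on [set: P] q.
  split=> [|x y _ _|x y _ _].
  - rewrite /q -(cl1 cP); apply: (cl_ae cP); apply: filterS filterT => l _ /=.
    by have [hh _ _] := hP l; rewrite (hom_on1 hh) (hom_on1 hu).
  - rewrite /q -(clB cP); apply: (cl_ae cP).
    apply: filterS (filterI (UP x) (UP y)) => l [/= xl yl].
    by have [hh _ hC] := hP l; rewrite (hom_onB hh) ?(hom_onB hu) //;
      try (apply: hC); exact: memA.
  - rewrite /q -(clM cP); apply: (cl_ae cP).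
    apply: filterS (filterI (UP x) (UP y)) => l [/= xl yl].
    by have [hh _ hC] := hP l; rewrite (hom_onM hh) ?(hom_onM hu) //;
      try (apply: hC); exact: memA.
have qE x : H x -> q x = cdiag cl (u x).
  by move=> Hx; congr cl; apply: funext => l; have [_ hE _] := hP l; rewrite hE.
exists W1, (cdiag cl), q; split=> //; first exact: (cdiag_hom cP).
(* Equality with a diagonal element says that [u (h l x) = y] for some [l] containing [x]. Then [x]
   and [h l x], which lies in [H], have the same image under the injective map [q]. *)
move=> x y /(cl_eq cP) e.
have [l [/= xl yl]] := ultra_ex2 (UP x) e.
have Hx' : H (h l x) by have [_ _ hC] := hP l; apply: hC; exact: memA.
suff -> : x = h l x by [].
apply: (hom_on_inj (setT_subfield P) hq) => //.
by rewrite (qE _ Hx') yl; apply/(cl_eq cP).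
Qed.

(** The projection onto the subspace [S] along a complement [V], which is a maximal subspace meeting
    [S] in [0]: if [w] were not in [S + V], adjoining it to [V] would contradict maximality. *)
Lemma additive_retraction (W : fieldType) (L S : set W) : subfield_set L ->
  S 0 -> (forall x y, S x -> S y -> S (x - y)) ->
  (forall a x, L a -> S x -> S (a * x)) ->
  exists r : W -> W, [/\ forall x, S (r x), forall x, S x -> r x = x
    & forall x y, r (x + y) = r x + r y].
Proof.
move=> [sL iL] S0 SB SZ.
have SN x : S x -> S (- x) by move=> Sx; rewrite -sub0r; exact: SB.
have SD x y : S x -> S y -> S (x + y) by move=> Sx Sy; rewrite -[y]opprK; apply: (SB) => //; exact: SN.
pose P (V : set W) := (forall x y a, V x -> V y -> L a -> V (x + a * y)) /\
  (forall x, V x -> S x -> x = 0).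
have [G GP tG|V [[VL VS] maxV]] := @Zorn_bigcup _ P.
  split=> [x y a [X1 GX1 Xx] [X2 GX2 Xy] La|x [X1 GX1 Xx]]; last by case: (GP _ GX1) => _; apply.
  case: (tG _ _ GX1 GX2) => s; [exists X2|exists X1] => //.
    by case: (GP _ GX2) => H _; apply: H => //; exact: s.
  by case: (GP _ GX1) => H _; apply: H => //; exact: s.
have V0 : V 0.
  have [[x Vx]|nV] := pselect (exists x, V x).
    have := VL x x (-1) Vx Vx; rewrite mulN1r subrr; apply.
    by apply: subringN => //; exact: subring1.
  exfalso; apply: (maxV [set 0]).
    split=> [x Vx|s]; first by case: nV; exists x.
    by case: nV; exists 0; exact: s.
  by split=> [x y a -> -> _|x -> _] //=; rewrite mulr0 addr0.
have VB x y : V x -> V y -> V (x - y).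
  move=> Vx Vy; rewrite -mulN1r; apply: VL => //.
  by apply: subringN => //; exact: subring1.
have dec w : exists s, S s /\ V (w - s).
  apply: contrapT => nw.
  apply: (maxV [set z | exists v a, [/\ V v, L a & z = v + a * w]]).
    split=> [x Vx|sub].
      by exists x, 0; rewrite mul0r addr0; split=> //; exact: subring0.
    apply: nw; exists 0; split=> //; rewrite subr0; apply: sub.
    by exists 0, 1; rewrite mul1r add0r; split=> //; exact: subring1.
  split=> [_ _ a [v [b [Vv Lb ->]]] [v' [b' [Vv' Lb' ->]]] La|_ [v [b [Vv Lb ->]]] Sx].
    exists (v + a * v'), (b + a * b'); split.
    - exact: VL.
    - by apply: subringD => //; exact: subringM.
    - by rewrite mulrDr mulrDl addrACA !mulrA.
  have [b0|b0] := eqVneq b 0.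
    by move: Sx; rewrite b0 mul0r addr0 => /(VS _ Vv).
  exfalso; apply: nw; exists (b^-1 * (v + b * w)); split.
    by apply: SZ => //; exact: iL.
  rewrite mulrDr mulKf // opprD addrCA subrr addr0 -mulrN.
  have := VL 0 v (- b^-1) V0 Vv; rewrite add0r mulNr -mulrN; apply.
  by apply: subringN => //; exact: iL.
have /choice[r rP] := dec.
have ru w s : S s -> V (w - s) -> r w = s.
  move=> Ss Vs; have [Sr Vr] := rP w; apply/eqP; rewrite -subr_eq0; apply/eqP.
  apply: VS; last exact: SB.
  have -> : r w - s = (w - s) - (w - r w) by ring.
  exact: VB.
exists r; split=> [x|x Sx|x y]; first by case: (rP x).
  by apply: ru => //; rewrite subrr.
have [Sx Vx] := rP x; have [Sy Vy] := rP y; apply: ru; first exact: SD.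
rewrite opprD addrACA; have := VL _ _ 1 Vx Vy; rewrite mul1r; apply.
exact: subring1.
Qed.

(* The exponential is prescribed on the sum of the three images and extended
   by [1] on a linear complement. *)
Lemma exp_glue (P W : expFieldType) (K : set P) (i p1 p2 : P -> W) :
  subfield_set K -> hom_on [set: P] i -> hom_on [set: P] p1 -> hom_on [set: P] p2 ->
  (forall x, K x -> p1 x = i x) -> (forall x, K x -> p2 x = i x) ->
  (forall x y z, p1 x + p2 y + i z = 0 -> p1 (expf x) * p2 (expf y) * i (expf z) = 1) ->
  exists (N : expFieldType) (j : W -> N),
    [/\ injective j, embedding (j \o i), embedding (j \o p1) & embedding (j \o p2)].
Proof.
move=> [sK iK] hi h1 h2 K1 K2 rel.
have sT : subring_set [set: P] by [].
have B0 (p : P -> W) x y : hom_on [set: P] p -> p (x - y) = p x - p y.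
  by move=> hp; rewrite (hom_onB hp).
have M0 (p : P -> W) x y : hom_on [set: P] p -> p (x * y) = p x * p y.
  by move=> hp; rewrite (hom_onM hp).
have Z0 (p : P -> W) : hom_on [set: P] p -> p 0 = 0 by move=> hp; rewrite (hom_on0 sT hp).
have D0 (p : P -> W) x y : hom_on [set: P] p -> p (x + y) = p x + p y.
  by move=> hp; rewrite (hom_onD sT hp).
have exp0 : @expf P 0 = 1.
  by apply: (mulfI (@Defs.expf_neq0 P 0)); rewrite -expfD addr0 mulr1.
have expN x : @expf P (- x) = (expf x)^-1.
  by apply: (mulfI (@Defs.expf_neq0 P x)); rewrite -expfD subrr exp0 mulfV // Defs.expf_neq0.
have inj0 (p : P -> W) : hom_on [set: P] p -> injective p.
  by move=> hp x y; apply: (hom_on_inj (setT_subfield P) hp).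
have V0 (p : P -> W) x : hom_on [set: P] p -> p x^-1 = (p x)^-1.
  by move=> hp; exact: (hom_onV (setT_subfield P) hp).
pose val3 (t : P * P * P) := p1 t.1.1 + p2 t.1.2 + i t.2.
pose exp3 (t : P * P * P) := p1 (expf t.1.1) * p2 (expf t.1.2) * i (expf t.2).
pose S := range val3.
have E3 t t' : val3 t = val3 t' -> exp3 t = exp3 t'.
  move=> e; have := rel (t.1.1 - t'.1.1) (t.1.2 - t'.1.2) (t.2 - t'.2).
  rewrite !B0 // => /(_ _) H.
  have {}H : exp3 t * (exp3 t')^-1 = 1.
    rewrite -H; last first.
      by rewrite -(subrr (val3 t')) -{1}e /val3; ring.
    by rewrite !expfD !expN !M0 // !V0 // /exp3 !invfM; ring.
  apply/eqP; rewrite -subr_eq0; apply/eqP.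
  have t0 : exp3 t' != 0.
    rewrite /exp3 !mulf_neq0 //.
    - by rewrite -(Z0 p1 h1) (inj_eq (inj0 _ h1)) Defs.expf_neq0.
    - by rewrite -(Z0 p2 h2) (inj_eq (inj0 _ h2)) Defs.expf_neq0.
    - by rewrite -(Z0 i hi) (inj_eq (inj0 _ hi)) Defs.expf_neq0.
  by rewrite -[exp3 t](divfK t0) H mul1r subrr.
have [r [rS rid rD]] : exists r : W -> W, [/\ forall x, S (r x), forall x, S x -> r x = x
    & forall x y, r (x + y) = r x + r y].
  apply: (@additive_retraction _ (i @` K)).
  - by apply: subfield_image => //; exact: hom_on_sub hi.
  - by exists (0, 0, 0) => //; rewrite /val3 /= !Z0 // !addr0.
  - move=> _ _ [t _ <-] [t' _ <-]; exists (t.1.1 - t'.1.1, t.1.2 - t'.1.2, t.2 - t'.2) => //.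
    by rewrite /val3 /= !B0 //; ring.
  - move=> _ _ [a Ka <-] [t _ <-]; exists (a * t.1.1, a * t.1.2, a * t.2) => //.
    by rewrite /val3 /= !M0 // K1 // K2 // !mulrDr.
have /choice[E EP] : forall w, exists y, forall t, r w = val3 t -> y = exp3 t.
  move=> w; have [t _ tw] := rS w; exists (exp3 t) => t' e; apply: E3.
  by rewrite tw.
have ED x y : E (x + y) = E x * E y.
  have [t _ tx] := rS x; have [t' _ ty] := rS y.
  rewrite (EP x t) // (EP y t') // (EP _ (t.1.1 + t'.1.1, t.1.2 + t'.1.2, t.2 + t'.2)).
    by rewrite /exp3 /= !expfD !M0 //; ring.
  by rewrite rD -tx -ty /val3 /= !D0 //; ring.
have En0 x : E x != 0.
  have [t _ tx] := rS x; rewrite (EP x t) // /exp3 !mulf_neq0 //.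
  - by rewrite -(Z0 p1 h1) (inj_eq (inj0 _ h1)) Defs.expf_neq0.
  - by rewrite -(Z0 p2 h2) (inj_eq (inj0 _ h2)) Defs.expf_neq0.
  - by rewrite -(Z0 i hi) (inj_eq (inj0 _ hi)) Defs.expf_neq0.
pose N : expFieldType := HB.pack (GRing.Field.sort W)
  (Field_isExpField.Build (GRing.Field.clone _ W) (@expf_char0 W) ED En0).
have EE t : E (val3 t) = exp3 t by apply: EP; apply: rid; exists t.
have Ei x : E (i x) = i (expf x).
  have := EE (0, 0, x); rewrite /val3 /exp3 /= !Z0 // !add0r => ->.
  by rewrite exp0 (hom_on1 h1) (hom_on1 h2) !mul1r.
have E1 x : E (p1 x) = p1 (expf x).
  have := EE (x, 0, 0); rewrite /val3 /exp3 /= !Z0 // !addr0 => ->.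
  by rewrite exp0 (hom_on1 hi) (hom_on1 h2) !mulr1.
have E2 x : E (p2 x) = p2 (expf x).
  have := EE (0, x, 0); rewrite /val3 /exp3 /= !Z0 // add0r addr0 => ->.
  by rewrite exp0 (hom_on1 hi) (hom_on1 h1) mulr1 mul1r.
have emb (p : P -> W) : hom_on [set: P] p -> (forall x, E (p x) = p (expf x)) ->
    embedding (p : P -> N).
  move=> hp Ep; split.
  - exact: inj0.
  - by split; [exact: Z0|exact: (hom_on1 hp)].
  - by move=> x y; exact: D0.
  - by move=> x y; exact: M0.
  - by split=> x; [exact: (hom_onN sT hp)|rewrite /= -Ep].
by exists N, id; split=> //; exact: emb.
Qed.

(** * Independent amalgamation of three exponential fields *)

Section ThreeAmalgam.
Variables (P : expFieldType) (K B1 B2 C1 C2 : set P) (tau : P -> P).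
Hypotheses (aP : alg_closed P).
Hypotheses (EK : EA_subfield K) (EB1 : EA_subfield B1)
  (EC1 : EA_subfield C1) (EC2 : EA_subfield C2).
Hypotheses (KB1 : K `<=` B1) (KC1 : K `<=` C1) (KC2 : K `<=` C2).
Hypotheses (htau : hom_on B1 tau) (tauB : forall x, B1 x -> B2 (tau x))
  (tauE : forall x, B1 x -> tau (expf x) = expf (tau x))
  (tauK : forall x, K x -> tau x = x).
Hypotheses (ld1 : lin_disjoint C1 B1 K) (ld2 : lin_disjoint C2 B2 K)
  (C12 : forall x, C1 x -> C2 x -> K x).

Let cK : closed_subfield K. Proof. by have /EA_subfieldP[] := EK. Qed.
Let cB1 : closed_subfield B1. Proof. by have /EA_subfieldP[] := EB1. Qed.
Let cC1 : closed_subfield C1. Proof. by have /EA_subfieldP[] := EC1. Qed.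
Let cC2 : closed_subfield C2. Proof. by have /EA_subfieldP[] := EC2. Qed.
Let sfK : subfield_set K. Proof. by have [] := cK. Qed.
Let sfB1 : subfield_set B1. Proof. by have [] := cB1. Qed.
Let sK : subring_set K. Proof. by have [] := sfK. Qed.
Let sB1 : subring_set B1. Proof. by have [] := sfB1. Qed.
Let sC1 : subring_set C1. Proof. by have [[]] := cC1. Qed.
Let sC2 : subring_set C2. Proof. by have [[]] := cC2. Qed.

(** Both maps come from one specialisation [s] of [K[b]] into [K], transported by [tau] on the
    second side and extended by the identity of [C1] and of [C2]; only afterwards are the other
    elements of [l1] and [l2] specialised. The non-vanishing conditions travel backwards, so that a
    single product [q1 * q2] is imposed on [s]. *)
Lemma compatible_specializations (l1 l2 : seq P) :
  exists (S1 S2 : set P) (h1 h2 : P -> P),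
  [/\ [/\ subring_set S1, forall x, x \in l1 -> S1 x & C1 `<=` S1],
      [/\ subring_set S2, forall x, x \in l2 -> S2 x & C2 `<=` S2],
      [/\ hom_on S1 h1, forall x, C1 x -> h1 x = x & forall x, S1 x -> C1 (h1 x)],
      [/\ hom_on S2 h2, forall x, C2 x -> h2 x = x & forall x, S2 x -> C2 (h2 x)]
    & forall x, x \in l1 -> B1 x ->
      [/\ S2 (tau x), h1 x = h2 (tau x) & K (h1 x)]].
Proof.
pose b := [seq x <- l1 | `[< B1 x >]].
pose Rb := adj K b.
have sRb : subring_set Rb by exact: adj_subring.
have KRb : K `<=` Rb by exact: sub_adj.
have RbB : Rb `<=` B1.
  by apply: adj_min => // x; rewrite mem_filter => /andP[/asboolP].
pose T1 := comp C1 Rb; have sT1 : subring_set T1 by exact: comp_subring.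
have htR : hom_on Rb tau by exact: hom_on_sub htau.
pose Rb' := tau @` Rb.
have sRb' : subring_set Rb'.
  split; first by exists 1; [exact: subring1|rewrite (hom_on1 htau)].
    by move=> _ _ [x Rx <-] [y Ry <-]; exists (x - y); [exact: subringB|rewrite (hom_onB htR)].
  by move=> _ _ [x Rx <-] [y Ry <-]; exists (x * y); [exact: subringM|rewrite (hom_onM htR)].
have KRb' : K `<=` Rb' by move=> x Kx; exists x; [exact: KRb|exact: tauK].
have RbB' : Rb' `<=` B2 by move=> _ [x Rx <-]; apply: tauB; exact: RbB.
pose T2 := comp C2 Rb'; have sT2 : subring_set T2 by exact: comp_subring.
have adj_one (T : set P) (l : seq P) : subring_set T -> adj T l 1 by move=> sT; apply: subring1; exact: adj_subring.
have [r1 [Tr1 r10 X1]] := specialize (@expf_char0 P) sT1 sT1 (fun _ => id) cC1 cC1 (fun _ => id)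
  (dichotomy_refl T1 l1) (adj_one _ l1 sT1) (oner_neq0 P).
have [r2 [Tr2 r20 X2]] := specialize (@expf_char0 P) sT2 sT2 (fun _ => id) cC2 cC2 (fun _ => id)
  (dichotomy_refl T2 l2) (adj_one _ l2 sT2) (oner_neq0 P).
have [q1 [Rq1 q10 Y1]] := comp_extend sfK sC1 sRb KC1 KRb RbB ld1 Tr1 r10.
have [_ [[q2 Rq2 <-] q20 Y2]] := comp_extend sfK sC2 sRb' KC2 KRb' RbB' ld2 Tr2 r20.
have q2n : q2 != 0 by apply: contraNneq q20 => ->; rewrite (hom_on0 sB1 htau).
have [r0 [Kr0 r00 Z]] := specialize (@expf_char0 P) sK sK (fun _ => id) cK cK (fun _ => id)
  (dichotomy_refl K b) (subringM sRb Rq1 Rq2) (mulf_neq0 q10 q2n).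
have hid : hom_on K (id : P -> P) by [].
have [s [hs sid sKK _ sq]] := Z id hid (fun _ x => x) (fun _ x => x) r00.
move: sq; rewrite (hom_onM hs) // mulf_eq0 negb_or => /andP[sq1 sq2].
have tau_inj x y : B1 x -> B1 y -> tau x = tau y -> x = y by exact: hom_on_inj.
have /choice[t tP] : forall y, exists x, forall z, B1 z -> tau z = y -> x = z.
  move=> y; have [[z [Bz zy]]|n] := pselect (exists z, B1 z /\ tau z = y).
    by exists z => z' Bz' z'y; apply: tau_inj; rewrite // zy.
  by exists 0 => z Bz zy; case: n; exists z.
have tK z : B1 z -> t (tau z) = z by move=> Bz; exact: tP.
pose s' x := s (t x).
have s'E x : Rb x -> s' (tau x) = s x by move=> Rx; rewrite /s' tK //; exact: RbB.
have hs' : hom_on Rb' s'.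
  split.
  - by have := s'E 1 (subring1 sRb); rewrite (hom_on1 htau) (hom_on1 hs).
  - move=> _ _ [x Rx <-] [y Ry <-]; rewrite -(hom_onB htR) // !s'E ?(hom_onB hs) //.
    exact: subringB.
  - move=> _ _ [x Rx <-] [y Ry <-]; rewrite -(hom_onM htR) // !s'E ?(hom_onM hs) //.
    exact: subringM.
have [k1 [hk1 k1s k1C k1T k1r]] := Y1 s hs sKK sid sq1.
have [k2 [hk2 k2s k2C k2T k2r]] : exists h, [/\ hom_on T2 h, forall x, Rb' x -> h x = s' x,
      forall x, C2 x -> h x = x, forall x, T2 x -> C2 (h x) & h r2 != 0].
  apply: Y2 => //.
  - by move=> _ [x Rx <-]; rewrite s'E //; exact: sKK.
  - by move=> x Kx; rewrite -{1}(tauK Kx) s'E ?sid //; exact: KRb.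
  - by rewrite s'E.
have [h1 [hh1 h1k h1C _ _]] := X1 k1 hk1 k1T k1T k1r.
have [h2 [hh2 h2k h2C _ _]] := X2 k2 hk2 k2T k2T k2r.
have CT1 : C1 `<=` T1 by apply: sub_compl; exact: subring1.
have CT2 : C2 `<=` T2 by apply: sub_compl; exact: subring1.
have RT1 : Rb `<=` T1 by apply: sub_compr; exact: subring1.
have RT2 : Rb' `<=` T2 by apply: sub_compr; exact: subring1.
have sub1 : T1 `<=` adj T1 l1 by exact: sub_adj.
have sub2 : T2 `<=` adj T2 l2 by exact: sub_adj.
exists (adj T1 l1), (adj T2 l2), h1, h2; split.
- split; [exact: adj_subring|by move=> x; exact: mem_adj|].
  by move=> x /CT1; exact: sub1.
- split; [exact: adj_subring|by move=> x; exact: mem_adj|].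
  by move=> x /CT2; exact: sub2.
- by split=> // x Cx; rewrite h1k ?k1C //; exact: CT1.
- by split=> // x Cx; rewrite h2k ?k2C //; exact: CT2.
- move=> x xl Bx.
  have Rx : Rb x by apply: mem_adj => //; rewrite mem_filter xl andbT; apply/asboolP.
  have R'x : Rb' (tau x) by exists x.
  rewrite h1k ?k1s; [|by []|exact: RT1].
  rewrite h2k ?k2s; [|by []|exact: RT2].
  by split; [exact/sub2/RT2|rewrite s'E|exact: sKK].
Qed.

(** The algebraic closure of the compositum of [C1] and [B1]: the part of [P] to be placed in the
    ultrapower [W0]. The rest of [P] is added over it by [field_amalgam]. *)
Let H1 : set P := [set x | algebraic (comp C1 B1) x].
Let sT : subring_set (comp C1 B1). Proof. exact: comp_subring. Qed.
Let cH1 : closed_subfield H1. Proof. exact: algebraic_closed. Qed.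
Let sfH1 : subfield_set H1. Proof. by have [] := cH1. Qed.
Let sH1 : subring_set H1. Proof. by have [] := sfH1. Qed.
Let CH1 : C1 `<=` H1.
Proof. by move=> x Cx; apply: algebraic_mem => //; apply: sub_compl => //; exact: subring1. Qed.
Let BH1 : B1 `<=` H1.
Proof. by move=> x Cx; apply: algebraic_mem => //; apply: sub_compr => //; exact: subring1. Qed.

(** Separates an algebraic equation over the compositum into polynomials over [B1], weighted by
    [K]-independent elements of [C1], so that linear disjointness can later make each summand
    vanish. *)
Lemma algebraic_comp x : H1 x -> exists (e : seq P) (p : nat -> {poly P}),
  [/\ forall y, y \in e -> C1 y, linindep K e, forall k, pover B1 (p k),
      lc (fun k => (p k).[x]) e = 0 & exists2 k, (k < size e)%N & p k != 0].
Proof.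
move=> [q [Tq q0 qx]].
have /choice[l lP] : forall j, exists l : seq (P * P),
    (forall p, p \in l -> C1 p.1 /\ B1 p.2) /\ q`_j = \sum_(p <- l) p.1 * p.2.
  by move=> j; have [l lP lE] := Tq j; exists l.
have [e [eg ie ge]] := exists_basis (flatten [seq map fst (l j) | j <- iota 0 (size q)]) sfK.
have hid : hom_on B1 (id : P -> P) by [].
have /choice[b bP] : forall j, exists b, (j < size q)%N ->
    (forall k, B1 (b k)) /\ q`_j = lc b e.
  move=> j; have [lt|] := ltnP j (size q); last by exists (fun=> 0).
  have [p pl|b Bb [E _]] := comp_coordinates (e := e) (l := l j) sB1 KB1 hid (fun _ _ => erefl).
    have [lj _] := lP j; split; last by case: (lj p pl).
    apply: ge; apply/flattenP; exists (map fst (l j)); last exact: map_f.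
    by apply/mapP; exists j => //; rewrite mem_iota.
  by exists b => _; split=> //; rewrite -E; case: (lP j).
exists e, (fun k => \poly_(j < size q) b j k); split=> //.
- move=> y /eg/flattenP[_ /mapP[j _ ->] /mapP[p pl ->]].
  by have [lj _] := lP j; case: (lj p pl).
- move=> k i; rewrite coef_poly; case: ifP => [lt|_]; last exact: subring0.
  by case: (bP i lt).
- rewrite -qx horner_coef /lc.
  transitivity (\sum_(k < size e) \sum_(j < size q) b j k * x ^+ j * e`_k).
    by apply: eq_bigr => k _; rewrite horner_poly mulr_suml.
  rewrite exchange_big /=; apply: eq_bigr => j _.
  have [_ ->] := bP j (ltn_ord j); rewrite /lc mulr_suml.
  by apply: eq_bigr => k _; rewrite mulrAC.
- apply: contrapT => n; case/eqP: q0; apply/polyP => j; rewrite coef0.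
  have [lt|le] := ltnP j (size q); last by rewrite nth_default.
  have [_ ->] := bP j lt; rewrite /lc big1 // => k _.
  suff /polyP/(_ j) : \poly_(j < size q) b j k = 0.
    by rewrite coef_poly lt coef0 => ->; rewrite mul0r.
  by apply: contrapT => /eqP pk; apply: n; exists k.
Qed.

Theorem three_amalgam : exists (N : expFieldType) (i p1 p2 : P -> N),
  [/\ [/\ embedding i, embedding p1 & embedding p2],
      forall x, C1 x -> p1 x = i x, forall x, C2 x -> p2 x = i x
    & forall x, B1 x -> p1 x = p2 (tau x)].
Proof.
have [U [UF UP]] := mem_ultrafilter P.
have [W0 [cl cP]] := expfield_upower P UF.
have /choice[t tP] : forall l : seq P, exists t : set P * set P * (P -> P) * (P -> P),
  [/\ [/\ subring_set t.1.1.1, forall x, x \in l -> H1 x -> t.1.1.1 x & C1 `<=` t.1.1.1],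
      [/\ subring_set t.1.1.2, forall x, x \in l -> t.1.1.2 x & C2 `<=` t.1.1.2],
      [/\ hom_on t.1.1.1 t.1.2, forall x, C1 x -> t.1.2 x = x
        & forall x, t.1.1.1 x -> C1 (t.1.2 x)],
      [/\ hom_on t.1.1.2 t.2, forall x, C2 x -> t.2 x = x
        & forall x, t.1.1.2 x -> C2 (t.2 x)]
    & forall x, x \in l -> B1 x ->
      [/\ t.1.1.2 (tau x), t.1.2 x = t.2 (tau x) & K (t.1.2 x)]].
  move=> l; have [S1 [S2 [h1 [h2 [[a1 a2 a3] a4 a5 a6 a7]]]]] :=
    compatible_specializations [seq x <- l | `[< H1 x >]] l.
  exists (S1, S2, h1, h2); split=> //=.
    by split=> // x xl Hx; apply: a2; rewrite mem_filter xl andbT; apply/asboolP.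
  move=> x xl Bx; apply: a7 => //; rewrite mem_filter xl andbT; apply/asboolP; exact: BH1.
pose S1 l := (t l).1.1.1; pose S2 l := (t l).1.1.2.
pose h1 l := (t l).1.2; pose h2 l := (t l).2.
have S1r l : subring_set (S1 l) by case: (tP l) => -[].
have S2r l : subring_set (S2 l) by case: (tP l) => _ [].
have S1m l x : x \in l -> H1 x -> S1 l x by case: (tP l) => -[_ + _] _ _ _ _; apply.
have S2m l x : x \in l -> S2 l x by case: (tP l) => _ [_ + _] _ _ _; apply.
have S1C l : C1 `<=` S1 l by case: (tP l) => -[].
have S2C l : C2 `<=` S2 l by case: (tP l) => _ [].
have hh1 l : hom_on (S1 l) (h1 l) by case: (tP l) => _ _ [].
have hh2 l : hom_on (S2 l) (h2 l) by case: (tP l) => _ _ _ [].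
have h1C l x : C1 x -> h1 l x = x by case: (tP l) => _ _ [_ + _] _ _; apply.
have h2C l x : C2 x -> h2 l x = x by case: (tP l) => _ _ _ [_ + _] _; apply.
have h1S l x : S1 l x -> C1 (h1 l x) by case: (tP l) => _ _ [_ _ +] _ _; apply.
have h2S l x : S2 l x -> C2 (h2 l x) by case: (tP l) => _ _ _ [_ _ +] _; apply.
have h12 l x : x \in l -> B1 x -> h1 l x = h2 l (tau x) /\ K (h1 l x).
  by move=> xl Bx; case: (tP l) => _ _ _ _ /(_ x xl Bx)[].
pose u1 x := cl (fun l => h1 l x); pose u2 x := cl (fun l => h2 l x).
pose d : P -> W0 := cdiag cl.
have hd : hom_on [set: P] d by exact: (cdiag_hom cP).
(* The map [u1] is meant for [H1] only. Were the first copy of [P] placed in [W0] as a whole, its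
   additive relations with [W0] could not be confined to [H1]. *)
have hu1 : hom_on H1 u1.
  split=> [|x y Hx Hy|x y Hx Hy].
  - rewrite /u1 -(cl1 cP); congr cl; apply: funext => l; exact: (hom_on1 (hh1 l)).
  - rewrite /u1 -(clB cP); apply: (cl_ae cP).
    apply: filterS (filterI (UP x) (UP y)) => l [/= xl yl].
    by rewrite (hom_onB (hh1 l)) //; exact: S1m.
  - rewrite /u1 -(clM cP); apply: (cl_ae cP).
    apply: filterS (filterI (UP x) (UP y)) => l [/= xl yl].
    by rewrite (hom_onM (hh1 l)) //; exact: S1m.
have hu2 : hom_on [set: P] u2.
  split=> [|x y _ _|x y _ _].
  - rewrite /u2 -(cl1 cP); congr cl; apply: funext => l; exact: (hom_on1 (hh2 l)).
  - rewrite /u2 -(clB cP); apply: (cl_ae cP).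
    apply: filterS (filterI (UP x) (UP y)) => l [/= xl yl].
    by rewrite (hom_onB (hh2 l)) //; exact: S2m.
  - rewrite /u2 -(clM cP); apply: (cl_ae cP).
    apply: filterS (filterI (UP x) (UP y)) => l [/= xl yl].
    by rewrite (hom_onM (hh2 l)) //; exact: S2m.
have u1C x : C1 x -> u1 x = d x by move=> Cx; congr cl; apply: funext => l; exact: h1C.
have u2C x : C2 x -> u2 x = d x by move=> Cx; congr cl; apply: funext => l; exact: h2C.
have u12 x : B1 x -> u1 x = u2 (tau x).
  by move=> Bx; apply: (cl_ae cP); apply: filterS (UP x) => l /= xl; case: (h12 l x).
have u1K x : B1 x -> iset cl K (u1 x).
  move=> Bx; apply: (iset_ae cP); first exact: subring0.
  by apply: filterS (UP x) => l /= xl; case: (h12 l x).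
have [[sI _] _] := iset_closed cP cK.
(* Apply [u1] to the equation of [algebraic_comp]. If [u1 x] is in the ultrapower of [K], so is
   every value of a [p k]; all of them vanish by linear disjointness from the diagonal, and [x] is a
   root of a nonzero polynomial over [B1]. *)
have back x : H1 x -> iset cl K (u1 x) -> B1 x.
  move=> Hx Ix; have [e [p [eC ie Bp E [k ke pk]]]] := algebraic_comp Hx.
  have Hp j : H1 (p j).[x].
    by apply: pover_horner => //; apply: pover_sub (Bp j).
  have zero : u1 (p k).[x] = 0.
    have := iset_linindep cP sK ie (c := fun j => u1 (p j).[x]).
    move=> /(_ UF _ _ k); rewrite size_map; apply=> //.
      move=> j; rewrite (hom_on_horner sH1 hu1) //; last exact: pover_sub (Bp j).
      apply: pover_horner => // i.
      by rewrite (coef_map_hom sH1 hu1); apply: u1K; exact: Bp.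
    rewrite -(hom_on0 sH1 hu1) -E /lc (hom_on_sum sH1 hu1).
      rewrite size_map; apply: eq_bigr => j _.
      have Ce : C1 e`_j by apply: eC; exact: mem_nth.
      by rewrite (nth_map 0) // (hom_onM hu1 (Hp j) (CH1 Ce)) (u1C _ Ce).
    by move=> j; apply: subringM => //; apply: CH1; apply: eC; exact: mem_nth.
  have pkx : (p k).[x] = 0.
    apply: (hom_on_inj sfH1 hu1) => //; first exact: subring0.
    by rewrite zero (hom_on0 sH1 hu1).
  by apply: (closed_subfield_root cB1 (p := p k)) => //; apply/rootP.
have [W1 [w [q [hw hq qE qw]]]] := field_amalgam cH1 hu1.
have wB x y : w (x - y) = w x - w y by rewrite (hom_onB hw).
have wD x y : w (x + y) = w x + w y by rewrite (hom_onD (setT_subfield W0).1 hw).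
have w_inj : injective w by move=> x y; apply: (hom_on_inj (setT_subfield W0) hw).
have w0 : w 0 = 0 by rewrite (hom_on0 (setT_subfield W0).1 hw).
have homw (f : P -> W0) : hom_on [set: P] f -> hom_on [set: P] (w \o f).
  move=> hf; split=> [|x y _ _|x y _ _] /=.
  - by rewrite (hom_on1 hf) (hom_on1 hw).
  - by rewrite (hom_onB hf) // wB.
  - by rewrite (hom_onM hf) // (hom_onM hw).
have KH x : K x -> q x = w (d x) by move=> Kx; rewrite qE ?u1C //; [exact: KC1|apply: CH1; exact: KC1].
have KH2 x : K x -> w (u2 x) = w (d x) by move=> Kx; rewrite u2C //; exact: KC2.
have expN (x : ExpField.sort P) : expf (- x) = (expf x)^-1.
  have exp0 : @expf P 0 = 1.
    by apply: (mulfI (@Defs.expf_neq0 P 0)); rewrite -expfD addr0 mulr1.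
  by apply: (mulfI (@Defs.expf_neq0 P x)); rewrite -expfD subrr exp0 mulfV // Defs.expf_neq0.
have eC1 x : C1 x -> C1 (expf x) by have /EA_subfieldP[_] := EC1; apply.
have eC2 x : C2 x -> C2 (expf x) by have /EA_subfieldP[_] := EC2; apply.
have eB1 x : B1 x -> B1 (expf x) by have /EA_subfieldP[_] := EB1; apply.
have rel x y z : q x + w (u2 y) + w (d z) = 0 ->
    q (expf x) * w (u2 (expf y)) * w (d (expf z)) = 1.
  move=> E.
  have Hx : H1 x.
    apply: (qw x (- (u2 y + d z))); rewrite -[- _]sub0r wB w0 wD sub0r.
    by apply/eqP; rewrite -addr_eq0 addrA; apply/eqP.
  have E0 : u1 x + u2 y + d z = 0.
    by apply: w_inj; rewrite !wD -qE // w0.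
  have ae : U [set l | h1 l x + h2 l y + z = 0].
    by apply/(cl_eq cP (fun l => h1 l x + h2 l y + z) (fun=> 0)); rewrite !(clD cP) (cl0 cP).
  (* One coordinate of the relation splits [z] as [- (g1 + g2)] with [g1] in [C1] and [g2] in [C2].
     The aim is [x = g1 + be] and [y = g2 - tau be] with [be] in [B1]; the exponentials then
     cancel. *)
  have [l [/= [xl yl] El]] := ultra_ex2 (filterI (UP x) (UP y)) ae.
  pose g1 := h1 l x; pose g2 := h2 l y.
  have Cg1 : C1 g1 by apply: h1S; exact: S1m.
  have Cg2 : C2 g2 by apply: h2S; exact: S2m.
  have zE : z = - (g1 + g2).
    by apply/eqP; rewrite -addr_eq0 addrC; apply/eqP.
  pose be := x - g1.
  have Hb : H1 be by apply: subringB => //; exact: CH1.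
  have ub : u1 be = - u2 (y - g2).
    rewrite (hom_onB hu1 Hx (CH1 Cg1)) (hom_onB hu2) // (u1C _ Cg1) (u2C _ Cg2).
    have dz : d z = - (d g1 + d g2).
      by rewrite zE (hom_onN (setT_subfield P).1 hd) // (hom_onD (setT_subfield P).1 hd).
    by apply/eqP; rewrite -subr_eq0 -E0 dz; apply/eqP; ring.
  (* In almost every coordinate the value of [be] is in [C1] and equals an element of [C2], hence is
     in [K]. *)
  have Ib : iset cl K (u1 be).
    apply: (iset_ae cP); first exact: subring0.
    have aeb : U [set l | h1 l be = - h2 l (y - g2)].
      apply/(cl_eq cP (fun l => h1 l be) (fun l => - h2 l (y - g2))).
      by rewrite (clN cP).
    apply: filterS (filterI (filterI (UP be) (UP (y - g2))) aeb) => l' [[/= bl yl'] e].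
    apply: C12; first by apply: h1S; exact: S1m.
    by rewrite e; apply: subringN => //; apply: h2S; exact: S2m.
  have Bb := back _ Hb Ib.
  have yE : y = g2 - tau be.
    apply: (hom_on_inj (setT_subfield P) hu2) => //.
    have := ub; rewrite u12 // !(hom_onB hu2) // => ->.
    by ring.
  have xE : x = g1 + be by rewrite /be; ring.
  have qx : q (expf x) = w (d (expf g1)) * q (expf be).
    rewrite xE expfD (hom_onM hq) // (qE (expf g1)) ?u1C //.
      exact: eC1.
    by apply: CH1; exact: eC1.
  have qb : q (expf be) = w (u2 (tau (expf be))).
    by rewrite qE ?u12 //; [exact: eB1|apply: BH1; exact: eB1].
  have qb0 : q (expf be) != 0.
    rewrite -(hom_on0 (setT_subfield P).1 hq); apply/eqP.
    by move/(hom_on_inj (setT_subfield P) hq I I)/eqP; rewrite (negPf (Defs.expf_neq0 _)).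
  have uy : w (u2 (expf y)) = w (d (expf g2)) / q (expf be).
    apply: (canRL (mulfK qb0)); rewrite qb -(hom_onM hw) // -(hom_onM hu2) // tauE //.
    by rewrite -expfD yE subrK u2C //; exact: eC2.
  rewrite qx uy zE expN (expfD g1 g2).
  have dm a b : d (a * b) = d a * d b by rewrite (hom_onM hd).
  have wm a b : w (a * b) = w a * w b by rewrite (hom_onM hw).
  set A := expf g1; set B := expf g2.
  have inv : w (d A) * w (d B) * w (d (A * B)^-1) = 1.
    rewrite -!wm -!dm mulfV ?(hom_on1 hd) ?(hom_on1 hw) //.
    by rewrite mulf_neq0 // Defs.expf_neq0.
  rewrite -[RHS]inv; move: (w (d A)) (w (d B)) (w (d _)) (q _) qb0 => a b c e e0.
  by field.
have [N [j [ji e1 e2 e3]]] := exp_glue sfK (homw _ hd) hq (homw _ hu2) KH KH2 rel.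
exists N, (j \o (w \o d)), (j \o q), (j \o (w \o u2)); split=> //.
- by move=> x Cx /=; rewrite qE ?u1C //; exact: CH1.
- by move=> x Cx /=; rewrite u2C.
- by move=> x Bx /=; rewrite qE ?u12 //; exact: BH1.
Qed.

End ThreeAmalgam.

(** * The independence theorem *)

Lemma embed_elementary (Z : Type) (N A : structure) (fN : Z -> N) (fA : Z -> A) :
  (forall phi : formula Z, existential phi -> sat fN phi -> sat fA phi) ->
  exists (Q : structure) (dg : A -> Q) (j : N -> Q),
    [/\ elementary dg, embedding j & forall z, j (fN z) = dg (fA z)].
Proof.
move=> /upower_embedding[I [U [UF [j [ej jE]]]]].
by exists _, (@udiag I U UF A), j; split=> //; exact: udiag_elementary.
Qed.

Lemma embed_elementary_expfield (Z : Type) (N : structure) (A : expFieldType)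
    (fN : Z -> N) (fA : Z -> A) :
  (forall phi : formula Z, existential phi -> sat fN phi -> sat fA phi) ->
  exists (Q : expFieldType) (dg : A -> Q) (j : N -> Q),
    [/\ elementary dg, embedding j & forall z, j (fN z) = dg (fA z)].
Proof.
move=> /embed_elementary[Q [dg [j [el ej jE]]]].
have [Q' E] : exists Q' : expFieldType, Q = efield_structure Q'.
  by apply: models_efield_structure; rewrite -(elementary_models _ el); exact: efield_structure_models.
by subst Q; exists Q', dg, j.
Qed.

Lemma ec_sat (T : theory) (F M : structure) (f : F -> M) W (v : W -> F) phi :
  existentially_closed T F -> models T M -> embedding f -> existential phi ->
  sat (f \o v) phi -> sat v phi.
Proof.
move=> [_ ec] TM ef ephi s.
have := ec M f TM ef (fsubst (fun x => Var (v x)) phi) (existential_fsubst _ ephi).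
by rewrite !sat_fsubst; apply.
Qed.

Lemma embedding_comp (A B C : structure) (f : B -> C) (g : A -> B) :
  embedding f -> embedding g -> embedding (f \o g).
Proof.
move=> [fi [f0 f1] fD fM [fN fE]] [gi [g0 g1] gD gM [gN gE]]; split.
- exact: inj_comp.
- by rewrite /= g0 g1.
- by move=> x y /=; rewrite gD fD.
- by move=> x y /=; rewrite gM fM.
- by split=> x /=; rewrite ?gN ?fN ?gE ?fE.
Qed.

Lemma embedding_factor (A B C : structure) (f : B -> C) (g : A -> B) :
  embedding f -> embedding (f \o g) -> embedding g.
Proof.
move=> [fi [f0 f1] fD fM [fN fE]] [gi [g0 g1] gD gM [gN gE]]; split.
- by move=> x y xy; apply: gi => /=; rewrite xy.
- by split; apply: fi; [rewrite f0|rewrite f1].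
- by move=> x y; apply: fi; rewrite fD -gD.
- by move=> x y; apply: fi; rewrite fM -gM.
- by split=> x; apply: fi; [rewrite fN -gN|rewrite fE -gE].
Qed.

(** An elementary substructure of an existentially closed model is existentially closed. What [M2]
    satisfies over [A] therefore holds in [A] and then in [M1], so that [M2] embeds over [A] in an
    ultrapower of [M1]. *)
Lemma elementary_amalgamation_base (T : theory) (F A : structure) (e : A -> F) :
  existentially_closed T F -> elementary e -> amalgamation_base T A.
Proof.
move=> ecF el; have TF : models T F by case: ecF.
split; first by apply/(elementary_models T el).
have ecA (M : structure) (f : A -> M) phi : models T M -> embedding f -> existential phi ->
    sat f phi -> sat (id : A -> A) phi.
  move=> TM ef ephi sf.
  have [psi epsi sp|Q [dg [j [eldg ej jE]]]] := @embed_elementary A F M e f.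
    by apply: (embedding_existential (v := id) ef epsi); apply/el.
  apply/el; apply: (ec_sat (v := e) ecF (M := Q) _ ej ephi).
    by apply/(elementary_models T eldg).
  by rewrite (_ : j \o e = dg \o f); [apply/eldg|apply: funext => a /=].
move=> M1 M2 f1 f2 TM1 TM2 ef1 ef2.
have [phi ephi s2|Q [dg [j [eldg ej jE]]]] := @embed_elementary A M2 M1 f2 f1.
  exact: (embedding_existential (v := id) ef1 ephi (ecA _ _ _ TM2 ef2 ephi s2)).
exists Q, dg, j; split=> //; first by apply/(elementary_models T eldg).
exact: elementary_embedding.
Qed.

Fixpoint horner_term (V : Type) (s : seq V) : term (option V) :=
  if s is c :: s' then Add (Mul (horner_term s') (Var None)) (Var (Some c)) else Zero.

Lemma eval_horner_term (Q : expFieldType) V (v : V -> Q) (x : Q) s :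
  eval (oapp v x) (horner_term s) = (Poly (map v s)).[x].
Proof. by rewrite horner_Poly; elim: s => //= c s ->. Qed.

Lemma embedding_hom (P Q : expFieldType) (f : P -> Q) : embedding f -> hom_on [set: P] f.
Proof.
move=> [_ [_ f1] fD fM [fN _]]; split=> // x y _ _; last exact: fM.
by rewrite [LHS](fD x (- y)) [f (- y)](fN y).
Qed.

(** A root of an irreducible factor lives in a finite extension of [F]. Composing [expf] with an
    [F]-linear retraction onto [F] makes that extension an exponential field, and the root reflects
    to [F]. *)
Lemma ec_alg_closed (F : expFieldType) :
  existentially_closed Efield_theory F -> alg_closed F.
Proof.
move=> ecF p p1.
have [q [qp q1 qirr]] : exists q : {poly F}, [/\ q %| p, (1 < size q)%N & irreducible_poly q].
  have ex : exists n, `[< exists q : {poly F}, [/\ q %| p, (1 < size q)%N & size q = n] >].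
    by exists (size p); apply/asboolP; exists p.
  have [n /asboolP[q [qp q1 qn]] nmin] := ex_minnP ex.
  exists q; split=> //; split=> // r r1 rq.
  rewrite -(dvdp_size_eqp rq) eqn_leq dvdp_leq //=; last by rewrite -size_poly_gt0 ltnW.
  rewrite qn; apply: nmin; apply/asboolP; exists r; split=> //; first exact: dvdp_trans rq qp.
  have r0 : r != 0 by apply: contraTneq rq => ->; rewrite dvd0p -size_poly_gt0 ltnW.
  by rewrite ltn_neqAle eq_sym r1 size_poly_gt0.
have [L _ [z qz _]] := irredp_FAdjoin qirr.
pose a : F -> L := in_alg L.
have a_inj : injective a by exact: fmorph_inj.
have [r [rS rid rD]] : exists r : L -> L, [/\ forall x, range a (r x),
    forall x, range a x -> r x = x & forall x y, r (x + y) = r x + r y].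
  apply: (@additive_retraction _ (range a)).
  - split; first split.
    + by exists 1 => //; exact: rmorph1.
    + by move=> _ _ [x _ <-] [y _ <-]; exists (x - y) => //; exact: rmorphB.
    + by move=> _ _ [x _ <-] [y _ <-]; exists (x * y) => //; exact: rmorphM.
    + by move=> _ [x _ <-]; exists x^-1 => //; exact: fmorphV.
  - by exists 0 => //; exact: rmorph0.
  - by move=> _ _ [x _ <-] [y _ <-]; exists (x - y) => //; exact: rmorphB.
  - by move=> _ _ [x _ <-] [y _ <-]; exists (x * y) => //; exact: rmorphM.
have /choice[r' r'P] : forall x, exists y, a y = r x by move=> x; have [y _ yE] := rS x; exists y.
have r'D x y : r' (x + y) = r' x + r' y.
  by apply: a_inj; rewrite r'P rD -!r'P; exact/esym/rmorphD.
have r'a x : r' (a x) = x by apply: a_inj; rewrite r'P rid //; exists x.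
pose E x := a (expf (r' x)).
have ED x y : E (x + y) = E x * E y.
  by rewrite /E r'D expfD; exact: rmorphM.
have E0 x : E x != 0.
  by rewrite /E (fmorph_eq0 (in_alg L)) Defs.expf_neq0.
have ch : [pchar L] =i pred0.
  by move=> n; rewrite (fmorph_pchar (in_alg L)); exact: expf_char0.
pose N : expFieldType := HB.pack (GRing.Field.sort L)
  (Field_isExpField.Build (GRing.Field.clone _ L) ch ED E0).
have ea : embedding (a : F -> N).
  split=> //.
  - by split; [exact: (rmorph0 (in_alg L))|exact: (rmorph1 (in_alg L))].
  - by move=> x y; exact: (rmorphD (in_alg L)).
  - by move=> x y; exact: (rmorphM (in_alg L)).
  - split=> x; first exact: (rmorphN (in_alg L)).
    by rewrite /= /expf /= /E r'a.
have [x /= xE] : sat (id : F -> F) (Ex (Eq (horner_term (p : seq F)) Zero)).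
  apply: (ec_sat (v := id) ecF (efield_structure_models N) ea) => //.
  exists (z : N); rewrite /= (eval_horner_term (Q := N)) /=.
  have : root (map_poly a p) z by apply: root_dvdp qz; rewrite dvdp_map.
  by move/rootP; rewrite map_polyE.
exists x; apply/rootP; move: xE.
by rewrite eval_horner_term map_id polyseqK.
Qed.

Lemma ec_range_EA (A : structure) (F : expFieldType) (f : A -> F) : alg_closed F ->
  embedding f ->
  (forall phi : formula A, existential phi -> sat f phi -> sat (id : A -> A) phi) ->
  EA_subfield (range f).
Proof.
move=> aF ef ec; have [fi [f0 f1] fD fM [fN fE]] := ef.
apply/EA_subfieldP; split; last by move=> _ [a _ <-]; exists (sexp a) => //; rewrite fE.
split; first split; first split.
- by exists (sone A).
- by move=> _ _ [a _ <-] [b _ <-]; exists (sadd a (sopp b)) => //; rewrite fD fN.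
- by move=> _ _ [a _ <-] [b _ <-]; exists (smul a b) => //; rewrite fM.
- move=> _ [a _ <-]; have [a0|a0] := eqVneq (f a) 0.
    by exists (szero A) => //; rewrite a0 invr0 f0.
  have [b /= bE] : sat (id : A -> A) (Ex (Eq (Mul (Var None) (Var (Some a))) One)).
    by apply: ec => //=; exists (f a)^-1; exact: mulVf.
  exists b => //; apply: (mulIf a0); rewrite mulVf //.
  by rewrite -[RHS]f1 -bE fM.
- move=> p Ap p1; have [s sE] : exists s, map f s = p.
    have : forall i, range f p`_i by exact: Ap.
    elim: (p : seq F) => [|c s IH] H; first by exists [::].
    have [a _ aE] := H 0%N; have [|s' s'E] := IH; first by move=> i; exact: (H i.+1).
    by exists (a :: s'); rewrite /= aE s'E.
  have [x px] := aF p p1.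
  have [b /= bE] : sat (id : A -> A) (Ex (Eq (horner_term s) Zero)).
    apply: ec => //=; exists x; rewrite eval_horner_term sE polyseqK; exact/rootP.
  exists (f b); first by exists b.
  apply/rootP; have := congr1 f bE; rewrite -(embedding_eval (oapp id b) _ ef) f0.
  by rewrite comp_oapp eval_horner_term /= (_ : map _ s = p) ?polyseqK.
Qed.

Lemma EA_image (F Q : expFieldType) (f : F -> Q) (K : set F) :
  embedding f -> EA_subfield K -> EA_subfield (f @` K).
Proof.
move=> ef; have hf := embedding_hom ef; have [_ _ _ _ [_ fE]] := ef.
move=> /EA_subfieldP[[sfK aK] eK]; have hK := hom_on_sub (fun _ _ => I) hf : hom_on K f.
have [sK _] := sfK; apply/EA_subfieldP; split; last first.
  by move=> _ [x Kx <-]; exists (expf x); [exact: eK|exact: fE].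
split; first exact: subfield_image.
move=> p Kp p1; have [q [Kq qE qs]] := pover_image sK hK Kp.
have [//||x Kx qx] := aK q; first by rewrite qs.
exists (f x); first by exists x.
by apply/rootP; rewrite -qE -(hom_on_horner sK hK) // (rootP qx) (hom_on0 sK hK).
Qed.

(** The preimage of an EA-subfield of [Q] is one of [F]: roots exist in [F], and their images lie in
    any algebraically closed subfield that contains the coefficients. *)
Lemma EA_hull_image (F Q : expFieldType) (f : F -> Q) (X : set F) :
  alg_closed F -> embedding f -> f @` (EA_hull X) = EA_hull (f @` X).
Proof.
move=> aF ef; have hf := embedding_hom ef; have [fi _ _ _ [_ fE]] := ef.
have sT : subring_set [set: F] by [].
apply/seteqP; split; last first.
  apply: EA_hull_min; first exact/(EA_image ef)/EA_hull_EA.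
  by move=> _ [x Xx <-]; exists x => //; exact: sub_EA_hull.
move=> _ [x hx <-] L [EL XL]; have /EA_subfieldP[cL eL] := EL; have [[sL iL] aL] := cL.
apply: (hx (f @^-1` L)); split; last by move=> y Xy; apply: XL; exists y.
apply/EA_subfieldP; split; last by move=> y Ly; rewrite /preimage /= [f _](fE y); exact: eL.
split; first split; first split.
- by rewrite /preimage /= (hom_on1 hf); exact: subring1.
- by move=> y z Ly Lz; rewrite /preimage /= (hom_onB hf) //; exact: subringB.
- by move=> y z Ly Lz; rewrite /preimage /= (hom_onM hf) //; exact: subringM.
- move=> y Ly; rewrite /preimage /= (hom_onV (setT_subfield F) hf) //; exact: iL.
- move=> p Lp p1; have [y py] := aF p p1; exists y => //.
  apply: (closed_subfield_root cL (p := map_poly f p)).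
  + by move=> i; rewrite (coef_map_hom sT hf); exact: Lp.
  + apply: (map_hom_neq0 sT hf) => //.
    by rewrite -(hom_on0 sT hf) (inj_eq fi) lead_coef_eq0 -size_poly_gt0 ltnW.
  + by apply/rootP; rewrite -(hom_on_horner sT hf) // (rootP py) (hom_on0 sT hf).
Qed.

(** The inclusion of types embeds [F] in an elementary extension of itself, taking [v1] to the
    diagonal copy of [v2]; existential closedness pulls [phi] back to [v1]. *)
Lemma ec_type_maximal (F : expFieldType) W (v1 v2 : W -> F) :
  existentially_closed Efield_theory F ->
  (forall phi : formula W, existential phi -> sat v1 phi -> sat v2 phi) ->
  forall phi : formula W, existential phi -> sat v2 phi -> sat v1 phi.
Proof.
move=> ecF H phi ephi s2.
have [Q [dg [j [eldg ej jE]]]] := embed_elementary_expfield H.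
apply: (ec_sat (v := v1) ecF (efield_structure_models Q) ej ephi).
by rewrite (_ : j \o v1 = dg \o v2); [apply/eldg|apply: funext => w /=].
Qed.

(** The embedding [j] and the elementary map [dg] carry the two hulls onto the same subfield of [Q];
    [tau] is [j] followed by the inverse of [dg]. *)
Lemma hull_morphism (F : expFieldType) W (v1 v2 : W -> F) : alg_closed F ->
  (forall phi : formula W, existential phi -> sat v1 phi -> sat v2 phi) ->
  exists tau : F -> F,
    [/\ hom_on (EA_hull (range v1)) tau,
        forall x, EA_hull (range v1) x -> EA_hull (range v2) (tau x),
        forall x, EA_hull (range v1) x -> tau (expf x) = expf (tau x)
      & forall w, tau (v1 w) = v2 w].
Proof.
move=> aF H; have [Q [dg [j [eldg ej jE]]]] := embed_elementary_expfield H.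
have edg := elementary_embedding eldg; have [di _ _ _ [_ dE]] := edg.
have hdg := embedding_hom edg; have hj := embedding_hom ej; have [_ _ _ _ [_ jX]] := ej.
have im : j @` EA_hull (range v1) = dg @` EA_hull (range v2).
  rewrite !EA_hull_image //; congr EA_hull; apply/seteqP; split.
    by move=> _ [_ [w _ <-] <-]; exists (v2 w); [exists w|rewrite jE].
  by move=> _ [_ [w _ <-] <-]; exists (v1 w); [exists w|rewrite jE].
have /choice[tau tP] : forall x, exists y, EA_hull (range v1) x ->
    EA_hull (range v2) y /\ dg y = j x.
  move=> x; have [hx|n] := pselect (EA_hull (range v1) x); last by exists x.
  have : (dg @` EA_hull (range v2)) (j x) by rewrite -im; exists x.
  by move=> [y hy yx]; exists y.
have tE x : EA_hull (range v1) x -> dg (tau x) = j x by move=> /tP[].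
have /EA_subfieldP[[[sH iH] aH] eH] := EA_hull_EA aF (range v1).
exists tau; split.
- split.
  + apply: di; rewrite tE; last exact: (subring1 sH).
    by rewrite (hom_on1 hj) (hom_on1 hdg).
  + move=> x y hx hy; apply: di; rewrite (hom_onB hdg) // (tE _ hx) (tE _ hy) tE.
      by rewrite (hom_onB hj).
    exact: (subringB sH).
  + move=> x y hx hy; apply: di; rewrite (hom_onM hdg) // (tE _ hx) (tE _ hy) tE.
      by rewrite (hom_onM hj).
    exact: (subringM sH).
- by move=> x /tP[].
- move=> x hx; apply: di; rewrite [RHS]dE tE; last exact: eH.
  by rewrite [LHS]jX; congr sexp; rewrite -tE.
- by move=> w; apply: di; rewrite tE ?jE //; apply: sub_EA_hull; exists w.
Qed.

Section Monster.
Variables (T : theory) (F : expFieldType).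
Hypotheses (hT : JEP_refinement Efield_theory T) (hF : monster T F).

Lemma monster_ecT : existentially_closed T F. Proof. by case: hF. Qed.

Lemma monster_ec : existentially_closed Efield_theory F.
Proof. by case: hT => _ _ _; apply; exact: monster_ecT. Qed.

Lemma monster_closed : alg_closed F.
Proof. exact: ec_alg_closed monster_ec. Qed.

Lemma not_injects_nat : ~ injects F nat.
Proof. by case: hF => _ unc _ _ Fn; apply: unc; apply/card_le_injectsT. Qed.

Lemma nat_injects : injects nat F.
Proof. by case: (injects_total nat F) => // /not_injects_nat. Qed.

Lemma smallP (J : Type) : small F [set: J] <-> injects J F /\ ~ injects F J.
Proof. by rewrite /small !card_le_injectsT. Qed.

Lemma small_sum (J J' : Type) : injects J F /\ ~ injects F J ->
  injects J' F /\ ~ injects F J' -> injects (J + J') F /\ ~ injects F (J + J').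
Proof.
move=> [JF nJ] [J'F nJ']; split.
  exact: injects_trans (injects_sum JF J'F) (injects_double nat_injects).
by move=> /(injects_not_sum nat_injects)[].
Qed.

Lemma monster_realize (I J : Type) (c : J -> F) (N : structure) (i : F -> N) (b : I -> N) :
  models Efield_theory N -> embedding i -> injects I F ->
  injects J F /\ ~ injects F J ->
  exists b' : I -> F, forall phi : formula (I + J), existential phi ->
    sat (vsum b (i \o c)) phi -> sat (vsum b' c) phi.
Proof.
move=> EN ei IF smJ; have ecF := monster_ec.
have [phi ephi s|Q [dg [j [eldg ej jE]]]] := @embed_elementary F N F i id.
  exact: (ec_sat (v := id) ecF EN ei ephi s).
(* Loewenheim-Skolem needs an infinite bound, so [nat] is added to the parameters; smallness
   survives because [F] is uncountable. *)
have smJn : injects (J + nat) F /\ ~ injects F (J + nat).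
  by apply: small_sum => //; split; [exact: nat_injects|exact: not_injects_nat].
have nJ : injects nat (J + nat) by exists inr => x y [].
have JJ : injects J (J + nat) by exists inl => x y [].
have [A [e [ele ec AJ]]] := lowenheim_skolem c nJ JJ.
have AF : injects A F by apply: injects_trans AJ _; case: smJn.
have IA : injects (I + A) F.
  exact: injects_trans (injects_sum IF AF) (injects_double nat_injects).
have [N' [e2 [ele2 gen N'F]]] := lowenheim_skolem
  (fun z => match z with inl x => j (b x) | inr a => dg (e a) end) nat_injects IA.
have TN' : models T N'.
  by rewrite (elementary_models T ele2) -(elementary_models T eldg); case: monster_ecT.
have [_ _ unv hmg] := hF.
have [|g eg] := unv N' TN'; first by apply/card_le_injectsT.
have /choice[g0 g0P] : forall a, exists x, e2 x = dg (e a) by move=> a; exact: (gen (inr a)).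
have /choice[b0 b0P] : forall x, exists y, e2 y = j (b x) by move=> x; exact: (gen (inl x)).
have /choice[a aP] := ec.
have ee2 := elementary_embedding ele2; have ee := elementary_embedding ele.
have eg0 : embedding g0.
  apply: (embedding_factor ee2); rewrite (_ : e2 \o g0 = dg \o e); last exact: funext.
  exact: embedding_comp (elementary_embedding eldg) ee.
have smA : small F [set: A].
  by apply/smallP; split=> // FA; case: smJn => _; apply; exact: injects_trans FA AJ.
(* The universality map [g] displaces the parameters. Homogeneity over the small base [A] brings
   their images back to [c]. *)
have [th [[eth _] thE]] := hmg A (g \o g0) e
  (elementary_amalgamation_base monster_ecT ele) smA (embedding_comp eg eg0) ee.
exists (th \o g \o b0) => phi ephi s.
have := embedding_existential ej ephi s.
rewrite (_ : j \o vsum b (i \o c) = e2 \o vsum b0 (g0 \o a)); last first.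
  by apply: funext => -[x|y] /=; rewrite ?b0P // jE g0P aP.
move=> /ele2 /(embedding_existential (embedding_comp eth eg) ephi).
congr sat; apply: funext => -[x|y] //=.
by have /= -> := thE (a y); exact: aP.
Qed.

(** Otherwise [1] and [x] would be [K]-independent in [C], whereas [x * 1 - 1 * x = 0] is a relation
    over [B]. *)
Lemma lin_disjoint_cap (C B K : set F) x : subfield_set K -> subring_set B ->
  lin_disjoint C B K -> C 1 -> C x -> B x -> K x.
Proof.
move=> [sK iK] sB ld C1 Cx Bx; apply: contrapT => nK.
have ie : linindep K [:: 1; x].
  move=> c Kc; rewrite !lc_cons /lc big_ord0 addr0 mulr1 => E.
  have c1 : c 1%N = 0.
    apply: contrapT => /eqP c1; apply: nK.
    have -> : x = - (c 0%N) / c 1%N.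
      apply: (mulfI c1); rewrite mulrCA mulfV // mulr1.
      by apply/eqP; rewrite -addr_eq0 addrC; apply/eqP.
    by apply: subringM => //; [exact: subringN|exact: iK].
  by move: E; rewrite c1 mul0r addr0 => c0 [|[|]].
pose c (l : nat) : F := if l is 0%N then x else -1.
have eC y : y \in [:: 1; x] -> C y by rewrite !inE => /orP[/eqP->|/eqP->].
have Bc l : B (c l) by case: l => [//|l]; apply: (subringN sB); exact: (subring1 sB).
have E : lc c [:: 1; x] = 0 by rewrite !lc_cons /lc big_ord0 addr0 mulr1 mulN1r subrr.
by have /eqP := ld _ eC ie c Bc E 1%N isT; rewrite oppr_eq0 oner_eq0.
Qed.

Lemma independence_theorem (K : set F) (I J1 J2 : Type)
    (b1 b2 : I -> F) (c1 : J1 -> F) (c2 : J2 -> F) :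
  EA_subfield K -> small F K ->
  small F [set: I] -> small F [set: J1] -> small F [set: J2] ->
  EA_indep (range c1) K (range c2) -> EA_indep (range b1) K (range c1) ->
  EA_indep (range b2) K (range c2) -> etp K b1 = etp K b2 ->
  exists b : I -> F,
    etp (range c1 `|` K) b = etp (range c1 `|` K) b1 /\
    etp (range c2 `|` K) b = etp (range c2 `|` K) b2.
Proof.
move=> EK smK /smallP[IF _] /smallP smJ1 /smallP smJ2 ind12 ind1 ind2 etpE.
have aF := monster_closed; have ecF := monster_ec.
have {}smK : injects K F /\ ~ injects F K.
  move: smK; rewrite /small !card_le_injects => -[a b]; split.
    exact: injects_val.
  move=> FK; apply: b; apply: injects_trans FK; exact: injects_val.
rewrite /EA_indep !(EA_hull_id EK) in ind12 ind1 ind2.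
have rangeE (J : Type) (b : J -> F) :
    range (with_params b : J + K -> F) = range b `|` K.
  apply/seteqP; split=> [_ [[x|x] _ <-]|x [[y _ <-]|Kx]] /=.
  - by left; exists x.
  - by right; apply: set_mem; exact: (valP x).
  - by exists (inl y).
  - by exists (inr (exist _ x (mem_set Kx))).
have [phi ephi s|tau [htau tauB tauE tauV]] :=
  @hull_morphism F (I + K) (with_params b1) (with_params b2) aF.
  by have [] : etp K b2 phi by rewrite -etpE; split.
rewrite !rangeE in htau tauB tauE.
have KH (X : set F) : K `<=` EA_hull (X `|` K) by move=> x Kx; apply: sub_EA_hull; right.
have [cK _] := (EA_subfieldP K).1 EK.
have hc (X : set F) : closed_subfield (EA_hull X) by exact: (EA_hull_closed aF).
have cf (X : set F) : closed_subfield X -> subfield_set X by case.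
have [N [i [p1 [p2 [[ei ep1 ep2] p1C p2C p12]]]]] : exists (N : expFieldType) (i p1 p2 : F -> N),
  [/\ [/\ embedding i, embedding p1 & embedding p2],
      forall x, EA_hull (range c1 `|` K) x -> p1 x = i x,
      forall x, EA_hull (range c2 `|` K) x -> p2 x = i x
    & forall x, EA_hull (range b1 `|` K) x -> p1 x = p2 (tau x)].
  apply: (@three_amalgam F K (EA_hull (range b1 `|` K)) (EA_hull (range b2 `|` K))) => //;
    try exact: (EA_hull_EA aF); try exact: KH.
  - by move=> x Kx; exact: (tauV (inr (exist _ x (mem_set Kx)))).
  - exact: ACF_indep_lin_disjoint.
  - exact: ACF_indep_lin_disjoint.
  - move=> x C1x C2x.
    have ld := ACF_indep_lin_disjoint (hc _) (hc _) cK (KH (range c1)) (KH (range c2)) ind12.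
    apply: (lin_disjoint_cap _ _ ld) => //; first exact: cf.
      by case: (cf _ (hc (range c1 `|` K))).
    by case: (cf _ (hc (range c2 `|` K))) => sC _; exact: subring1.
pose c (x : J1 + (J2 + K)) : F :=
  match x with inl x => c1 x | inr (inl x) => c2 x | inr (inr x) => val x end.
have [|b bP] := monster_realize c (p1 \o b1) (efield_structure_models N) ei IF _.
  by apply: small_sum => //; exact: small_sum.
(* Used with [p1] and [b1] over [c1], then with [p2] and [b2] over [c2]: the tuples [p1 \o b1] and
   [p2 \o b2] coincide because [tau] takes [b1] to [b2]. *)
have half (S : set F) (p : F -> N) (b' : I -> F) :
    embedding p -> (forall x, S x -> p x = i x) -> (forall x, p (b' x) = p1 (b1 x)) ->
    (forall x, S x -> exists y, c y = x) -> etp S b = etp S b'.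
  move=> ep pS pb Sc.
  have /choice[rho rhoP] : forall x : S, exists y, c y = val x.
    by move=> x; apply: Sc; apply: set_mem; exact: (valP x).
  have H phi : existential phi -> sat (with_params (B := S) b') phi -> sat (with_params (B := S) b) phi.
    move=> ephi s.
    pose r (x : I + S) : term (I + (J1 + (J2 + K))) :=
      match x with inl y => Var (inl y) | inr y => Var (inr (rho y)) end.
    have := bP (fsubst r phi) (existential_fsubst r ephi).
    rewrite !sat_fsubst.
    rewrite (_ : (fun x => eval (vsum b c) (r x)) = with_params (B := S) b); last first.
      by apply: funext => -[x|x] //=; exact: rhoP.
    apply; rewrite (_ : (fun x => _) = p \o with_params (B := S) b'); last first.
      apply: funext => -[x|x] /=; first by rewrite pb.
      by rewrite rhoP pS //; apply: set_mem; exact: (valP x).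
    exact: embedding_existential.
  apply/seteqP; split=> phi [ephi s]; split=> //; last exact: H.
  exact: (ec_type_maximal ecF H).
exists b; split.
  apply: (half _ p1) => //.
  - by move=> x Sx; apply: p1C; exact: sub_EA_hull.
  - by move=> x [[y _ <-]|Kx]; [exists (inl y)|exists (inr (inr (exist _ x (mem_set Kx))))].
apply: (half _ p2) => //.
- by move=> x Sx; apply: p2C; exact: sub_EA_hull.
- move=> x; rewrite p12; last by apply: sub_EA_hull; left; exists x.
  by have /= -> := tauV (inl x).
- by move=> x [[y _ <-]|Kx]; [exists (inr (inl y))|exists (inr (inr (exist _ x (mem_set Kx))))].
Qed.

End Monster.

(** * Strong finite character *)

Section Definable.
Variable F : expFieldType.

(** [X] is a type of instances, each giving a valuation of the variables [W]. Definability is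
    uniform in the instance, so that one formula applies to [a] and to every other tuple [a']. *)
Definition tdef (X W : Type) (val : X -> W -> F) (g : X -> F) : Prop :=
  exists t : term W, forall x, eval (val x) t = g x.

Definition edef (X W : Type) (val : X -> W -> F) (R : X -> Prop) : Prop :=
  exists2 phi : formula W, existential phi & forall x, sat (val x) phi <-> R x.

Section Ops.
Variables (X W : Type) (val : X -> W -> F).

Lemma tdef0 : tdef val (fun=> 0). Proof. by exists Zero. Qed.
Lemma tdef1 : tdef val (fun=> 1). Proof. by exists One. Qed.
Lemma tdefD f g : tdef val f -> tdef val g -> tdef val (fun x => f x + g x).
Proof. by move=> [s sE] [t tE]; exists (Add s t) => x /=; rewrite sE tE. Qed.
Lemma tdefB f g : tdef val f -> tdef val g -> tdef val (fun x => f x - g x).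
Proof. by move=> [s sE] [t tE]; exists (Add s (Opp t)) => x /=; rewrite sE tE. Qed.
Lemma tdefM f g : tdef val f -> tdef val g -> tdef val (fun x => f x * g x).
Proof. by move=> [s sE] [t tE]; exists (Mul s t) => x /=; rewrite sE tE. Qed.
Lemma tdefE f : tdef val f -> tdef val (fun x => expf (f x)).
Proof. by move=> [s sE]; exists (Exp s) => x /=; rewrite sE. Qed.
Lemma tdef_ext f g : (forall x, f x = g x) -> tdef val f -> tdef val g.
Proof. by move=> fg [t tE]; exists t => x; rewrite tE fg. Qed.
Lemma tdefX f k : tdef val f -> tdef val (fun x => f x ^+ k).
Proof.
move=> df; elim: k => [|k IH]; first by apply: tdef_ext tdef1 => x; rewrite expr0.
by apply: tdef_ext (tdefM df IH) => x; rewrite exprS.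
Qed.
Lemma tdef_sum (J : Type) (r : seq J) (f : J -> X -> F) :
  (forall j, tdef val (f j)) -> tdef val (fun x => \sum_(j <- r) f j x).
Proof.
move=> df; elim: r => [|j r IH]; first by apply: tdef_ext tdef0 => x; rewrite big_nil.
by apply: tdef_ext (tdefD (df j) IH) => x; rewrite big_cons.
Qed.
Lemma tdef_prod (J : Type) (r : seq J) (f : J -> X -> F) :
  (forall j, tdef val (f j)) -> tdef val (fun x => \prod_(j <- r) f j x).
Proof.
move=> df; elim: r => [|j r IH]; first by apply: tdef_ext tdef1 => x; rewrite big_nil.
by apply: tdef_ext (tdefM (df j) IH) => x; rewrite big_cons.
Qed.

Lemma edef_eq f g : tdef val f -> tdef val g -> edef val (fun x => f x = g x).
Proof. by move=> [s sE] [t tE]; exists (Eq s t) => // x /=; rewrite sE tE. Qed.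
Lemma edef_neq f g : tdef val f -> tdef val g -> edef val (fun x => f x <> g x).
Proof. by move=> [s sE] [t tE]; exists (Not (Eq s t)) => // x /=; rewrite sE tE. Qed.
Lemma edef_and R S : edef val R -> edef val S -> edef val (fun x => R x /\ S x).
Proof.
move=> [f ef fE] [g eg gE]; have [h eh hE] := existential_and ef eg.
by exists h => // x; rewrite hE fE gE.
Qed.
Lemma edef_all (J : eqType) (r : seq J) (R : J -> X -> Prop) :
  (forall j, j \in r -> edef val (R j)) -> edef val (fun x => forall j, j \in r -> R j x).
Proof.
elim: r => [|j r IH] dR; first by exists (Eq Zero Zero).
have [k kr|h eh hE] := IH; first by apply: dR; rewrite inE kr orbT.
have [f ef fE] := edef_and (dR j (mem_head _ _)) (ex_intro2 _ _ h eh hE).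
exists f => // x; rewrite fE; split=> [[Rj H] k|H]; last first.
  by split=> [|k kr]; apply: H; rewrite inE ?eqxx ?kr ?orbT.
by rewrite inE => /predU1P[->//|/H].
Qed.
Lemma edef_forall (J : finType) (R : J -> X -> Prop) :
  (forall j, edef val (R j)) -> edef val (fun x => forall j, R j x).
Proof.
move=> dR; have [f ef fE] := @edef_all _ (enum J) R (fun j _ => dR j).
by exists f => // x; rewrite fE; split=> H j; [apply: H; rewrite mem_enum|].
Qed.
Lemma edef_ext R S : (forall x, R x <-> S x) -> edef val R -> edef val S.
Proof. by move=> RS [f ef fE]; exists f => // x; rewrite fE RS. Qed.

Lemma edef_ex V (R : X * (V -> F) -> Prop) :
  edef (fun p => vsum (val p.1) p.2) R -> edef val (fun x => exists v, R (x, v)).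
Proof.
move=> [f ef fE]; have [h eh hE] := existential_close ef.
by exists h => // x; rewrite hE; split=> -[v /(fE (x, v)) Rv]; exists v.
Qed.
End Ops.

Lemma edef_subst (X W X' W' : Type) (val : X -> W -> F) (val' : X' -> W' -> F)
    (pi : X' -> X) (rho : W -> term W') (R : X -> Prop) :
  (forall x w, eval (val' x) (rho w) = val (pi x) w) ->
  edef val R -> edef val' (fun x => R (pi x)).
Proof.
move=> H [f ef fE]; exists (fsubst rho f); first exact: existential_fsubst.
move=> x; rewrite sat_fsubst -fE (_ : (fun w => _) = val (pi x)) //.
exact: funext.
Qed.

Hypothesis aF : alg_closed F.

Lemma finite_roots (q : {poly F}) : q != 0 -> finite_set [set y | q.[y] = 0].
Proof.
move=> q0; apply: contrapT => /infiniteP; rewrite card_le_injects => -[f fi].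
have [g gi] := injects_trans (setT_injects nat) (ex_intro (fun f => injective f) f fi).
have /(max_poly_roots q0) : all (root q) [seq val (g i) | i <- iota 0 (size q)].
  by apply/allP => _ /mapP[i _ ->]; apply/rootP; exact: (set_mem (valP (g i))).
rewrite map_inj_uniq ?iota_uniq; last by move=> i j /val_inj/gi.
by move=> /(_ isT); rewrite size_map size_iota ltnn.
Qed.

Lemma finite_family k (S : 'I_k -> set F) : (forall j, finite_set (S j)) ->
  finite_set [set y : 'I_k -> F | forall j, S j (y j)].
Proof.
move=> fS; have /choice[s sP] : forall j, exists s : seq F, S j = [set` s].
  by move=> j; apply/finite_seqP.
pose N := (\max_j size (s j))%N.
apply: (@sub_finite_set _ _ ((fun f : {ffun 'I_k -> 'I_N.+1} => fun j => nth 0 (s j) (f j)) @` setT)).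
  move=> y yS; exists [ffun j => inord (index (y j) (s j))] => //.
  apply: funext => j; have := yS j; rewrite sP => ys.
  have lt : (index (y j) (s j) < size (s j))%N by rewrite index_mem.
  rewrite ffunE inordK ?nth_index // ltnS.
  exact: leq_trans (ltnW lt) (leq_bigmax j).
by apply: finite_image; exact: finite_finset.
Qed.

Section Hull.
Variables (X W : Type) (val : X -> W -> F) (x0 : X).

Definition oval (p : X * F) : option W -> F := oapp (val p.1) p.2.

(** The finite set containing [al] is defined uniformly in the instance and always stays in the hull
    of that instance; hence a formula about [a] still provides elements of the hull of [a']. *)
Definition algebraic_over (al : F) : Prop := exists R : X -> F -> Prop,
  [/\ edef oval (fun p => R p.1 p.2), R x0 al, forall x, finite_set [set y | R x y]
    & forall x y, R x y -> EA_hull (range (val x)) y].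

(** Operations are relations with finitely many values, so that taking a root of the polynomial with
    given coefficients is one of them. A finite union of finite sets is finite. *)
Lemma algebraic_over_op k (O : ('I_k -> F) -> F -> Prop) (als : 'I_k -> F) al :
  (forall j, algebraic_over (als j)) -> O als al ->
  edef (fun q : ('I_k -> F) * F => oapp q.1 q.2) (fun q => O q.1 q.2) ->
  (forall ys, finite_set [set y | O ys y]) ->
  (forall (K : set F) ys y, EA_subfield K -> (forall j, K (ys j)) -> O ys y -> K y) ->
  algebraic_over al.
Proof.
move=> /choice[R RP] Oal dO fO hO.
exists (fun x y => exists ys : 'I_k -> F, (forall j, R j x (ys j)) /\ O ys y); split.
- apply: edef_ex (fun q : X * F * ('I_k -> F) =>
    (forall j, R j q.1.1 (q.2 j)) /\ O q.2 q.1.2) _ => /=.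
  apply: edef_and.
    apply: edef_forall => j; have [dR _ _ _] := RP j.
    apply: (edef_subst (pi := fun q : X * F * ('I_k -> F) => (q.1.1, q.2 j))
      (rho := fun w => if w is Some w' then Var (inl (Some w')) else Var (inr j))) dR.
    by move=> x [w|].
  apply: (edef_subst (pi := fun q : X * F * ('I_k -> F) => (q.2, q.1.2))
    (rho := fun w => if w is Some j then Var (inr j) else Var (inl None))) dO.
  by move=> x [w|].
- by exists als; split=> // j; case: (RP j).
- move=> x.
  apply: (@sub_finite_set _ _ (\bigcup_(ys in [set ys | forall j, R j x (ys j)]) [set y | O ys y])).
    by move=> y [ys [ysR Oy]]; exists ys.
  apply: bigcup_finite => [|ys _]; last exact: fO.
  by apply: (finite_family (S := fun j => [set y | R j x y])) => j; case: (RP j).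
- move=> x y [ys [ysR Oy]]; apply: (hO _ ys y) => //; first exact: EA_hull_EA.
  by move=> j; have [_ _ _ H] := RP j; exact: H (ysR j).
Qed.

Lemma hull_algebraic_over : EA_hull (range (val x0)) `<=` algebraic_over.
Proof.
have gvar (k : nat) (j : 'I_k) : tdef (fun q : ('I_k -> F) * F => oapp q.1 q.2) (fun q => q.1 j).
  by exists (Var (Some j)).
have gres (k : nat) : tdef (fun q : ('I_k -> F) * F => oapp q.1 q.2) (fun q => q.2).
  by exists (Var None).
have fin1 (z : F) : finite_set [set y | y = z] by exact: finite_set1.
have one : algebraic_over 1.
  apply: (@algebraic_over_op 0 (fun _ y => y = 1) (fun _ => 0)) => //.
  - by case.
  - by apply: edef_eq; [exact: gres|exact: tdef1].
  - by move=> K _ y /EA_subfieldP[[[sK _] _] _] _ ->; exact: subring1.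
pose two (x y : F) (j : 'I_2) := if nat_of_ord j is 0%N then x else y.
apply: EA_hull_min; last first.
  move=> _ [w _ <-]; exists (fun x y => y = val x w); split=> //.
  - by apply: edef_eq; [exists (Var None)|exists (Var (Some w))].
  - by move=> x y ->; apply: sub_EA_hull; exists w.
apply/EA_subfieldP; split; last first.
  move=> x gx; apply: (@algebraic_over_op 1 (fun ys y => y = expf (ys ord0)) (fun=> x)) => //.
  - by apply: edef_eq => //; apply: tdefE.
  - by move=> K ys y /EA_subfieldP[_ eK] Kys ->; exact: eK.
split; first split; first split=> //.
- move=> x y gx gy.
  apply: (@algebraic_over_op 2 (fun ys z => z = ys ord0 - ys ord_max) (two x y)) => //.
  + by move=> j; rewrite /two; case: (nat_of_ord j).
  + by apply: edef_eq => //; apply: tdefB.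
  + by move=> K ys z /EA_subfieldP[[[sK _] _] _] Kys ->; exact: subringB.
- move=> x y gx gy.
  apply: (@algebraic_over_op 2 (fun ys z => z = ys ord0 * ys ord_max) (two x y)) => //.
  + by move=> j; rewrite /two; case: (nat_of_ord j).
  + by apply: edef_eq => //; apply: tdefM.
  + by move=> K ys z /EA_subfieldP[[[sK _] _] _] Kys ->; exact: subringM.
(* The relation [z * y = 1] gives inverses of nonzero elements only; the value [0] is obtained as
   [y - y]. *)
- move=> x gx; have [->|x0'] := eqVneq x 0.
    rewrite invr0.
    apply: (@algebraic_over_op 1 (fun ys z => z = ys ord0 - ys ord0) (fun=> x)) => //.
    + by rewrite subrr.
    + by apply: edef_eq => //; apply: tdefB.
    + by move=> K ys z /EA_subfieldP[[[sK _] _] _] Kys ->; exact: subringB.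
  apply: (@algebraic_over_op 1 (fun ys z => z * ys ord0 = 1) (fun=> x)) => //.
  + by rewrite mulVf.
  + by apply: edef_eq; [apply: tdefM|exact: tdef1].
  + move=> ys; apply: (@sub_finite_set _ _ [set (ys ord0)^-1]); last exact: finite_set1.
    move=> z /= zE; have y0 : ys ord0 != 0.
      by apply: contra_eq_neq zE => ->; rewrite mulr0 eq_sym oner_neq0.
    by apply: (mulIf y0); rewrite mulVf.
  + move=> K ys z /EA_subfieldP[[[sK iK] _] _] Kys zE.
    have y0 : ys ord0 != 0.
      by apply: contra_eq_neq zE => ->; rewrite mulr0 eq_sym oner_neq0.
    suff -> : z = (ys ord0)^-1 by exact: iK.
    by apply: (mulIf y0); rewrite mulVf.
- move=> p gp p1; have [z pz] := aF p1; exists z => //.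
  have pn0 : p != 0 by rewrite -size_poly_gt0 ltnW.
  have lt : ((size p).-1 < size p)%N by rewrite prednK // ltnW.
  pose pp (ys : 'I_(size p) -> F) : {poly F} :=
    \poly_(j < size p) (if insub j is Some j' then ys j' else 0).
  have ppE ys (j : 'I_(size p)) : (pp ys)`_j = ys j.
    by rewrite coef_poly ltn_ord valK.
  have pph ys y : (pp ys).[y] = \sum_(j < size p) ys j * y ^+ j.
    by rewrite horner_poly; apply: eq_bigr => j _; rewrite valK.
  have pp0 ys : ys (Ordinal lt) <> 0 -> pp ys != 0.
    move=> y0; apply/eqP => pp0; apply: y0.
    by rewrite -(ppE ys (Ordinal lt)) pp0 coef0.
  (* The leading coefficient is required to be nonzero because at another instance the polynomial
     could vanish, and every element would be a root. *)
  apply: (@algebraic_over_op (size p) (fun ys y => ys (Ordinal lt) <> 0 /\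
    \sum_(j < size p) ys j * y ^+ j = 0) (fun j => p`_j)).
  + by move=> j; exact: gp.
  + split; last by rewrite -horner_coef; exact/rootP.
    by apply/eqP; rewrite /= -lead_coefE lead_coef_eq0.
  + apply: edef_and; first by apply: edef_neq => //; exact: tdef0.
    apply: edef_eq; last exact: tdef0.
    by apply: tdef_sum => j; apply: tdefM => //; apply: tdefX.
  + move=> ys; have [y0|y0] := pselect (ys (Ordinal lt) = 0).
      by apply: (@sub_finite_set _ _ set0) => // y [].
    apply: (@sub_finite_set _ _ [set y | (pp ys).[y] = 0]); last exact/finite_roots/pp0.
    by move=> y [_ yE] /=; rewrite pph.
  + move=> K ys y /EA_subfieldP[cK _] Kys [y0 yE].
    apply: (closed_subfield_root cK (p := pp ys)); last by apply/rootP; rewrite pph.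
      move=> j; rewrite coef_poly; case: ifP => // _; last by case: cK => -[sK _] _; exact: subring0.
      by case: insubP => [j' _ _|_] //; case: cK => -[sK _] _; exact: subring0.
    exact: pp0.
Qed.

End Hull.

Lemma strong_finite_character (K : set F) (I J : Type) (a : I -> F) (b : J -> F) :
  EA_subfield K -> ~ EA_indep (range a) K (range b) ->
  exists2 phi : formula (I + (range b `|` K)), etp (range b `|` K) a phi
    & forall a' : I -> F, sat (with_params a') phi -> ~ EA_indep (range a') K (range b).
Proof.
move=> EK; rewrite /EA_indep !(EA_hull_id EK).
have [cK _] := (EA_subfieldP K).1 EK; have [sfK _] := cK; have [sK _] := sfK.
pose A_ (a' : I -> F) := EA_hull (range a' `|` K); pose B := EA_hull (range b `|` K).
have KA a' : K `<=` A_ a' by move=> x Kx; apply: sub_EA_hull; right.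
have KB : K `<=` B by move=> x Kx; apply: sub_EA_hull; right.
have cA a' : closed_subfield (A_ a') by exact: (EA_hull_closed aF).
have cB : closed_subfield B by exact: (EA_hull_closed aF).
have sfA a' : subfield_set (A_ a') by case: (cA a').
have symm a' : ~ ACF_indep B (A_ a') K -> ~ ACF_indep (A_ a') B K.
  by move=> n /(ACF_indep_sym (cA a') cB cK (KA a') KB).
move=> nind.
have {nind} : ~ ACF_indep B (A_ a) K.
  by move=> /(ACF_indep_sym cB (cA a) cK KB (KA a)).
rewrite (ACF_indepP _ (sfA a) (KA a)) => nind.
have [N [be [Bbe Kbe nAbe]]] : exists N (be : 'I_N -> F),
    [/\ forall i, B (be i), alg_indep K be & ~ alg_indep (A_ a) be].
  apply: contrapT => H; apply: nind => N be Bbe Kbe; apply: contrapT => nA.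
  by apply: H; exists N, be.
have {Kbe} fbe : alg_free K be by apply/alg_indepE.
have [p [Ap p0 pn]] : exists p : {mpoly F[N]}, [/\ mover (A_ a) p, p.@[be] = 0 & p <> 0].
  apply: contrapT => H; apply: nAbe; apply/alg_indepE => // p Ap p0.
  by apply: contrapT => pn; apply: H; exists p.
pose ms := msupp p; pose M := size ms.
have M0 : (0 < M)%N.
  by rewrite lt0n size_eq0 msupp_eq0; apply/eqP.
pose mk (k : nat) := nth 0%MM ms k.
pose valB (_ : unit) (s : (range b `|` K : set F)) : F := val s.
have rB : range (valB tt) = range b `|` K.
  apply/seteqP; split=> [_ [s _ <-]|x xS]; first exact: (set_mem (valP s)).
  by exists (exist _ x (mem_set xS)).
have /choice[Rb RbP] : forall i, algebraic_over valB tt (be i).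
  by move=> i; apply: hull_algebraic_over; rewrite rB; exact: Bbe.
pose valA (a' : I -> F) : I + K -> F := with_params a'.
have rA a' : range (valA a') = range a' `|` K.
  apply/seteqP; split=> [_ [[x|x] _ <-]|x [[y _ <-]|Kx]] /=.
  - by left; exists x.
  - by right; exact: (set_mem (valP x)).
  - by exists (inl y).
  - by exists (inr (exist _ x (mem_set Kx))).
have /choice[Ra RaP] : forall k : 'I_M, algebraic_over valA a p@_(mk k).
  by move=> k; apply: hull_algebraic_over; rewrite rA; exact: Ap.
pose Y : set ('I_N -> F) := [set y | forall i, Rb i tt (y i)].
have fY : finite_set Y.
  by apply: (finite_family (S := fun i => [set y | Rb i tt y])) => i; case: (RbP i).
(* Each conjugate tuple that is dependent over [K] is given a nonzero relation over [K]; a conjugate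
   at which none of these vanishes is independent over [K]. The value [1] for independent tuples
   excludes nothing. *)
have /choice[qf qfP] : forall y : 'I_N -> F, exists q : {mpoly F[N]},
    [/\ mover K q, q <> 0 & ~ alg_free K y -> q.@[y] = 0].
  move=> y; have [fy|nfy] := pselect (alg_free K y).
    exists 1; split=> //; first by rewrite -mpolyC1; apply: (moverC sfK); exact: subring1.
    by apply/eqP; exact: oner_neq0.
  apply: contrapT => H; apply: nfy => q Kq qy; apply: contrapT => q0.
  by apply: H; exists q.
have /finite_seqP[qs qsE] := finite_image qf fY.
have qsP q : q \in qs -> mover K q /\ q <> 0.
  move=> qqs; have : [set` qs] q by []. 
  by rewrite -qsE => -[y _ <-]; case: (qfP y).
pose S := (range b `|` K : set F).
(* Here [x.1] is the varying tuple [a']. The first two clauses provide a conjugate of [be] that is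
   independent over [K], the last three a nontrivial relation on it with coefficients in the hull of
   [a'] and [K]. *)
pose cond (x : (I -> F) * ('I_N + 'I_M -> F)) : Prop :=
  [/\ forall i, Rb i tt (x.2 (inl i)),
      forall q, q \in qs -> q.@[fun i => x.2 (inl i)] <> 0,
      forall k, Ra k x.1 (x.2 (inr k)),
      x.2 (inr (Ordinal M0)) <> 0
    & \sum_(k < M) x.2 (inr k) * (\prod_i x.2 (inl i) ^+ mk k i) = 0].
have [phi ephi phiE] : edef (fun a' : I -> F => with_params a' : I + S -> F)
    (fun a' => exists v, cond (a', v)).
  apply: edef_ex; set val := (fun _ => vsum _ _).
  have dv z : tdef val (fun x => x.2 z) by exists (Var (inr z)).
  have dmon (mm : 'X_{1..N}) : tdef val (fun x => \prod_i x.2 (inl i) ^+ mm i).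
    by apply: tdef_prod => i; apply: tdefX.
  have c1 : edef val (fun x => forall i, Rb i tt (x.2 (inl i))).
    apply: edef_forall => i; have [dR _ _ _] := RbP i.
    apply: (edef_subst (pi := fun x : (I -> F) * ('I_N + 'I_M -> F) => (tt, x.2 (inl i)))
      (rho := fun w => if w is Some s then Var (inl (inr s)) else Var (inr (inl i)))) dR.
    by move=> x [w|].
  have c2 : edef val (fun x => forall q, q \in qs -> q.@[fun i => x.2 (inl i)] <> 0).
    apply: edef_all => q /qsP[Kq _]; apply: edef_neq; last exact: tdef0.
    apply: tdef_ext (fun x => \sum_(mm <- msupp q) q@_mm * \prod_i x.2 (inl i) ^+ mm i) _ _ _.
      by move=> x; rewrite mevalE.
    apply: tdef_sum => mm; apply: tdefM => //.
    have Sq : S q@_mm by right; exact: Kq.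
    by exists (Var (inl (inr (exist (fun z => z \in S) _ (mem_set Sq))))).
  have c3 : edef val (fun x => forall k, Ra k x.1 (x.2 (inr k))).
    apply: edef_forall => k; have [dR _ _ _] := RaP k.
    have KS (x : K) : S (\val x) by right; exact: (set_mem (valP x)).
    apply: (edef_subst (pi := fun x : (I -> F) * ('I_N + 'I_M -> F) => (x.1, x.2 (inr k)))
      (rho := fun w => match w with
        | Some (inl i) => Var (inl (inl i))
        | Some (inr x) => Var (inl (inr (exist (fun z => z \in S) _ (mem_set (KS x)))))
        | None => Var (inr (inr k)) end)) dR.
    by move=> x [[w|w]|].
  have c4 : edef val (fun x => x.2 (inr (Ordinal M0)) <> 0).
    by apply: edef_neq => //; exact: tdef0.
  have c5 : edef val (fun x => \sum_(k < M) x.2 (inr k) * (\prod_i x.2 (inl i) ^+ mk k i) = 0).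
    by apply: edef_eq; [apply: tdef_sum => k; apply: tdefM|exact: tdef0].
  apply: edef_ext (edef_and (edef_and (edef_and c1 c2) (edef_and c3 c4)) c5) => x.
  by rewrite /cond; split=> [[[[? ?] [? ?]] ?]|[]].
exists phi.
  split=> //; apply/phiE.
  exists (fun z : 'I_N + 'I_M => match z with inl i => be i | inr k => p@_(mk k) end).
  split=> /=.
  - by move=> i; case: (RbP i).
  - by move=> q /qsP[Kq q0] qbe; apply: q0; exact: fbe.
  - by move=> k; case: (RaP k).
  - by apply/eqP; rewrite -mcoeff_msupp; exact: mem_nth.
  - by rewrite -[RHS]p0 mevalE (big_nth 0%MM) big_mkord.
move=> a' /phiE[v [v1 v2 v3 v4 v5]]; apply: symm.
rewrite (ACF_indepP _ (sfA a') (KA a')) => ind.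
pose y i := v (inl i).
have fy : alg_free K y.
  apply: contrapT => nfy; apply: (v2 (qf y)); last by case: (qfP y) => _ _; apply.
  have : [set` qs] (qf y) by rewrite -qsE; exists y.
  by [].
have By i : B (y i).
  by have [_ _ _ H] := RbP i; have := H tt _ (v1 i); rewrite rB.
have /(alg_indepE _ (sfA a')) fA : alg_indep (A_ a') y by apply: ind => //; apply/alg_indepE.
pose q : {mpoly F[N]} := \sum_(k < M) v (inr k) *: 'X_[mk k].
have q0 : q = 0.
  apply: fA.
    apply: (mover_sum (sfA a')) => k; rewrite -mul_mpolyC; apply: (moverM (sfA a')).
      apply: (moverC (sfA a')).
      by have [_ _ _ H] := RaP k; have := H a' _ (v3 k); rewrite rA.
    by apply/(mover_pred (sfA a')); exact: mpolyOverX.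
  rewrite -[RHS]v5 /q rmorph_sum; apply: eq_bigr => k _ /=.
  by rewrite mevalZ mevalX.
have := congr1 (mcoeff (mk 0%N)) q0.
rewrite /q raddf_sum /= mcoeff0 (bigD1 (Ordinal M0)) //= mcoeffZ mcoeffX eqxx mulr1.
rewrite big1 ?addr0 // => k k0.
rewrite mcoeffZ mcoeffX nth_uniq ?msupp_uniq //.
by rewrite (negPf (_ : val k != 0%N)) ?mulr0.
Qed.

End Definable.

(** * Absence of SOP1 *)

(** For each size [n], the existence of a polynomial of size [n] without roots is a sentence,
    obtained by quantifying over its coefficients with [formula_close]. *)
Lemma elementary_alg_closed (F Q : expFieldType) (f : F -> Q) :
  elementary f -> alg_closed F -> alg_closed Q.
Proof.
move=> el aF p p1; apply: contrapT => np.
pose n := size p.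
pose phi : formula (void + nat) := And (Not (Eq (Var (inr n.-1)) Zero))
  (Not (Ex (Eq (horner_term [seq inr i | i <- iota 0 n]) Zero))).
have [h _ hE] := formula_close phi.
have : sat (of_void Q) h.
  apply/hE; exists (fun i => p`_i); split=> /=.
    by apply/eqP; rewrite -lead_coefE lead_coef_eq0 -size_poly_gt0 ltnW.
  move=> [x]; rewrite eval_horner_term -map_comp /= => px; apply: np; exists x.
  apply/rootP; rewrite -[RHS]px; congr horner; apply/polyP => i; rewrite coef_Poly.
  have [lt|le] := ltnP i n; first by rewrite (nth_map 0%N) ?size_iota // nth_iota.
  by rewrite !nth_default // size_map size_iota.
rewrite (_ : of_void Q = f \o of_void F); last by apply: funext => -[].
move=> /el /hE[v /= [v0 nv]]; apply: nv.
pose q := Poly [seq v i | i <- iota 0 n].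
have qn : q`_n.-1 = v n.-1.
  rewrite coef_Poly (nth_map 0%N) ?size_iota ?prednK // ?nth_iota ?prednK //; exact: ltnW.
have [|x qx] := aF q.
  rewrite ltnNge; apply/negP => /leq_sizeP/(_ n.-1).
  rewrite qn => H; apply: v0; apply: H.
  by rewrite -ltnS prednK // ltnW.
exists x; rewrite eval_horner_term -map_comp; exact/rootP.
Qed.

Lemma compactness (F : expFieldType) V (Phi : set (formula V)) :
  (forall l : seq (formula V), (forall f, List.In f l -> Phi f) ->
     exists v : V -> F, forall f, List.In f l -> sat v f) ->
  exists (Q : expFieldType) (dg : F -> Q) (v : V -> Q),
    elementary dg /\ forall f, Phi f -> sat v f.
Proof.
move=> H; have [U [UF UP]] := list_ultrafilter (formula V).
have [Q [cl cP]] := expfield_upower F UF.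
have /choice[v vP] : forall l : seq (formula V), exists v : V -> F,
    forall f, List.In f l -> Phi f -> sat v f.
  move=> l; have [|v vP] := H [seq f <- l | `[< Phi f >]].
    by move=> f /In_filter[_ /asboolP].
  by exists v => f fl Pf; apply: vP; apply/In_filter; split=> //; apply/asboolP.
exists Q, (cdiag cl), (fun x => cl (fun l => v l x)); split.
  exact: (cdiag_elementary cP).
move=> f Pf; apply/(cl_los cP (fun x l => v l x)); apply: filterS (UP f) => l /= fl.
exact: vP.
Qed.

(** This is [iset_linindep] transported to the diagonal copy of [K] and with the two sides exchanged
    by [lin_disjoint_sym]. *)
Lemma upower_lin_disjoint (I : Type) (U : set_system I) (UF : UltraFilter U)
    (P Q : expFieldType) (cl : (I -> P) -> Q) (K : set P) : is_upower U cl ->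
  closed_subfield K ->
  lin_disjoint (iset cl K) (range (cdiag cl)) (cdiag cl @` K).
Proof.
move=> cP cK; have [[sK iK] _] := cK.
have hd := cdiag_hom cP; have [di _ _ _ _] := cdiag_embedding cP.
have [[sI _] _] := iset_closed cP cK.
have sT : subring_set [set: P] by [].
have sfdK : subfield_set (cdiag cl @` K).
  by apply: subfield_image => //; exact: hom_on_sub hd.
apply: lin_disjoint_sym => //.
  by move=> _ [x Kx <-]; exact: iset_diag.
move=> e er ie.
have [e0 e0E] : exists e0, e = map (cdiag cl) e0.
  elim: e er {ie} => [|x e IH] er; first by exists [::].
  have [y _ yx] := er x (mem_head _ _).
  have [z ze|e0 ->] := IH; first by apply: er; rewrite inE ze orbT.
  by exists (y :: e0); rewrite /= yx.
rewrite e0E; apply: (iset_linindep cP sK) => c Kc E l le; apply: di.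
rewrite (hom_on0 sT hd); rewrite e0E in ie.
apply: (ie (fun j => cdiag cl (c j))); last by rewrite size_map.
  by move=> j; exists (c j).
rewrite -(hom_on0 sT hd) -E /lc (hom_on_sum sT hd) // size_map.
by apply: eq_bigr => j _; rewrite (nth_map 0) // (hom_onM hd).
Qed.

Lemma lin_disjoint_image (P Q : expFieldType) (f : P -> Q) (C B K : set P) :
  embedding f -> lin_disjoint C B K -> lin_disjoint (f @` C) (f @` B) (f @` K).
Proof.
move=> ef ld e eC ie; have hf := embedding_hom ef; have [fi _ _ _ _] := ef.
have sT : subring_set [set: P] by [].
have [e0 e0C e0E] : exists2 e0, (forall x, x \in e0 -> C x) & e = map f e0.
  elim: e eC {ie} => [|x e IH] er; first by exists [::].
  have [y Cy yx] := er x (mem_head _ _).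
  have [z ze|e0 e0C ->] := IH; first by apply: er; rewrite inE ze orbT.
  exists (y :: e0); last by rewrite /= yx.
  by move=> z; rewrite inE => /predU1P[->|/e0C].
have lcE c : lc (fun j => f (c j)) (map f e0) = f (lc c e0).
  rewrite /lc (hom_on_sum sT hf) // size_map.
  by apply: eq_bigr => j _; rewrite (nth_map 0) // (hom_onM hf).
have ie0 : linindep K e0.
  move=> c Kc E l le; apply: fi; rewrite (hom_on0 sT hf).
  apply: (ie (fun j => f (c j))); last by rewrite e0E size_map.
    by move=> j; exists (c j).
  by rewrite e0E lcE E (hom_on0 sT hf).
move=> c Bc E l le.
have /choice[c0 c0P] : forall j, exists c0, B c0 /\ f c0 = c j.
  by move=> j; have [c0] := Bc j; exists c0.
have cE : c = fun j => f (c0 j) by apply: funext => j; case: (c0P j).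
rewrite cE; suff -> : c0 l = 0 by rewrite (hom_on0 sT hf).
apply: (ld e0 e0C ie0) => //; last by move: le; rewrite e0E size_map.
  by move=> j; case: (c0P j).
by apply: fi; rewrite -lcE -cE -e0E E (hom_on0 sT hf).
Qed.

Lemma lin_disjoint_mono (P : fieldType) (C C' B B' K : set P) :
  C' `<=` C -> B' `<=` B -> lin_disjoint C B K -> lin_disjoint C' B' K.
Proof.
move=> CC BB ld e eC ie c Bc; apply: ld => // [x /eC /CC//|j]; exact/BB/Bc.
Qed.

Lemma nat_ultrafilter : exists U : set_system nat,
  UltraFilter U /\ forall k, U [set i | (k <= i)%N].
Proof.
pose G : set_system nat := [set S | exists k, forall i, (k <= i)%N -> S i].
have PG : ProperFilter G.
  split; first by move=> [k H]; exact: (H k).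
  split=> [|A B [k Hk] [l Hl]|A B AB [k Hk]].
  - by exists 0%N.
  - exists (maxn k l) => i; rewrite geq_max => /andP[? ?]; split; [exact: Hk|exact: Hl].
  - by exists k => i /Hk /AB.
have [U [UF GU]] := ultraFilterLemma PG.
by exists U; split=> // k; apply: GU; exists k.
Qed.

Section Tree.
Variables (T : theory) (F : expFieldType).
Hypotheses (hT : JEP_refinement Efield_theory T) (hF : monster T F).
Variables (n m : nat) (phi : formula ('I_n + 'I_m)) (psi : formula ('I_m + 'I_m)).
Hypotheses (ephi : existential phi) (epsi : existential psi).
Variables (A : structure) (a : seq bool -> 'I_m -> A).
Hypotheses (Abase : amalgamation_base T A).
Hypothesis branch : forall s : nat -> bool,
  exists (B : structure) (f : A -> B) (x : 'I_n -> B),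
    [/\ models T B, embedding f & forall k, sat (join_tuple x (f \o a (mkseq s k))) phi].
Hypothesis pairs : forall eta nu, prefix (rcons eta false) nu ->
  sat (join_tuple (a (rcons eta true)) (a nu)) psi.

(** Each branch is realised in a model of its own; since [A] is an amalgamation base these models
    can be joined one at a time. The induction starts from a joint extension of [A] and [F], so that
    existential facts reflect to [F]. *)
Lemma amalgamate_branches (S : seq (nat -> bool)) :
  exists (N : structure) (e : A -> N) (f : F -> N) (x : (nat -> bool) -> 'I_n -> N),
    [/\ models T N, embedding e, embedding f
      & forall s, List.In s S -> forall k, sat (join_tuple (x s) (e \o a (mkseq s k))) phi].
Proof.
have [_ _ jep _] := hT; have [TA am] := Abase.
have TF : models T F by case: (monster_ecT hF).
elim: S => [|s S [N [e [f [x [TN ee ef xP]]]]]].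
  have [N [TN [e [f [ee ef]]]]] := jep A F TA TF.
  by exists N, e, f, (fun _ _ => szero N).
have [B [g [y [TB eg yP]]]] := branch s.
have [N' [n1 [n2 [TN' en1 en2 nE]]]] := am N B e g TN TB ee eg.
exists N', (n1 \o e), (n1 \o f),
  (fun s' => if `[< s' = s >] then n2 \o y else n1 \o x s'); split=> //.
- exact: embedding_comp.
- exact: embedding_comp.
move=> s' s'S k; case: asboolP => [->|ns].
  have := embedding_existential en2 ephi (yP k).
  by congr sat; apply: funext => -[j|j] //=; rewrite nE.
case: s'S => [ss'|s'S]; first by case: ns.
have := embedding_existential en1 ephi (xP s' s'S k).
by congr sat; apply: funext => -[j|j].
Qed.

(** Finitely many of the conditions involve finitely many branches and form an existential sentence,
    true in an extension of [F] and so in [F]; compactness then realises all branches at once. *)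
Lemma tree_in_extension : exists (P : expFieldType) (dg : F -> P)
    (al : seq bool -> 'I_m -> P) (bb : (nat -> bool) -> 'I_n -> P),
  [/\ elementary dg,
      forall s k, sat (join_tuple (bb s) (al (mkseq s k))) phi
    & forall eta nu, prefix (rcons eta false) nu ->
        sat (join_tuple (al (rcons eta true)) (al nu)) psi].
Proof.
pose V := ((seq bool * 'I_m) + ((nat -> bool) * 'I_n))%type.
pose fphi s k : formula V := fsubst (fun x => match x with
  | inl j => Var (inr (s, j)) | inr j => Var (inl (mkseq s k, j)) end) phi.
pose fpsi eta nu : formula V := fsubst (fun x => match x with
  | inl j => Var (inl (rcons eta true, j)) | inr j => Var (inl (nu, j)) end) psi.
pose Phi : set (formula V) := [set f | (exists s k, f = fphi s k) \/
  (exists eta nu, prefix (rcons eta false) nu /\ f = fpsi eta nu)].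
have ePhi f : Phi f -> existential f.
  by move=> [[s [k ->]]|[eta [nu [_ ->]]]]; exact: existential_fsubst.
have [l lP|P [dg [v [el vP]]]] := @compactness F V Phi.
  have [S SP] : exists S : seq (nat -> bool), forall f, List.In f l ->
      (exists s k, List.In s S /\ f = fphi s k) \/
      (exists eta nu, prefix (rcons eta false) nu /\ f = fpsi eta nu).
    elim: l lP => [|f l IH] lP; first by exists [::].
    have [f' f'l|S SP] := IH; first by apply: lP; right.
    have [[s [k fE]]|fE] := lP f (or_introl erefl); last first.
      by exists S => f' [<-|/SP]; [right|].
    exists (s :: S) => f' [<-|/SP[[s' [k' [s'S f'E]]]|]]; last by right.
      by left; exists s, k; split=> //; left.
    by left; exists s', k'; split=> //; right.
  have [N [e [f [x [TN ee ef xP]]]]] := amalgamate_branches S.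
  pose w (z : V) : N := match z with inl p => e (a p.1 p.2) | inr p => x p.1 p.2 end.
  have [h eh hE] := @existential_conj _ l (fun f fl => ePhi f (lP f fl)).
  have [h' eh' h'E] := existential_close (Z := void)
    (existential_fsubst (fun z => Var (inr z)) eh).
  have : sat (of_void F) h'.
    apply: (ec_sat (monster_ecT hF) TN ef eh').
    apply/h'E; exists w; rewrite sat_fsubst; apply/hE => g gl.
    have [[s [k [sS ->]]]|[eta [nu [pr ->]]]] := SP g gl; rewrite sat_fsubst.
      have := xP s sS k; congr sat; apply: funext => -[j|j] //=.
    have := embedding_existential ee epsi (pairs pr).
    by congr sat; apply: funext => -[j|j].
  by move=> /h'E[v]; rewrite sat_fsubst => /hE; exists v.
exists P, dg, (fun eta j => v (inl (eta, j))), (fun s j => v (inr (s, j))); split=> //.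
- move=> s k; have := vP (fphi s k) (or_introl (ex_intro _ s (ex_intro _ k erefl))).
  by rewrite sat_fsubst; congr sat; apply: funext => -[j|j].
- move=> eta nu pr; have : Phi (fpsi eta nu) by right; exists eta, nu.
  by move=> /vP; rewrite sat_fsubst; congr sat; apply: funext => -[j|j].
Qed.

End Tree.

(* The path [eta_i] turns right after a run of zeros; on the way it leaves
   behind a right turn with the same formulas of index less than [i]. *)
Lemma tree_selection (X : Type) (al : seq bool -> X) (truth : X -> nat -> bool) :
  exists (ee : nat -> seq bool) (dd : nat -> seq bool),
    [/\ forall i, (i <= size (ee i))%N,
        forall i j, (i <= j)%N -> prefix (ee i) (ee j),
        forall i j, (i < j)%N -> prefix (rcons (dd i) false) (ee j)
      & forall i k, (k < i)%N ->
          truth (al (rcons (dd i) true)) k = truth (al (ee i.+1)) k].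
Proof.
pose nd eta k := rcons (eta ++ nseq k false) true.
have step i eta : exists p : nat * nat, (p.1 < p.2)%N /\ forall k, (k < i)%N ->
    truth (al (nd eta p.1)) k = truth (al (nd eta p.2)) k.
  pose g k : {ffun 'I_i -> bool} := [ffun j : 'I_i => truth (al (nd eta k)) j].
  pose N := #|{ffun 'I_i -> bool}|.
  have : ~ injective (fun k : 'I_N.+1 => g k).
    by move=> /leq_card; rewrite card_ord ltnn.
  move=> ni; have [k [k' [kk' e]]] : exists k k', k <> k' /\ g k = g k'.
    apply: contrapT => H; apply: ni => k k' e; apply: val_inj; apply: contrapT => kk'.
    by apply: H; exists k, k'.
  wlog lt : k k' kk' e / (k < k')%N.
    move=> W; have [kl|kl|//] := ltngtP k k'; first exact: (W k k').
    by apply: (W k' k) => //; exact: nesym.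
  exists (k, k'); split=> // j ji.
  by have /ffunP/(_ (Ordinal ji)) := e; rewrite !ffunE.
have /choice[s sP] : forall q : nat * seq bool, exists p : nat * nat,
    (p.1 < p.2)%N /\ forall k, (k < q.1)%N ->
    truth (al (nd q.2 p.1)) k = truth (al (nd q.2 p.2)) k.
  by move=> [i eta]; exact: step.
(* Of two agreeing numbers of zeros the larger one continues the path and the smaller one gives the
   side node. The path thus passes through [rcons (dd i) false], while the side node is
   [rcons (dd i) true]. *)
pose ee := fix ee i := if i is i'.+1 then nd (ee i') (s (i', ee i')).2 else [::].
pose dd i := ee i ++ nseq (s (i, ee i)).1 false.
have sub1 i : prefix (ee i) (ee i.+1).
  by rewrite /= /nd rcons_cat; exact: prefix_prefix.
have sub i j : (i <= j)%N -> prefix (ee i) (ee j).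
  move=> /subnK <-; elim: (j - i)%N => [|k IH]; first exact: prefix_refl.
  exact: prefix_trans IH (sub1 _).
exists ee, dd; split=> //.
- elim=> [//|i IH]; rewrite /= /nd size_rcons size_cat ltnS.
  exact: leq_trans IH (leq_addr _ _).
- move=> i j ij; apply: prefix_trans (sub i.+1 j ij).
  have [lt _] := sP (i, ee i).
  rewrite /= /nd /dd -!cats1 -!catA prefix_catr ?eqxx //.
  move: lt => /=; elim: (_.1) (_.2) => [|x IH] [|y] //=; first by rewrite prefix0s.
  by rewrite ltnS => /IH.
- by move=> i k ki; have [_ H] := sP (i, ee i); exact: H.
Qed.

Section NSOP1.
Variables (T : theory) (F : expFieldType).
Hypotheses (hT : JEP_refinement Efield_theory T) (hF : monster T F).

Theorem monster_NSOP1 : NSOP1 T.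
Proof.
move=> n m phi ephi [A [psi [a [[Abase epsi] branch incons pairs]]]].
have [P [dgP [al [bb [elP brP prP]]]]] := tree_in_extension hT hF ephi epsi Abase branch pairs.
have aP : alg_closed P := elementary_alg_closed elP (monster_closed hT hF).
have natnat : injects nat nat by exists id.
have cntZ : injects (seq bool * 'I_m) nat by exists pickle; exact: pcan_inj pickleK.
have [A0 [e [ele gen A0n]]] := lowenheim_skolem (fun p => al p.1 p.2) natnat cntZ.
have ee0 := elementary_embedding ele.
pose M := range e.
have EM : EA_subfield M.
  by apply: ec_range_EA => // f ef sf; apply/ele.
have [cM _] := (EA_subfieldP M).1 EM.
have [code codei] : injects (formula ('I_m + A0)) nat.
  apply: formula_injects_nat; apply: injects_trans (injects_double natnat).
  by apply: injects_sum => //; exists (@nat_of_ord m); exact: val_inj.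
pose truth (x : 'I_m -> P) k := `[< exists2 f, code f = k & sat (vsum x e) f >].
have [ee [dd [eesize eepre ddpre agree]]] := tree_selection al truth.
(* The branch through all [ee i]; its entry at [k] is read off from [ee k.+1], which has at least
   [k.+1] entries. *)
pose s k := nth false (ee k.+1) k.
have sE i : mkseq s (size (ee i)) = ee i.
  apply: (@eq_from_nth _ false); first by rewrite size_mkseq.
  move=> k; rewrite size_mkseq => ki; rewrite nth_mkseq // /s.
  have pre (u v : seq bool) : prefix u v -> (k < size u)%N -> nth false u k = nth false v k.
    by move=> /prefixP[w ->] ku; rewrite nth_cat ku.
  have [ik|ik] := leqP i k.+1; first by apply/esym/pre => //; exact: eepre.
  by apply: pre; [apply: eepre; exact: ltnW|exact: eesize].
pose b := bb s.
pose c0_ i := al (ee i.+1); pose c1_ i := al (rcons (dd i) true).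
have bphi i : sat (join_tuple b (c0_ i)) phi.
  by have := brP s (size (ee i.+1)); rewrite sE.
have c10 i j : (i <= j)%N -> sat (join_tuple (c1_ i) (c0_ j)) psi.
  by move=> ij; apply: prP; apply: ddpre.
have cM0 i j : M (c0_ i j) by have [x xE] := gen (ee i.+1, j); exists x.
have cM1 i j : M (c1_ i j) by have [x xE] := gen (rcons (dd i) true, j); exists x.
have [U [UF UP]] := nat_ultrafilter.
have [Q1 [cl1 cP1]] := expfield_upower P UF.
have [Q2 [cl2 cP2]] := expfield_upower Q1 UF.
pose d1 : P -> Q1 := cdiag cl1; pose d2 : Q1 -> Q2 := cdiag cl2.
have eld1 : elementary d1 by exact: (cdiag_elementary cP1).
have eld2 : elementary d2 by exact: (cdiag_elementary cP2).
have ed1 := elementary_embedding eld1; have ed2 := elementary_embedding eld2.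
have aQ1 : alg_closed Q1 := elementary_alg_closed eld1 aP.
have aQ2 : alg_closed Q2 := elementary_alg_closed eld2 aQ1.
pose M1 := d1 @` M.
have EM1 : EA_subfield M1 by exact: EA_image.
have [cM1' _] := (EA_subfieldP M1).1 EM1.
pose M2 := d2 @` M1.
have EM2 : EA_subfield M2 by exact: EA_image.
(* As [psi] is known of [c1_ i] and [c0_ j] for [i <= j], the limit over [j] is taken first, in
   [Q1], and the limit over [i] second, in [Q2]. So [c0] and [c1] lie in the ultrapower of [M1],
   linearly disjoint from the diagonal copy of [Q1]. *)
pose c2 j : Q1 := cl1 (fun i => c0_ i j).
pose c0 j : Q2 := cl2 (fun i => d1 (c0_ i j)).
pose c1 j : Q2 := cl2 (fun i => d1 (c1_ i j)).
have sb1 : sat (join_tuple (d1 \o b) c2) phi.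
  rewrite (_ : join_tuple _ _ = fun x => cl1 (fun i => join_tuple b (c0_ i) x)); last first.
    by apply: funext => -[].
  apply/(cl_los cP1 (fun x i => join_tuple b (c0_ i) x)).
  by apply: filterS filterT => i _; exact: bphi.
have sb2 : sat (join_tuple (d2 \o (d1 \o b)) c0) phi.
  rewrite (_ : join_tuple _ _ = fun x => cl2 (fun i => d1 (join_tuple b (c0_ i) x))); last first.
    by apply: funext => -[].
  apply/(cl_los cP2 (fun x i => d1 (join_tuple b (c0_ i) x))).
  apply: filterS filterT => i _; exact/(eld1 _ (join_tuple b (c0_ i)))/bphi.
have sc : sat (join_tuple c1 (d2 \o c2)) psi.
  rewrite (_ : join_tuple _ _ = fun x => cl2 (fun i => join_tuple (d1 \o c1_ i) c2 x)); last first.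
    by apply: funext => -[].
  apply/(cl_los cP2 (fun x i => join_tuple (d1 \o c1_ i) c2 x)).
  apply: filterS filterT => i _ /=.
  rewrite (_ : (fun x => _) = fun x => cl1 (fun j => join_tuple (c1_ i) (c0_ j) x)); last first.
    by apply: funext => -[].
  apply/(cl_los cP1 (fun x j => join_tuple (c1_ i) (c0_ j) x)).
  by apply: filterS (UP i) => j /= ij; exact: c10.
(* [c0_ i] and [c1_ i] agree on [f] as soon as [i] exceeds its code, so their limits have the same
   type. *)
have etp01 (f : formula ('I_m + A0)) : existential f ->
    sat (vsum c0 (d2 \o (d1 \o e))) f -> sat (vsum c1 (d2 \o (d1 \o e))) f.
  move=> _.
  have E (c_ : nat -> 'I_m -> P) :
      sat (vsum (fun j => cl2 (fun i => d1 (c_ i j))) (d2 \o (d1 \o e))) f <->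
      U [set i | sat (vsum (c_ i) e) f].
    rewrite (_ : vsum _ _ = fun x => cl2 (fun i => d1 (vsum (c_ i) e x))); last first.
      by apply: funext => -[].
    rewrite (cl_los cP2 (fun x i => d1 (vsum (c_ i) e x))).
    by split; apply: filterS => i /= H; exact/(eld1 _ (vsum (c_ i) e)).
  move=> /(E c0_) H; apply/(E c1_).
  apply: filterS (filterI H (UP (code f).+1)) => i [/= s0 fi].
  have t0 : truth (c0_ i) (code f) by apply/asboolP; exists f.
  have : truth (c1_ i) (code f) by rewrite /c1_ agree.
  by move=> /asboolP[g /codei ->].
have [R [dg [j [eldg ej jE]]]] := embed_elementary_expfield etp01.
have edg := elementary_embedding eldg.
have aR : alg_closed R := elementary_alg_closed eldg aQ2.
have jM x : M2 x -> j x = dg x.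
  by move=> [_ [_ [y _ <-] <-] <-]; exact: (jE (inr y)).
pose K := dg @` M2.
have KE : K = j @` M2.
  by apply/seteqP; split=> _ [x Mx <-]; exists x => //; rewrite jM.
have EK : EA_subfield K by exact: EA_image.
pose dP := d2 \o d1.
have edP : embedding dP by exact: embedding_comp.
(* [B1] and [B2] are the copies of [P], with [b] inside, in the two images of [Q2]. [C1] contains
   [j \o c0], which is [dg \o c1], and [C2] contains [dg \o (d2 \o c2)]. Identifying [B1] with [B2]
   makes one tuple satisfy [phi] with both members of a pair for which [psi] holds. *)
pose B1 := j @` range dP; pose B2 := dg @` range dP.
pose H0 := EA_hull (M2 `|` range c0); pose H1 := EA_hull (M2 `|` range c1).
pose C1 := j @` H0.
pose I1 := iset cl1 M; pose I2 := iset cl2 M1.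
pose C2 := dg @` (d2 @` I1).
have EI1 : EA_subfield I1 by exact: iset_EA.
have EI2 : EA_subfield I2 by exact: iset_EA.
have M2I2 : M2 `<=` I2 by move=> _ [x Mx <-]; exact: iset_diag.
have H0I2 : H0 `<=` I2.
  apply: EA_hull_min => // x [/M2I2//|[k _ <-]].
  by exists (fun i => d1 (c0_ i k)) => // i; exists (c0_ i k).
have H1I2 : H1 `<=` I2.
  apply: EA_hull_min => // x [/M2I2//|[k _ <-]].
  by exists (fun i => d1 (c1_ i k)) => // i; exists (c1_ i k).
have C1E : C1 = dg @` H1.
  rewrite /C1 /H0 /H1 !EA_hull_image //; congr EA_hull; rewrite !image_setU -/K -KE.
  congr setU; apply/seteqP; split=> _ [_ [k _ <-] <-].
    by exists (c1 k); [exists k|rewrite -(jE (inl k))].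
  by exists (c0 k); [exists k|rewrite (jE (inl k))].
have rE : range dP = d2 @` range d1.
  by apply/seteqP; split=> [_ [x _ <-]|_ [_ [x _ <-] <-]]; [exists (d1 x) => //; exists x|exists x].
have EdP : EA_subfield (range dP) by apply: EA_image => //; exact: EA_setT.
have MM2 : M2 `<=` range dP by move=> _ [_ [x _ <-] <-]; exists x.
have [_ _ _ _ [_ dgE]] := edg; have [dgi _ _ _ _] := edg; have [ji _ _ _ [_ jX]] := ej.
have hdg := embedding_hom edg; have hj := embedding_hom ej.
have /choice[tau tP] : forall x, exists y, forall z, j z = x -> dg z = y.
  move=> x; have [[z zx]|nz] := pselect (exists z, j z = x); last first.
    by exists 0 => z zx; case: nz; exists z.
  by exists (dg z) => z' z'x; congr dg; apply: ji; rewrite zx.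
have tj z : tau (j z) = dg z by apply/esym; exact: tP.
have EB1 : EA_subfield B1 by exact: EA_image.
have EC1 : EA_subfield C1 by apply: EA_image => //; exact: EA_hull_EA.
have EC2 : EA_subfield C2 by apply: EA_image => //; exact: EA_image.
have KB1 : K `<=` B1 by rewrite KE => _ [x Mx <-]; exists x => //; exact: MM2.
have KC1 : K `<=` C1.
  by rewrite KE => _ [x Mx <-]; exists x => //; apply: sub_EA_hull; left.
have KC2 : K `<=` C2.
  move=> _ [_ [x Mx <-] <-]; exists (d2 x) => //; exists x => //.
  by case: Mx => y My <-; exact: iset_diag.
have htau : hom_on B1 tau.
  split.
  - by have := tj 1; rewrite (hom_on1 hj) (hom_on1 hdg).
  - by move=> _ _ [x _ <-] [y _ <-]; rewrite -(hom_onB hj) // !tj (hom_onB hdg).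
  - by move=> _ _ [x _ <-] [y _ <-]; rewrite -(hom_onM hj) // !tj (hom_onM hdg).
have tauB x : B1 x -> B2 (tau x) by move=> [y yP <-]; rewrite tj; exists y.
have tauE x : B1 x -> tau (expf x) = expf (tau x).
  by move=> [y _ <-]; rewrite tj -[expf (j y)](jX y) tj; exact: dgE.
have tauK x : K x -> tau x = x by rewrite KE => -[y My <-]; rewrite tj jM.
have ld1 : lin_disjoint C1 B1 K.
  rewrite KE; apply: lin_disjoint_image => //.
  apply: (lin_disjoint_mono H0I2 _ (upower_lin_disjoint UF cP2 cM1')).
  by rewrite rE => _ [x _ <-]; exists x.
have ld2 : lin_disjoint C2 B2 K.
  apply: lin_disjoint_image => //; rewrite rE; apply: lin_disjoint_image => //.
  exact: (upower_lin_disjoint UF cP1 cM).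
(* An element of the ultrapower of [M1] that is diagonal comes from [M1]. *)
have C12 x : C1 x -> C2 x -> K x.
  rewrite C1E => -[y H1y <-] [z [t I1t tz] /dgi zy].
  exists y => //; rewrite -zy -tz; exists t => //.
  have : I2 (cl2 (fun=> t)) by rewrite [cl2 _]tz zy; exact: H1I2.
  by move=> /(iset_aeP cP2)/filter_ex[].
have [N [i [p1 [p2 [[ei ep1 ep2] p1C p2C p12]]]]] := three_amalgam aR EK EB1 EC1 EC2
  KB1 KC1 KC2 htau tauB tauE tauK ld1 ld2 C12.
pose x0 := p1 \o (j \o (dP \o b)).
have y1E : p1 \o (j \o c0) = i \o (dg \o c1).
  apply: funext => k /=; rewrite p1C; first by rewrite (jE (inl k)).
  by exists (c0 k) => //; apply: sub_EA_hull; right; exists k.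
have s1 : sat (join_tuple x0 (i \o (dg \o c1))) phi.
  rewrite -y1E; have := embedding_existential (embedding_comp ep1 ej) ephi sb2.
  by congr sat; apply: funext => -[].
have s2 : sat (join_tuple x0 (i \o (dg \o (d2 \o c2)))) phi.
  have := embedding_existential (embedding_comp ep2 (embedding_comp edg ed2)) ephi sb1.
  congr sat; apply: funext => -[k|k] /=.
    rewrite /x0 /= p12 ?tj //; exists (dP (b k)) => //; by exists (b k).
  apply: p2C; exists (d2 (c2 k)) => //; exists (c2 k) => //.
  by exists (fun i => c0_ i k).
have s3 : sat (join_tuple (i \o (dg \o c1)) (i \o (dg \o (d2 \o c2)))) psi.
  have := embedding_existential (embedding_comp ei edg) epsi sc.
  by congr sat; apply: funext => -[].
pose V := ('I_n + ('I_m + 'I_m))%type.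
pose f1 : formula (void + V) := fsubst (fun x => match x with
  | inl k => Var (inr (inl k)) | inr k => Var (inr (inr (inl k))) end) phi.
pose f2 : formula (void + V) := fsubst (fun x => match x with
  | inl k => Var (inr (inl k)) | inr k => Var (inr (inr (inr k))) end) phi.
pose f3 : formula (void + V) := fsubst (fun x => match x with
  | inl k => Var (inr (inr (inl k))) | inr k => Var (inr (inr (inr k))) end) psi.
have [|h eh hE] := @existential_conj _ [:: f1; f2; f3].
  by move=> f [<-|[<-|[<-|//]]]; exact: existential_fsubst.
have [h' eh' h'E] := existential_close eh.
have : sat (of_void F) h'.
  apply: (ec_sat (monster_ec hT hF) (efield_structure_models N)
    (f := i \o (dg \o (dP \o dgP))) _ eh').
    do 3?apply: embedding_comp => //; exact: elementary_embedding.
  apply/h'E; exists (fun x => match x with inl k => x0 k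
    | inr (inl k) => i (dg (c1 k)) | inr (inr k) => i (dg (d2 (c2 k))) end).
  apply/hE => f [<-|[<-|[<-|//]]]; rewrite sat_fsubst.
  - by move: s1; congr sat; apply: funext => -[].
  - by move: s2; congr sat; apply: funext => -[].
  - by move: s3; congr sat; apply: funext => -[].
move=> /h'E[v /hE hv].
have TF : models T F by case: (monster_ecT hF).
apply: (incons F TF).
exists (fun k => v (inl k)), (fun k => v (inr (inl k))), (fun k => v (inr (inr k))).
split.
- have := hv f3 (or_intror (or_intror (or_introl erefl))).
  by rewrite sat_fsubst; congr sat; apply: funext => -[].
- have := hv f1 (or_introl erefl).
  by rewrite sat_fsubst; congr sat; apply: funext => -[].
- have := hv f2 (or_intror (or_introl erefl)).
  by rewrite sat_fsubst; congr sat; apply: funext => -[].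
Qed.

End NSOP1.

(** * Invariance under automorphisms *)

(** In the form [aind], independence is transported one polynomial at a time, since [f] maps
    [adj B s] onto the ring generated by the images. *)
Lemma alg_indep_image (F : expFieldType) (f : F -> F) (B : set F) n (a : 'I_n -> F) :
  embedding f -> subfield_set B -> subfield_set (f @` B) ->
  alg_indep (f @` B) (f \o a) <-> alg_indep B a.
Proof.
move=> ef sB sfB; have hf := embedding_hom ef; have [fi _ _ _ _] := ef.
have sT : subring_set [set: F] by [].
have tr R (s : seq F) : subring_set R -> f @` adj R s = adj (f @` R) (map f s).
  move=> sR; elim: s => [|x s IH] //=; rewrite -IH.
  have sA := adj_subring s sR.
  apply/seteqP; split=> [_ [_ [p Rp ->] <-]|_ [p Rp ->]].
    exists (map_poly f p); last by rewrite (hom_on_horner sT hf).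
    by move=> i; rewrite (coef_map_hom sT hf); exists p`_i.
  have hA : hom_on (adj R s) f by exact: hom_on_sub hf.
  have [q [Rq qE _]] := pover_image sA hA Rp.
  exists q.[x]; last by rewrite (hom_on_horner sT hf) // qE.
  by exists q.
have lstE k (c : 'I_k -> F) : lst (f \o c) = map f (lst c).
  by elim: k c => [|k IH] c //=; rewrite -IH.
rewrite (alg_indepE _ sfB) (alg_indepE _ sB) (alg_free_aind sfB) (alg_free_aind sB) lstE.
have [rB _] := sB.
elim: (lst a) => //= x s [IH1 IH2]; rewrite -tr //.
have rA := adj_subring s rB.
suff E : transc (f @` adj B s) (f x) <-> transc (adj B s) x.
  by tauto.
split=> tr1 p Rp px.
  apply/polyP => i; apply: fi; rewrite coef0 (hom_on0 sT hf) -(coef_map_hom sT hf).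
  rewrite (tr1 (map_poly f p)) ?coef0 //.
    by move=> k; rewrite (coef_map_hom sT hf); exists p`_k.
  by rewrite -(hom_on_horner sT hf) // px (hom_on0 sT hf).
have hA : hom_on (adj B s) f by exact: hom_on_sub hf.
have [q [Rq qE _]] := pover_image rA hA Rp.
rewrite -qE (tr1 q) ?(map_hom0 sT hf) //.
by apply: fi; rewrite (hom_on_horner sT hf) // qE px (hom_on0 sT hf).
Qed.

Lemma EA_indep_image (F : expFieldType) (f : F -> F) (A B C : set F) :
  alg_closed F -> embedding f ->
  EA_indep A C B <-> EA_indep (f @` A) (f @` C) (f @` B).
Proof.
move=> aF ef; rewrite /EA_indep -!image_setU -!EA_hull_image //.
have sf (X : set F) : subfield_set (EA_hull X) by case: (EA_hull_closed aF X).
have sfi (X : set F) : subfield_set (f @` EA_hull X).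
  by have /EA_subfieldP[[]] := EA_image ef (EA_hull_EA aF X).
have CB : EA_hull C `<=` EA_hull (B `|` C) by apply: EA_hull_mono => x; right.
have CBi : f @` EA_hull C `<=` f @` EA_hull (B `|` C) by exact: image_subset.
rewrite !ACF_indepP //; split=> H n a Aa.
  have /choice[c cP] : forall i, exists c, EA_hull (A `|` C) c /\ f c = a i.
    by move=> i; have [c] := Aa i; exists c.
  have -> : a = f \o c by apply: funext => i /=; case: (cP i).
  rewrite !alg_indep_image //; apply: H => i; by case: (cP i).
move=> Ca; apply/(alg_indep_image _ ef) => //; apply: H.
  by move=> i; exists (a i).
exact/alg_indep_image.
Qed.

Theorem theorem6p7 (T : theory) (F : expFieldType)
    (hT : JEP_refinement Efield_theory T) (hF : monster T F) :
  [/\ (* invariance under automorphisms *)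
      forall (theta : F -> F) (A B C : set F), automorphism theta ->
        small F A -> small F B -> small F C ->
        EA_indep A C B <-> EA_indep (theta @` A) (theta @` C) (theta @` B),
      (* small existentially closed models are EA-subfields *)
      forall (M : structure) (f : M -> F), existentially_closed T M ->
        small F [set: M] -> embedding f -> EA_subfield (range f),
      forall K : set F, EA_subfield K -> small F K ->
        [/\ (* (i) strong finite character *)
            forall (I J : Type) (a : I -> F) (b : J -> F),
              small F [set: I] -> small F [set: J] ->
              ~ EA_indep (range a) K (range b) ->
              exists2 phi : formula (I + (range b `|` K)),
                etp (range b `|` K) a phi
                & forall a' : I -> F, sat (with_params a') phi ->
                    ~ EA_indep (range a') K (range b),
            (* (ii) existence over K *)
            forall (I : Type) (a : I -> F), small F [set: I] ->
              EA_indep (range a) K K,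
            (* (iii) monotonicity *)
            forall (I I' J J' : Type)
                (a : I -> F) (a' : I' -> F) (b : J -> F) (b' : J' -> F),
              small F [set: I] -> small F [set: I'] ->
              small F [set: J] -> small F [set: J'] ->
              EA_indep (range a `|` range a') K (range b `|` range b') ->
              EA_indep (range a) K (range b),
            (* (iv) symmetry *)
            forall (I J : Type) (a : I -> F) (b : J -> F),
              small F [set: I] -> small F [set: J] ->
              EA_indep (range a) K (range b) -> EA_indep (range b) K (range a)
          & (* (v) independence theorem *)
            forall (I J1 J2 : Type)
                (b1 b2 : I -> F) (c1 : J1 -> F) (c2 : J2 -> F),
              small F [set: I] -> small F [set: J1] -> small F [set: J2] ->
              EA_indep (range c1) K (range c2) ->
              EA_indep (range b1) K (range c1) ->
              EA_indep (range b2) K (range c2) ->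
              etp K b1 = etp K b2 ->
              exists b : I -> F,
                etp (range c1 `|` K) b = etp (range c1 `|` K) b1 /\
                etp (range c2 `|` K) b = etp (range c2 `|` K) b2]
    & NSOP1 T].
Proof.
have aF := monster_closed hT hF.
have hc (X : set F) : closed_subfield (EA_hull X) by exact: (EA_hull_closed aF).
have sf (X : set F) : subfield_set (EA_hull X) by case: (hc X).
split.
- by move=> theta A B C [eth _] _ _ _; exact: EA_indep_image.
- move=> M f [_ ec] _ ef; apply: ec_range_EA => // phi ephi.
  by apply: (ec F f) => //; case: (monster_ecT hF).
- move=> K EK smK; have [cK _] := (EA_subfieldP K).1 EK; have [sfK _] := cK.
  have KH (X : set F) : K `<=` EA_hull (X `|` K) by move=> x Kx; apply: sub_EA_hull; right.
  split.
  + by move=> I J a b _ _; exact: strong_finite_character.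
  + by move=> I a _; rewrite /EA_indep setUid.
  + move=> I I' J J' a a' b b' _ _ _ _; rewrite /EA_indep !(EA_hull_id EK).
    move=> /(ACF_indepP _ (sf _) (KH _)) H; apply/ACF_indepP => // n x Ax Kx.
    have sub (X Y : set F) : EA_hull (X `|` K) `<=` EA_hull (X `|` Y `|` K).
      by apply: EA_hull_mono => y [?|?]; [left; left|right].
    by apply: (alg_indep_mono (sub _ _)); apply: H => // i; apply: sub; exact: Ax.
  + move=> I J a b _ _; rewrite /EA_indep !(EA_hull_id EK).
    exact: ACF_indep_sym.
  + move=> I J1 J2 b1 b2 c1 c2; exact: (independence_theorem hT hF EK smK).
- exact: (monster_NSOP1 hT hF).
Qed.
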